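(* Let $\nu$ be a strongly irreducible and proximal probability distribution on $\mathrm{GL}(E)$, $(\gamma_n)_{n\ge0}\sim\nu^{\otimes\mathbb{N}}$ and $\overline\gamma_n=\gamma_0\cdots\gamma_{n-1}$. There exist constants $C,D,\beta>0$ such that for all $f\in E^*\setminus\{0\}$, all $v\in E\setminus\{0\}$, all $n\in\mathbb{N}$ and all $t\ge0$, $$\mathbb{P}\Big(-\log\Big(\frac{|f\overline\gamma_nv|}{\|f\|\|\overline\gamma_n\|\|v\|}\Big)\ge t\Big)\le Ce^{-\beta n}+\sum_{k\ge1}Ce^{-\beta k}\,k\,N_*\nu(t/k-D,+\infty).$$
   Context: $\mathbb{K}$ a local field, $E=\mathbb{K}^d$, $d\ge2$, with Euclidean/Hermitian norm if $\mathbb{K}\in\{\mathbb{R},\mathbb{C}\}$ and max-norm otherwise. $N(g)=\log(\|g\|\|g^{-1}\|)$, $N_*\nu(a,+\infty)=\nu\{g:N(g)>a\}$. Proximal: $\nu^{*n}\{g:\rho_1(g)>\rho_2(g)\}>0$ for some $n$ ($\nu^{*n}$ law of product of $n$ i.i.d. $\nu$-variables, $\rho_i$ moduli of eigenvalues). Strongly irreducible: (a) for all $N\ge1$, $f_1,\dots,f_N\in E^*\setminus\{0\}$, $v\neq0$ there is $n$ with $\nu^{*n}\{g:\prod_if_igv\neq0\}>0$; (b) for all $N\ge1$, $f\neq0$, $v_1,\dots,v_N\neq0$ there is $n$ with $\nu^{*n}\{g:\prod_jfgv_j\neq0\}>0$. *)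

(* Defs.v *)
From HB Require Import structures.
From mathcomp Require Import all_boot all_order all_algebra.
From mathcomp Require Import all_classical all_reals all_analysis.
Set Implicit Arguments. Unset Strict Implicit. Unset Printing Implicit Defensive.
Import Order.TTheory GRing.Theory Num.Theory.
Local Open Scope classical_set_scope.
Local Open Scope ring_scope.

Section Defs.
Variable R : realType.

Definition is_absolute_value (L : fieldType) (absL : L -> R) : Prop :=
  (forall x, 0 <= absL x) /\
  (forall x, absL x = 0 <-> x = 0) /\
  (forall x y, absL (x * y) = absL x * absL y) /\
  (forall x y, absL (x + y) <= absL x + absL y).

Variable K : fieldType.
Variable abs : K -> R.

Definition ultrametric : Prop :=
  forall x y : K, abs (x + y) <= Num.max (abs x) (abs y).

Definition cauchy_seq (u : nat -> K) : Prop :=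
  forall e : R, 0 < e -> exists N, forall m n, (N <= m)%N -> (N <= n)%N ->
    abs (u m - u n) < e.

Definition converges_to (u : nat -> K) (l : K) : Prop :=
  forall e : R, 0 < e -> exists N, forall n, (N <= n)%N -> abs (u n - l) < e.

(** (K, abs) is a local field: a non-discrete, locally compact (closed unit
    ball sequentially compact), complete valued field.  In the archimedean
    case (K = R or C by Ostrowski) we fix the usual normalisation |2| = 2,
    i.e. abs is the usual absolute value / modulus. *)
Definition is_local_field : Prop :=
  is_absolute_value abs /\
  (exists x : K, abs x != 0 /\ abs x != 1) /\
  (forall u, cauchy_seq u -> exists l, converges_to u l) /\
  (forall u : nat -> K, (forall n, abs (u n) <= 1) ->
     exists phi : nat -> nat, (forall n, (phi n < phi n.+1)%N) /\
       exists l, converges_to (u \o phi) l) /\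
  (~ ultrametric -> abs 2 = 2).

Variable d : nat.

Definition vnorm (v : 'cV[K]_d) : R :=
  if `[< ultrametric >] then \big[Num.max/0]_(i < d) abs (v i 0)
  else Num.sqrt (\sum_(i < d) abs (v i 0) ^+ 2).

Definition opnorm (g : 'M[K]_d) : R :=
  sup [set vnorm (g *m v) / vnorm v | v in [set v : 'cV[K]_d | v != 0]].

Definition dualnorm (f : 'rV[K]_d) : R :=
  sup [set abs ((f *m v) 0 0) / vnorm v | v in [set v : 'cV[K]_d | v != 0]].

Definition Ncond (g : 'M[K]_d) : R := ln (opnorm g * opnorm (invmx g)).

(** Moduli of eigenvalues: rho_1(g) > rho_2(g), i.e. in a splitting extension
    (L, absL) of (K, abs) the characteristic polynomial has a root, counted
    with multiplicity, of modulus strictly larger than all the others. *)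
Definition rho1_gt_rho2 (g : 'M[K]_d) : Prop :=
  exists (L : fieldType) (iota : {rmorphism K -> L}) (absL : L -> R) (s : seq L),
    is_absolute_value absL /\ (forall x, absL (iota x) = abs x) /\
    map_poly iota (char_poly g) = \prod_(l <- s) ('X - l%:P) /\
    exists i, (i < size s)%N /\
      forall j, (j < size s)%N -> j != i -> absL s`_j < absL s`_i.

(** Borel sigma-algebra on matrices, generated by open boxes. *)
Definition mxT := 'M[K]_d.
HB.instance Definition _ := Choice.on mxT.
HB.instance Definition _ := isPointed.Build mxT 0.

Definition mx_boxes : set (set mxT) :=
  [set B | exists (a : 'M[K]_d) (r : R),
     B = [set g : mxT | forall i j, abs (g i j - a i j) < r]].

Definition mxM := g_sigma_algebraType mx_boxes.

Fixpoint rprod (gam : nat -> 'M[K]_d) (n : nat) : 'M[K]_d :=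
  match n with
  | 0 => 1%:M
  | n'.+1 => rprod gam n' *m gam n'
  end.

Definition iid_with_law (dO : measure_display) (Omega : measurableType dO)
    (P : probability Omega R) (gam : nat -> Omega -> mxM)
    (nu : probability mxM R) : Prop :=
  (forall n, measurable_fun setT (gam n)) /\
  (forall n (A : set mxM), measurable A -> P (gam n @^-1` A) = nu A) /\
  (forall n (A : nat -> set mxM), (forall i, measurable (A i)) ->
     P (\bigcap_(i in [set k | (k < n)%N]) (gam i @^-1` A i)) =
     (\prod_(i < n) P (gam i @^-1` A i))%E).

(** nu^{*n}(S) > 0, where nu^{*n} is the law of the product of n i.i.d.
    nu-distributed variables. *)
Definition conv_pos (nu : probability mxM R) (n : nat) (S : set 'M[K]_d) : Prop :=
  forall (dO : measure_display) (Omega : measurableType dO)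
    (P : probability Omega R) (gam : nat -> Omega -> mxM),
    iid_with_law P gam nu ->
    (0 < P [set w | S (rprod (fun i => gam i w) n)])%E.

Definition strongly_irreducible (nu : probability mxM R) : Prop :=
  (forall (N : nat) (fs : 'I_N -> 'rV[K]_d) (v : 'cV[K]_d),
     (1 <= N)%N -> (forall i, fs i != 0) -> v != 0 ->
     exists n, conv_pos nu n [set g | \prod_(i < N) (fs i *m g *m v) 0 0 != 0]) /\
  (forall (N : nat) (f : 'rV[K]_d) (vs : 'I_N -> 'cV[K]_d),
     (1 <= N)%N -> f != 0 -> (forall j, vs j != 0) ->
     exists n, conv_pos nu n [set g | \prod_(j < N) (f *m g *m vs j) 0 0 != 0]).

Definition proximal (nu : probability mxM R) : Prop :=
  exists n, conv_pos nu n [set g | rho1_gt_rho2 g].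

Definition corr_ratio (f : 'rV[K]_d) (g : 'M[K]_d) (v : 'cV[K]_d) : R :=
  abs ((f *m g *m v) 0 0) / (dualnorm f * opnorm g * vnorm v).

End Defs.

(* Main.v *)
Require Import Defs.
From HB Require Import structures.
From mathcomp Require Import all_boot all_order all_algebra.
From mathcomp Require Import all_classical all_reals all_analysis.
From mathcomp Require Import measurable_realfun.
From mathcomp Require Import ring lra zify.
Import Order.TTheory GRing.Theory Num.Theory.
Import numFieldNormedType.Exports.
Local Open Scope classical_set_scope.
Local Open Scope ring_scope.
Set Implicit Arguments.
Unset Strict Implicit.
Unset Printing Implicit Defensive.

(** Constants are absorbed by D, so one may work with the entrywise max norm |.|.
    By proximality the powers of some matrix of the support of some nu^{*n}
    converge projectively to a rank one matrix; multiplying it on both sides,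
    strong irreducibility gives 2d rank one limits u_i phi_i whose vectors u_i,
    respectively forms phi_i, are in general position. Hence there are a block
    length m and open sets S_i, each containing a block of length m with positive
    probability, such that |f g x| >= c |f||g||x| for g in S_i whenever
    |f u_i| >= e|f| and |phi_i x| >= e|x|, where every f (every x) violates its
    condition for less than d of the 2d indices i.

    Cut gamma_0 ... gamma_{N-1} into blocks of length m, and call a block g bad if it
    is in no S_i whose two conditions hold, for the product of f with what precedes
    g and the product of what follows g with v. One weight for each side has
    conditional expectation at most theta < 1, and the product of the two weights of
    a bad block is at least 1; so k consecutive blocks are all bad with probability
    at most 2 theta^k, and at most 4 theta^(k-1) nu(N > s) jointly with the event
    N(gamma_i) > s for a given letter of these blocks. If the first good block is the
    (k+1)-st one, the ratio |f gamma v| / (|f||gamma v|) is bounded below by the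
    condition numbers of the first km letters, one of which must be about t/(km) on
    the event |f gamma v| <= e^(-t) |f||gamma v|; summing over k bounds its
    probability. The mirror argument from the right bounds the probability of
    |f gamma v| <= e^(-t) |f gamma||v|. Applied to the coordinate forms f = e_i, it
    compares |gamma v| with |gamma||v|, and the two estimates combine. *)

(** * Absolute values and the entrywise max norm *)

(** Whether a block is bad depends on the past through f and on the future through v, so no
    filtration allows runs of bad blocks to be conditioned away one block at a time. Hence the two
    weights: each looks at one side only and can be integrated out from that side. On a run of bad
    blocks the product of all weights is at least 1, so one of the two one-sided products is, and
    Markov's inequality applies to each. The number 2d comes from here: on either side at most d - 1
    conditions fail, fewer than half, which pushes the mean of every weight strictly below 1.

    Combining the two one-sided estimates halves t up to constants; a run of k blocks of m letters
    is therefore charged to the term of index 2mk of the series, and beta is normalised by e^(-2mk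
    beta) = theta^k. For t below a constant the one-sided estimates give nothing, but D is large
    enough for the term k = 1 alone to exceed 1.

    The constants are extracted from one probability space; they hold on all of them, because the
    law of a block depends on its length and nu only. *)

Section AbsoluteValue.
Variables (R : realType) (L : fieldType) (abs : L -> R).
Hypothesis absP : is_absolute_value abs.

Lemma abs_ge0 x : 0 <= abs x. Proof. by case: absP. Qed.

Lemma abs_eq0 x : (abs x == 0) = (x == 0).
Proof. by apply/eqP/eqP; case: absP => _ [/(_ x) []]. Qed.

Lemma abs0 : abs 0 = 0. Proof. by apply/eqP; rewrite abs_eq0. Qed.

Lemma absM x y : abs (x * y) = abs x * abs y.
Proof. by case: absP => _ [_ []]. Qed.

Lemma absD x y : abs (x + y) <= abs x + abs y.
Proof. by case: absP => _ [_ []]. Qed.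

Lemma abs_gt0 x : (0 < abs x) = (x != 0).
Proof. by rewrite lt_def abs_eq0 abs_ge0 andbT. Qed.

Lemma abs1 : abs 1 = 1.
Proof.
have n1 : abs 1 != 0 by rewrite abs_eq0 oner_neq0.
by apply: (mulfI n1); rewrite -absM !mulr1.
Qed.

Lemma absN x : abs (- x) = abs x.
Proof.
suff h : abs (-1) = 1 by rewrite -mulN1r absM h mul1r.
apply/eqP; rewrite -sqrp_eq1 ?abs_ge0//.
by rewrite expr2 -absM mulrNN mulr1 abs1.
Qed.

Lemma absX x n : abs (x ^+ n) = abs x ^+ n.
Proof. by elim: n => [|n IH]; rewrite ?expr0 ?abs1// !exprS absM IH. Qed.

Lemma absV x : abs x^-1 = (abs x)^-1.
Proof.
have [->|x0] := eqVneq x 0; first by rewrite invr0 abs0 invr0.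
have n1 : abs x != 0 by rewrite abs_eq0.
by apply: (mulfI n1); rewrite -absM !divff// abs1.
Qed.

Lemma abs_distC x y : abs (x - y) = abs (y - x).
Proof. by rewrite -absN opprB. Qed.

Lemma absB_ge x y : abs x - abs y <= abs (x - y).
Proof. by rewrite lerBlDr (le_trans _ (absD _ _))// subrK. Qed.

Lemma abs_sum (I : Type) (r : seq I) (P : pred I) (F : I -> L) :
  abs (\sum_(i <- r | P i) F i) <= \sum_(i <- r | P i) abs (F i).
Proof.
elim/big_ind2 : _ => [|x1 x2 y1 y2 h1 h2|//]; first by rewrite abs0.
by rewrite (le_trans (absD _ _))// lerD.
Qed.

(** A single norm for forms, vectors, matrices and scalars (the 1 x 1 case), submultiplicative up to
    the inner dimension. *)
Definition mxnorm m n (A : 'M[L]_(m, n)) : R :=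
  \big[Num.max/0]_(p : 'I_m * 'I_n) abs (A p.1 p.2).

Lemma mxnorm_ge0 m n (A : 'M[L]_(m, n)) : 0 <= mxnorm A.
Proof. exact: bigmax_ge_id. Qed.

Lemma abs_le_mxnorm m n (A : 'M[L]_(m, n)) i j : abs (A i j) <= mxnorm A.
Proof. exact: (le_bigmax _ (fun p : 'I_m * 'I_n => abs (A p.1 p.2)) (i, j)). Qed.

Lemma mxnorm_leP m n (A : 'M[L]_(m, n)) r : 0 <= r ->
  (forall i j, abs (A i j) <= r) -> mxnorm A <= r.
Proof. by move=> r0 h; apply: bigmax_le => // -[i j] _; exact: h. Qed.

Lemma mxnorm_ltP m n (A : 'M[L]_(m, n)) r : 0 < r ->
  (forall i j, abs (A i j) < r) -> mxnorm A < r.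
Proof. by move=> r0 h; apply: bigmax_lt => // -[i j] _; exact: h. Qed.

Lemma mxnorm_attained m n (A : 'M[L]_(m, n)) : mxnorm A != 0 ->
  exists i j, mxnorm A = abs (A i j).
Proof.
move=> A0; apply: contrapT => h; move/eqP: A0; apply.
apply/eqP; rewrite eq_le mxnorm_ge0 andbT leNgt; apply/negP => A0.
have : mxnorm A < mxnorm A; last by rewrite ltxx.
apply: mxnorm_ltP => // i j; rewrite lt_neqAle abs_le_mxnorm andbT.
by apply/eqP => e; apply: h; exists i, j.
Qed.

Lemma mxnorm_eq0 m n (A : 'M[L]_(m, n)) : (mxnorm A == 0) = (A == 0).
Proof.
apply/eqP/eqP => [h|->]; last first.
  by apply/eqP; rewrite eq_le mxnorm_ge0 mxnorm_leP// => i j; rewrite mxE abs0.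
apply/matrixP => i j; rewrite mxE; apply/eqP; rewrite -abs_eq0.
by rewrite eq_le abs_ge0 andbT -h abs_le_mxnorm.
Qed.

Lemma mxnorm0 m n : mxnorm (0 : 'M[L]_(m, n)) = 0.
Proof. by apply/eqP; rewrite mxnorm_eq0. Qed.

Lemma mxnorm_gt0 m n (A : 'M[L]_(m, n)) : (0 < mxnorm A) = (A != 0).
Proof. by rewrite lt_def mxnorm_eq0 mxnorm_ge0 andbT. Qed.

Lemma mxnormD m n (A B : 'M[L]_(m, n)) : mxnorm (A + B) <= mxnorm A + mxnorm B.
Proof.
apply: mxnorm_leP => [|i j]; first by rewrite addr_ge0 ?mxnorm_ge0.
by rewrite mxE (le_trans (absD _ _))// lerD ?abs_le_mxnorm.
Qed.

Lemma mxnormZ m n c (A : 'M[L]_(m, n)) : mxnorm (c *: A) = abs c * mxnorm A.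
Proof.
have le a (B : 'M[L]_(m, n)) : mxnorm (a *: B) <= abs a * mxnorm B.
  apply: mxnorm_leP => [|i j]; first by rewrite mulr_ge0 ?abs_ge0 ?mxnorm_ge0.
  by rewrite mxE absM ler_wpM2l ?abs_ge0 ?abs_le_mxnorm.
have [->|c0] := eqVneq c 0; first by rewrite scale0r mxnorm0 abs0 mul0r.
apply/eqP; rewrite eq_le le/= -ler_pdivlMl ?abs_gt0// -absV.
by rewrite (le_trans _ (le _ _))// scalerK.
Qed.

Lemma mxnormN m n (A : 'M[L]_(m, n)) : mxnorm (- A) = mxnorm A.
Proof. by rewrite -scaleN1r mxnormZ absN abs1 mul1r. Qed.

Lemma mxnorm_distC m n (A B : 'M[L]_(m, n)) : mxnorm (A - B) = mxnorm (B - A).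
Proof. by rewrite -mxnormN opprB. Qed.

Lemma mxnormB_ge m n (A B : 'M[L]_(m, n)) :
  mxnorm A - mxnorm B <= mxnorm (A - B).
Proof. by rewrite lerBlDr (le_trans _ (mxnormD _ _))// subrK. Qed.

Lemma mxnormM m n p (A : 'M[L]_(m, n)) (B : 'M[L]_(n, p)) :
  mxnorm (A *m B) <= n%:R * mxnorm A * mxnorm B.
Proof.
apply: mxnorm_leP => [|i j]; first by rewrite !mulr_ge0 ?mxnorm_ge0.
rewrite mxE (le_trans (abs_sum _ _ _))//.
rewrite (@le_trans _ _ (\sum_(i < n) mxnorm A * mxnorm B))//; last first.
  by rewrite sumr_const card_ord -mulrA mulr_natl.
by apply: ler_sum => k _; rewrite absM ler_pM ?abs_ge0 ?abs_le_mxnorm.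
Qed.

Lemma mxnorm_tr m n (A : 'M[L]_(m, n)) : mxnorm A^T = mxnorm A.
Proof.
suff le k l (B : 'M[L]_(k, l)) : mxnorm B^T <= mxnorm B.
  by apply/eqP; rewrite eq_le le/= -{1}(trmxK A) le.
by apply: mxnorm_leP => [|i j]; rewrite ?mxnorm_ge0// mxE abs_le_mxnorm.
Qed.

Lemma mxnorm11 (A : 'M[L]_1) : mxnorm A = abs (A 0 0).
Proof.
apply/eqP; rewrite eq_le abs_le_mxnorm andbT; apply: mxnorm_leP => [|i j].
  exact: abs_ge0.
by rewrite !ord1.
Qed.

Lemma mxnorm_rank1 m n (u : 'cV[L]_m) (f : 'rV[L]_n) :
  mxnorm (u *m f) <= mxnorm u * mxnorm f.
Proof. by rewrite (le_trans (mxnormM _ _))// mul1r. Qed.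

Lemma mxnorm_unit_row m n (A : 'M[L]_n) (f : 'M[L]_(m, n)) : A \in unitmx ->
  mxnorm f <= n%:R * mxnorm (f *m A) * mxnorm (invmx A).
Proof. by move=> uA; rewrite -{1}(mulmxK uA f) mxnormM. Qed.

Lemma mxnorm_unit_col m n (A : 'M[L]_m) (v : 'M[L]_(m, n)) : A \in unitmx ->
  mxnorm v <= m%:R * mxnorm (invmx A) * mxnorm (A *m v).
Proof. by move=> uA; rewrite -{1}(mulKmx uA v) mxnormM. Qed.

(** Up to the scalar [c], [f g x] is [(f u)(phi x)] minus the error [f (u phi - c g) x]. The first
    is at least [e ^ 2 |f||x|], the second at most half of that by the choice of [del]. Both sides
    being homogeneous in [g], the bound [|c||g| <= B] then removes [c]. *)
Lemma near_rank1_mul n (g : 'M[L]_n) c (u : 'cV_n) (phi : 'rV_n)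
  (f : 'rV_n) (x : 'cV_n) (e del B : R) :
  c != 0 -> 0 < e -> 0 < del -> n%:R * n%:R * del <= e * e / 2 ->
  mxnorm u * mxnorm phi + del <= B ->
  mxnorm (c *: g - u *m phi) < del ->
  e * mxnorm f <= mxnorm (f *m u) -> e * mxnorm x <= mxnorm (phi *m x) ->
  e * e / (2 * B) * (mxnorm f * mxnorm g * mxnorm x) <= mxnorm (f *m g *m x).
Proof.
move=> c0 e0 d0 hd hB hg hf hx.
have ac0 : 0 < abs c by rewrite abs_gt0.
have B0 : 0 < B.
  by rewrite (lt_le_trans _ hB)// ltr_wpDl// mulr_ge0 ?mxnorm_ge0.
have cg : abs c * mxnorm g <= B.
  rewrite -mxnormZ (le_trans _ hB)//.
  rewrite -[X in mxnorm X](subrK (u *m phi)) addrC (le_trans (mxnormD _ _))//.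
  by rewrite lerD ?mxnorm_rank1// ltW.
have key : e * e / 2 * (mxnorm f * mxnorm x) <= abs c * mxnorm (f *m g *m x).
  rewrite -mxnormZ.
  have -> : c *: (f *m g *m x) =
      (f *m u) *m (phi *m x) - (f *m (u *m phi - c *: g) *m x).
    rewrite mulmxBr mulmxBl !mulmxA opprB addrC subrK.
    by rewrite -scalemxAr -scalemxAl.
  rewrite (le_trans _ (mxnormB_ge _ _))//.
  have -> : mxnorm (f *m u *m (phi *m x)) = mxnorm (f *m u) * mxnorm (phi *m x).
    by rewrite !mxnorm11 mxE big_ord1 absM.
  have h1 : e * mxnorm f * (e * mxnorm x) <= mxnorm (f *m u) * mxnorm (phi *m x).
    by rewrite ler_pM ?mulr_ge0 ?mxnorm_ge0// ltW.
  have h2 : mxnorm (f *m (u *m phi - c *: g) *m x) <=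
            n%:R * n%:R * del * (mxnorm f * mxnorm x).
    rewrite (le_trans (mxnormM _ _))//.
    rewrite (@le_trans _ _ (n%:R * (n%:R * mxnorm f * del) * mxnorm x))//.
      rewrite ler_wpM2r ?mxnorm_ge0// ler_wpM2l//.
      rewrite (le_trans (mxnormM _ _))// ler_wpM2l ?mulr_ge0 ?mxnorm_ge0//.
      by rewrite mxnorm_distC ltW.
    by rewrite le_eqVlt; apply/orP; left; apply/eqP; ring.
  have h3 := ler_wpM2r (mulr_ge0 (mxnorm_ge0 f) (mxnorm_ge0 x)) hd.
  rewrite lerBrDr; move: h1 h2 h3; nra.
rewrite -(ler_pM2l ac0) (le_trans _ key)//.
have -> : abs c * (e * e / (2 * B) * (mxnorm f * mxnorm g * mxnorm x)) =
    e * e / 2 * (mxnorm f * mxnorm x) * ((abs c * mxnorm g) / B).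
  by field; rewrite gt_eqF.
rewrite ler_piMr//; last by rewrite ler_pdivrMr// mul1r.
by rewrite !mulr_ge0 ?mxnorm_ge0 ?invr_ge0// ltW.
Qed.

End AbsoluteValue.

(* Extending a basis of the eigenspace to a basis of the whole space, ('X - lambda)
   can be factored out of as many rows of the characteristic matrix as the
   eigenspace has dimensions. *)
Lemma eigenspace_simple_root (F : fieldType) n (G : 'M[F]_n) l (q : {poly F}) :
  char_poly G = ('X - l%:P) * q -> q.[l] != 0 -> (\rank (kermx (G - l%:M)) <= 1)%N.
Proof.
move=> chiE ql; rewrite leqNgt; apply/negP => rk.
set A := kermx _ in rk; set r := \rank A in rk.
have rn : (r <= n)%N := rank_leq_row A.
pose P := row_ebase A.
have PG : pid_mx r *m P *m (G - l%:M) = 0 :> 'M[F]_n.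
  have -> : pid_mx r *m P = invmx (col_ebase A) *m A.
    by rewrite -{2}(mulmx_ebase A) -mulmxA mulKmx// col_ebase_unit.
  by rewrite -mulmxA mulmx_ker mulmx0.
have rowE (i : 'I_n) j : (i < r)%N -> (P *m G) i j = l * P i j.
  move=> ir; move/matrixP/(_ i j): PG; rewrite -mulmxA mulmxBr mul_mx_scalar mxE.
  rewrite (bigD1 i)//= big1 ?addr0; last first.
    by move=> k ki; rewrite mxE eq_sym val_eqE (negbTE ki) mul0r.
  by rewrite !mxE eqxx ir mul1r => /eqP; rewrite subr_eq0 => /eqP.
pose Pp := map_mx polyC P.
pose D : 'rV[{poly F}]_n := \row_i if (i < r)%N then 'X - l%:P else 1.
pose N := Pp *m char_poly_mx G.
pose N' : 'M[{poly F}]_n := \matrix_(i, j) if (i < r)%N then Pp i j else N i j.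
have NE : N = diag_mx D *m N'.
  apply/matrixP => i j; rewrite mul_diag_mx [RHS]mxE [D 0 i]mxE [N' i j]mxE.
  case: ifPn => ir; last by rewrite mul1r.
  rewrite /char_poly_mx /N mulmxBr mul_mx_scalar -map_mxM !mxE.
  have := rowE i j ir; rewrite mxE => ->.
  by rewrite /= polyCM mulrBl.
have detN : \det Pp * char_poly G = (\prod_i D 0 i) * \det N'.
  by rewrite -det_diag -!det_mulmx -/N NE.
have i0P : (0 < n)%N by apply: leq_trans rn; apply: ltn_trans rk.
have i1P : (1 < n)%N by apply: leq_trans rn.
have : (\prod_i D 0 i) = ('X - l%:P) * (('X - l%:P) *
    \prod_(i | (i != Ordinal i0P) && (i != Ordinal i1P)) D 0 i).
  rewrite (bigD1 (Ordinal i0P))//= (bigD1 (Ordinal i1P))//=.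
  by rewrite !mxE /= rk (ltn_trans _ rk).
move=> DE; move: detN; rewrite chiE DE mulrCA -!mulrA.
move/(mulfI (negbT (polyXsubC_eq0 l))) => /(congr1 (fun p => p.[l])).
rewrite !hornerM hornerXsubC subrr mul0r => /eqP; rewrite mulf_eq0 (negbTE ql) orbF.
rewrite /Pp det_map_mx hornerC => /eqP dP.
by have := row_ebase_unit A; rewrite -/P unitmxE dP unitr0.
Qed.

Lemma horner_mx_eigen (F : fieldType) n (G : 'M[F]_n.+1) (v : 'rV_n.+1) a (q : {poly F}) :
  v *m G = a *: v -> v *m horner_mx G q = q.[a] *: v.
Proof.
move=> vG; elim/poly_ind: q => [|q c IH]; first by rewrite rmorph0 mulmx0 horner0 scale0r.
rewrite rmorphD rmorphM /= horner_mx_X horner_mx_C hornerMXaddC mulmxDr.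
by rewrite -mulmxE mulmxA IH -scalemxAl vG scalerA mul_mx_scalar scalerDl.
Qed.

Lemma scalar_mul (F : fieldType) n a (B : 'M[F]_n.+1) : a%:M * B = a *: B.
Proof. exact: mul_scalar_mx. Qed.

Lemma mul_scalar (F : fieldType) n a (B : 'M[F]_n.+1) : B * a%:M = a *: B.
Proof. exact: mul_mx_scalar. Qed.

(** * Powers of a proximal matrix *)

Section Decay.
Variable R : realType.

Definition tends0 (a : nat -> R) :=
  forall e, 0 < e -> exists N, forall p, (N <= p)%N -> a p < e.

Lemma tends0_contraction (rho : R) (a b : nat -> R) :
  0 <= rho < 1 -> (forall p, 0 <= a p) -> (forall p, a p.+1 <= rho * a p + b p) ->
  tends0 b -> tends0 a.
Proof.
move=> /andP[r0 r1] a0 ab b0 e e0.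
(* An input of size [e * (1 - rho) / 2] makes [e / 2] the fixed point of the recursion. *)
have [N hN] := b0 (e * (1 - rho) / 2) ltac:(rewrite !mulr_gt0 ?subr_gt0 ?invr_gt0//).
have key k : a (N + k)%N <= rho ^+ k * a N + e / 2.
  elim: k => [|k IH]; first by rewrite addn0 expr0 mul1r lerDl divr_ge0// ltW.
  rewrite addnS (le_trans (ab _))// exprS.
  have := hN (N + k)%N (leq_addr _ _); have := ler_wpM2l r0 IH.
  nra.
have : (fun k => rho ^+ k) @ \oo --> (0 : R) by apply: cvg_expr; rewrite ger0_norm.
move=> /cvgrPdist_lt /(_ (e / 2 / (a N + 1))) [|M _ hM].
  by rewrite divr_gt0 ?divr_gt0// ltr_wpDl.
exists (N + M)%N => p Np.
have -> : p = (N + (p - N))%N by lia.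
rewrite (le_lt_trans (key _))//.
have := hM (p - N)%N ltac:(rewrite /=; lia).
rewrite sub0r normrN ger0_norm ?exprn_ge0// ltr_pdivlMr ?ltr_wpDl//.
have := exprn_ge0 (p - N) r0; nra.
Qed.

End Decay.

Section Proximal.
Variables (R : realType) (K : fieldType) (abs : K -> R).
Hypothesis absP : is_absolute_value abs.

(** Induction on the roots replaces a Jordan form: [X_p = l ^- p G ^ p W] satisfies
    [X_(p+1) = (mu / l) X_p + l^-1 Y_p], where [Y_p] is the same sequence for [(G - mu) W]. That
    matrix is killed by the remaining factors, so [Y_p] tends to 0, and [|mu / l| < 1]. *)
Lemma scaled_power_decay n (G W : 'M[K]_n.+1) l (r : seq K) :
  l != 0 -> (forall mu, mu \in r -> abs mu < abs l) ->
  (\prod_(mu <- r) (G - mu%:M)) * W = 0 ->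
  tends0 (fun p => mxnorm abs ((l ^- p) *: (G ^+ p * W))).
Proof.
move=> l0; elim: r W => [|mu r IH] W hr.
  rewrite big_nil mul1r => -> e e0; exists 0%N => p _.
  by rewrite mulr0 scaler0 mxnorm0.
rewrite big_cons => hW.
have al : 0 < abs l by rewrite abs_gt0.
have cG (s : seq K) : (G - mu%:M) * \prod_(x <- s) (G - x%:M) =
    \prod_(x <- s) (G - x%:M) * (G - mu%:M).
  have sc a (B : 'M[K]_n.+1) : GRing.comm B a%:M := scalar_mxC a B.
  have c1 x : GRing.comm (G - mu%:M) (G - x%:M).
    by apply: commrB; [apply/commr_sym/commrB => //; exact: sc | exact: sc].
  apply: (big_ind (GRing.comm (G - mu%:M))) => [|A B|x _].
  - exact: commr1.
  - exact: commrM.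
  - exact: c1.
have hb0 : \prod_(j <- r) (G - j%:M) * ((G - mu%:M) * W) = 0.
  by rewrite mulrA -cG.
have hb := fun hm => IH _ hm hb0.
have {}hb := hb (fun nu h => hr nu (@mem_behead _ (mu :: r) nu h)).
pose b p := (abs l)^-1 * mxnorm abs (l ^- p *: (G ^+ p * ((G - mu%:M) * W))).
apply: (@tends0_contraction _ (abs mu / abs l) _ b).
- by rewrite divr_ge0 ?abs_ge0//= ltr_pdivrMr// mul1r hr// mem_head.
- by move=> p; exact: mxnorm_ge0.
- move=> p; rewrite /b -absV// -mulrA.
  have -> : l ^- p.+1 *: (G ^+ p.+1 * W) = (mu / l) *: (l ^- p *: (G ^+ p * W)) +
       l^-1 *: (l ^- p *: (G ^+ p * ((G - mu%:M) * W))).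
    have -> : G ^+ p * ((G - mu%:M) * W) = G ^+ p.+1 * W - mu *: (G ^+ p * W).
      rewrite mulrBl mulrBr mulrA -exprSr; congr (_ - _).
      by rewrite scalar_mul -scalerAr.
    rewrite !scalerBr !scalerA [X in X *: (G ^+ p * W)](_ : _ = l^-1 / l ^+ p * mu); last by ring.
    by rewrite addrC subrK exprS invfM.
  rewrite (le_trans (mxnormD absP _ _))// !(mxnormZ absP) (absM absP).
  by rewrite -!mulrA.
- move=> e e0; have [N hN] := hb (e * abs l) (mulr_gt0 e0 al).
  by exists N => p /hN h; rewrite /b mulrC ltr_pdivrMr.
Qed.


(** [Pi = Q(G)] is, up to the factor [Q(l)], the projection onto the eigenspace of [l].
    Cayley-Hamilton gives [G Pi = l Pi], so scaled powers fix [Pi], and puts the rows of [Pi] in a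
    simple eigenspace, whence the rank; an eigenvector [v] has [v Pi = Q(l) v], so [Pi] is
    nonzero. *)
Lemma proximal_power n (G : 'M[K]_n.+1) l (r : seq K) :
  let Q := \prod_(mu <- r) ('X - mu%:P) in
  char_poly G = ('X - l%:P) * Q -> l != 0 ->
  (forall mu, mu \in r -> abs mu < abs l) ->
  [/\ Q.[l] != 0, horner_mx G Q != 0, (\rank (horner_mx G Q) <= 1)%N &
   tends0 (fun p => mxnorm abs (Q.[l] *: (l ^- p *: G ^+ p) - horner_mx G Q))].
Proof.
move=> Q chiE l0 hr; set Pi := horner_mx G Q.
have Ql : Q.[l] != 0.
  rewrite /Q horner_prod prodf_seq_neq0; apply/allP => mu mur /=.
  rewrite hornerXsubC subr_eq0; apply/eqP => e.
  by have := hr _ mur; rewrite e ltxx.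
have hXl (a : K) : horner_mx G ('X - a%:P) = G - a%:M.
  by rewrite rmorphB /= horner_mx_X horner_mx_C.
have GPi : (G - l%:M) * Pi = 0.
  by rewrite -hXl -rmorphM /= -chiE Cayley_Hamilton.
have GPi' : G * Pi = l *: Pi.
  by move/eqP: GPi; rewrite mulrBl subr_eq0 scalar_mul => /eqP.
split => //.
- have : root (char_poly G) l by rewrite chiE rootM root_XsubC eqxx.
  rewrite -eigenvalue_root_char => /eigenvalueP[v vG v0].
  apply/eqP => P0; have := horner_mx_eigen Q vG; rewrite -/Pi P0 mulmx0 => /esym/eqP.
  by rewrite scaler_eq0 (negbTE Ql) (negbTE v0).
- have PiG : Pi *m (G - l%:M) = 0.
    by rewrite mulmxE -hXl -rmorphM /= mulrC -chiE Cayley_Hamilton.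
  apply: leq_trans (eigenspace_simple_root chiE Ql).
  by apply: mxrankS; rewrite sub_kermx PiG.
(* The complementary part: [Q.[l] - Q] is divisible by [X - l], so [Pi W] is a multiple of
   [char_poly G] evaluated at [G], and scaled powers of [G] annihilate [W] in the limit. *)
- pose W := (Q.[l])%:M - Pi.
  have hW : (\prod_(mu <- r) (G - mu%:M)) * W = 0.
    have -> : \prod_(mu <- r) (G - mu%:M) = Pi.
      by rewrite /Pi /Q rmorph_prod; apply: eq_bigr => mu _; exact/esym/hXl.
    have -> : W = horner_mx G ((Q.[l])%:P - Q) by rewrite rmorphB /= horner_mx_C.
    have /factor_theorem[H ->] : root ((Q.[l])%:P - Q) l.
      by rewrite /root hornerD hornerN hornerC subrr.
    rewrite mulrC in chiE.
    by rewrite -[Pi * _]rmorphM /= mulrCA -chiE rmorphM /= Cayley_Hamilton mulr0.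
  have := scaled_power_decay l0 hr hW.
  congr tends0; apply/funext => p; congr mxnorm.
  have GpPi : G ^+ p * Pi = l ^+ p *: Pi.
    elim: p => [|p IH]; first by rewrite expr0 mul1r scale1r.
    by rewrite exprSr -mulrA GPi' -scalerAr IH scalerA -exprS.
  rewrite mulrBr GpPi scalerBr scalerA mulVf ?expf_neq0// scale1r.
  by rewrite mul_scalar !scalerA mulrC.
Qed.

Lemma tends0_mxnorm m n (A : nat -> 'M[K]_(m, n)) :
  (forall i j, tends0 (fun p => abs (A p i j))) -> tends0 (fun p => mxnorm abs (A p)).
Proof.
move=> h e e0.
have /choice[N hN] : forall ij : 'I_m * 'I_n, exists N, forall p, (N <= p)%N ->
    abs (A p ij.1 ij.2) < e by move=> -[i j]; exact: h.
exists (\max_ij N ij) => p hp; apply: mxnorm_ltP => // i j.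
by apply: (hN (i, j)); apply: leq_trans hp; apply: leq_bigmax.
Qed.

Lemma tends0_quotient (a b : nat -> K) A B : B != 0 ->
  tends0 (fun p => abs (a p - A)) -> tends0 (fun p => abs (b p - B)) ->
  tends0 (fun p => abs (a p / b p - A / B)).
Proof.
move=> B0 ha hb e e0.
have aB : 0 < abs B by rewrite (abs_gt0 absP).
have aA := abs_ge0 absP A.
pose del := e * (abs B * abs B) / 2 / (abs A + abs B + 1).
have s0 : 0 < abs A + abs B + 1 by rewrite ltr_wpDl// addr_ge0// ltW.
have del0 : 0 < del by rewrite !divr_gt0// !mulr_gt0.
have [N hN] := ha _ del0.
have [M hM] := hb (Num.min del (abs B / 2)) ltac:(rewrite lt_min del0 divr_gt0//).
exists (maxn N M) => p; rewrite geq_max => /andP[/hN h1 /hM].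
rewrite lt_min => /andP[h2 h3].
have bB : abs B / 2 < abs (b p).
  by have := absB_ge absP B (b p); rewrite (abs_distC absP) in h3 *; lra.
have bp0 : b p != 0 by rewrite -(abs_gt0 absP) (lt_trans _ bB)// divr_gt0.
have -> : a p / b p - A / B = ((a p - A) * B - A * (b p - B)) / (b p * B).
  by field; rewrite bp0 B0.
rewrite (absM absP) (absV absP) (absM absP) ltr_pdivrMr; last by rewrite mulr_gt0// (abs_gt0 absP).
rewrite (le_lt_trans (absD absP _ _))// (absN absP) !(absM absP).
apply: (@lt_trans _ _ (del * (abs A + abs B + 1))).
  by nra.
rewrite mulfVK ?gt_eqF//.
by rewrite -mulrA ltr_pM2l// mulrAC ltr_pM2r.
Qed.

Lemma rank1_decomposition m n (A : 'M[K]_(m, n)) : A != 0 -> (\rank A <= 1)%N ->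
  exists (u : 'cV_m) (phi : 'rV_n), [/\ u != 0, phi != 0 & A = u *m phi].
Proof.
move=> A0 rA; have r1 : \rank A = 1%N.
  by apply/eqP; rewrite eqn_leq rA lt0n mxrank_eq0.
move: (col_base A) (row_base A) (mulmx_base A); rewrite r1 => u phi uphi.
exists u, phi; split; rewrite ?uphi//; apply: contra_neq A0 => z.
  by rewrite -uphi z mul0mx.
by rewrite -uphi z mulmx0.
Qed.

End Proximal.

Section ProximalLimit.
Variables (R : realType) (K : fieldType) (abs : K -> R).
Hypothesis completeK : forall u, cauchy_seq abs u -> exists l, converges_to abs u l.

(** The limit of the scaled powers exists over the splitting extension, of which no completeness is
    known, and the scalars used there need not lie in [K]. Dividing by an entry that does not vanish
    in the limit brings everything back to [K]: the quotients are Cauchy because [iota] is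
    isometric, and rank is unchanged by field extension. *)
Lemma proximal_rank1 n (g : 'M[K]_n.+2) : rho1_gt_rho2 abs g ->
  exists (u : 'cV_n.+2) (phi : 'rV_n.+2), [/\ u != 0, phi != 0 &
   forall e, 0 < e -> exists N, forall p, (N <= p)%N ->
     exists2 c, c != 0 & mxnorm abs (c *: g ^+ p - u *m phi) < e].
Proof.
move=> [L [iota [absL [s [absLP [isom [chiE [i [si hi]]]]]]]]].
have sizes : size s = n.+2.
  have := size_char_poly g; rewrite -(size_map_poly iota) chiE size_prod_XsubC.
  by case.
pose l := s`_i; pose r := take i s ++ drop i.+1 s.
have hr mu : mu \in r -> absL mu < absL l.
  rewrite mem_cat => /orP[] /(nthP 0) [j].
    rewrite size_take si => ji; rewrite nth_take// => <-.
    by apply: hi; [exact: ltn_trans ji si | rewrite ltn_eqF].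
  rewrite size_drop nth_drop => ji <-; apply: hi; last by rewrite gtn_eqF// leq_addr.
  by rewrite -ltn_subRL.
(* There are at least two roots, and [l] strictly exceeds the other one in modulus. *)
have l0 : l != 0.
  rewrite -(abs_gt0 absLP).
  have [j jn ji] : exists2 j, (j < size s)%N & j != i.
    by rewrite sizes; case: (i) => [|k]; [exists 1%N|exists 0%N].
  by rewrite (le_lt_trans _ (hi _ jn ji))// (abs_ge0 absLP).
pose Q := \prod_(mu <- r) ('X - mu%:P).
pose G := map_mx iota g.
have chiG : char_poly G = ('X - l%:P) * Q.
  rewrite -map_char_poly chiE -[in LHS](cat_take_drop i s) (drop_nth 0 si).
  by rewrite /Q /r !big_cat big_cons /= mulrCA.
have [Ql Pi0 Pi1 zcv] := proximal_power absLP chiG l0 hr.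
set Pi := horner_mx G _ in Pi0 Pi1 zcv; set a := Q.[l] in Ql zcv.
have [i0 [j0 Pij]] : exists i0 j0, Pi i0 j0 != 0.
  apply: contrapT => h; move/eqP: Pi0; apply; apply/matrixP => i' j'; rewrite [RHS]mxE.
  by apply/eqP; apply: contrapT => /negP e; apply: h; exists i', j'.
pose z p := a *: (l ^- p *: G ^+ p).
have zcvE k m : tends0 (fun p => absL (z p k m - Pi k m)).
  move=> e e0; have [N hN] := zcv e e0; exists N => p /hN.
  apply: le_lt_trans; have := abs_le_mxnorm absL (z p - Pi) k m.
  by rewrite !mxE.
(* In this normalisation the factors [a] and [l ^- p] cancel. *)
pose M p := ((g ^+ p) i0 j0)^-1 *: g ^+ p.
have GE p : G ^+ p = map_mx iota (g ^+ p) by rewrite /G rmorphXn.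
have ME p k m : iota (M p k m) = z p k m / z p i0 j0.
  rewrite /M mxE rmorphM fmorphV /z GE !mxE mulrC.
  have n1 : a * l ^- p != 0 by rewrite mulf_neq0// invr_neq0// expf_neq0.
  by rewrite !mulrA -mulf_div divff// mul1r.
have Mcv k m : tends0 (fun p => absL (iota (M p k m) - Pi k m / Pi i0 j0)).
  by under eq_fun do rewrite ME; exact: (tends0_quotient absLP).
have Mlim (km : 'I_n.+2 * 'I_n.+2) : exists x, converges_to abs (fun p => M p km.1 km.2) x.
  apply: completeK => e e0; have [N hN] := Mcv km.1 km.2 (e / 2) (divr_gt0 e0 (ltr0Sn _ 1)).
  exists N => p q hp hq; rewrite -isom rmorphB /=.
  rewrite (_ : _ - _ = (iota (M p km.1 km.2) - Pi km.1 km.2 / Pi i0 j0) -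
     (iota (M q km.1 km.2) - Pi km.1 km.2 / Pi i0 j0)); last by ring.
  rewrite (le_lt_trans (absD absLP _ _))// (absN absLP) (splitr e).
  by rewrite ltrD// hN.
have {Mlim} [X hX] := choice Mlim.
pose P : 'M[K]_n.+2 := \matrix_(k, m) X (k, m).
have MP : tends0 (fun p => mxnorm abs (M p - P)).
  apply: tends0_mxnorm => k m e e0; have [N hN] := hX (k, m) e e0.
  by exists N => p /hN; rewrite !mxE.
have PE : map_mx iota P = (Pi i0 j0)^-1 *: Pi.
  apply/matrixP => k m; apply/eqP; rewrite -subr_eq0 -(abs_eq0 absLP) eq_le (abs_ge0 absLP) andbT.
  apply/ler_addgt0Pl => e e0; rewrite addr0.
  have [N hN] := hX (k, m) (e / 2) (divr_gt0 e0 (ltr0Sn _ 1)).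
  have [N' hN'] := Mcv k m (e / 2) (divr_gt0 e0 (ltr0Sn _ 1)).
  have h1 := hN (maxn N N') (leq_maxl _ _); have h2 := hN' (maxn N N') (leq_maxr _ _).
  rewrite !mxE (_ : _ - _ = (iota (M (maxn N N') k m) - Pi k m / Pi i0 j0) -
    (iota (M (maxn N N') k m) - iota (X (k, m)))); last by rewrite mulrC; ring.
  rewrite (le_trans (absD absLP _ _))// (absN absLP) -rmorphB isom (splitr e).
  by rewrite lerD// ltW.
have P0 : P != 0.
  apply: contra_neq Pij => Pz; move/matrixP: PE => /(_ i0 j0).
  rewrite Pz !mxE rmorph0 => /esym/eqP; rewrite mulf_eq0 invr_eq0 orbb.
  by move/eqP.
have rP : (\rank P <= 1)%N.
  by rewrite -(mxrank_map iota) PE (leq_trans _ Pi1)// mxrankS// scalemx_sub.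
have [u [phi [u0 phi0 uphi]]] := rank1_decomposition P0 rP.
exists u, phi; split => // e e0.
have [N hN] := MP e e0.
(* Once the entry is closer to its limit than the modulus of that limit it is nonzero, so that the
   scalar [c] is legitimate. *)
have [N' hN'] := zcvE i0 j0 (absL (Pi i0 j0)) ltac:(by rewrite (abs_gt0 absLP)).
exists (maxn N N') => p; rewrite geq_max => /andP[/hN h1 /hN' h2].
exists ((g ^+ p) i0 j0)^-1; last by rewrite -uphi.
rewrite invr_eq0; apply: contraTneq h2 => gz.
by rewrite /z GE !mxE gz rmorph0 !mulr0 sub0r (absN absLP) ltxx.
Qed.

End ProximalLimit.

(** * General position *)

Section GeneralPosition.
Variables (K : fieldType) (d : nat).
Implicit Types (us X : seq 'cV[K]_d).

(** Sub-sequences, not subsets: a repeated vector counts as often as it occurs, so that later counts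
    are counts of indices. *)
Definition general_position us :=
  forall X, subseq X us -> (size X <= d)%N -> free X.

Definition columns X n : 'M[K]_(d, n) := \matrix_(i, j) X`_j i 0.

Lemma mul_columnsE m (f : 'M[K]_(m, d)) X n i (j : 'I_n) :
  (f *m columns X n) i j = (f *m X`_j) i 0.
Proof. by rewrite !mxE; apply: eq_bigr => k _; rewrite mxE. Qed.

Lemma annihilator_exists X : (size X < d)%N ->
  exists2 f : 'rV[K]_d, f != 0 & forall x, x \in X -> f *m x = 0.
Proof.
move=> sX; have /rowV0Pn[f /sub_kermxP fX f0] : kermx (columns X (size X)) != 0.
  rewrite -mxrank_eq0 mxrank_ker -lt0n subn_gt0.
  exact: leq_ltn_trans (rank_leq_col _) sX.
exists f => // x /(nthP 0)[j jX <-]; apply/matrixP => a b.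
by rewrite !ord1 -(mul_columnsE f X 0 (Ordinal jX)) fX !mxE.
Qed.

Lemma annihilate_span m (f : 'M[K]_(m, d)) X v :
  (forall x, x \in X -> f *m x = 0) -> v \in <<X>>%VS -> f *m v = 0.
Proof.
move=> h vX; rewrite (coord_span (X := in_tuple X) vX) mulmx_sumr big1// => i _.
by rewrite -scalemxAr h ?scaler0// mem_nth.
Qed.

Lemma annihilator_free X (f : 'rV[K]_d) : free X -> size X = d ->
  (forall x, x \in X -> f *m x = 0) -> f = 0.
Proof.
move=> fX sX h.
have sp (v : 'cV[K]_d) : v \in <<X>>%VS.
  suff -> : <<X>>%VS = fullv by exact: memvf.
  apply/eqP; rewrite eqEdim subvf /= dimvf (eqP fX) sX /dim /=.
  by rewrite muln1.
have fv (v : 'cV[K]_d) : f *m v = 0 by exact: annihilate_span h (sp v).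
apply/rowP => i; have := fv (delta_mx i 0); move/matrixP/(_ 0 0).
by rewrite -colE !mxE.
Qed.

(** A new vector spoils general position only by lying in the span of fewer than d earlier ones.
    There are finitely many such spans, indexed by masks, each inside a hyperplane; the [fs] are
    equations of these hyperplanes, in the form that strong irreducibility accepts. *)
Lemma general_position_extend us : general_position us -> (0 < d)%N ->
  exists N (fs : 'I_N -> 'rV[K]_d), [/\ (1 <= N)%N, forall i, fs i != 0 &
    forall u : 'cV_d, (forall i, fs i *m u != 0) -> general_position (u :: us)].
Proof.
move=> gus d0.
have /choice[F hF] : forall m : (size us).-tuple bool, exists f : 'rV[K]_d,
    f != 0 /\ ((size (mask m us) < d)%N -> forall x, x \in mask m us -> f *m x = 0).
  move=> m; case: (ltnP (size (mask m us)) d) => [/annihilator_exists[f f0 h]|_].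
    by exists f.
  (* Masks selecting at least d vectors impose nothing; any nonzero form serves. *)
  exists (delta_mx 0 (Ordinal d0)); split => //.
  apply/eqP => /matrixP /(_ 0 (Ordinal d0)); rewrite !mxE !eqxx /= => /eqP.
  by rewrite oner_eq0.
exists #|{: (size us).-tuple bool}|, (fun i => F (enum_val i)); split.
- by rewrite card_tuple card_bool expn_gt0.
- by move=> i; case: (hF (enum_val i)).
- move=> u hu [|x X] //; first by rewrite nil_free.
  rewrite /=; case: eqVneq => [-> sX sz|_ sX sz]; last exact: gus.
  rewrite free_cons gus// ?(ltnW sz)// andbT.
  case/subseqP: sX => m sm Xm.
  have sm' : size m == size us by rewrite sm.
  have [_ hm] := hF (Tuple sm').
  have := hu (enum_rank (Tuple sm')); rewrite enum_rankK; apply: contra => uX.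
  by apply/eqP; apply: annihilate_span uX; rewrite Xm; apply: hm; rewrite /= -Xm.
Qed.

Section Quantitative.
Variables (R : realType) (abs : K -> R).
Hypothesis absP : is_absolute_value abs.

(** The matrix [M] of the basis is invertible, so [|f|] is at most [d |M^-1|] times [|f M|], and the
    norm of the row [f M] is attained at one basis vector. *)
Lemma basis_lower_bound X : free X -> size X = d ->
  exists2 e : R, 0 < e & forall f : 'rV[K]_d,
    f != 0 -> exists2 x, x \in X & e * mxnorm abs f <= mxnorm abs (f *m x).
Proof.
move=> fX sX; set M := columns X d.
have uM : M \in unitmx.
  rewrite -row_free_unit -kermx_eq0; apply/negPn/negP => /rowV0Pn[f /sub_kermxP fM].
  apply/negP; rewrite negbK; apply/eqP; apply: (annihilator_free fX sX) => x /(nthP 0)[j jX <-].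
  rewrite sX in jX; apply/matrixP => a b.
  by rewrite !ord1 -(mul_columnsE f X 0 (Ordinal jX)) fM !mxE.
have nn : 0 <= d%:R * mxnorm abs (invmx M) by rewrite mulr_ge0 ?mxnorm_ge0.
pose e := (d%:R * mxnorm abs (invmx M) + 1)^-1.
exists e; first by rewrite invr_gt0 ltr_wpDl.
move=> f f0.
have fM0 : mxnorm abs (f *m M) != 0.
  by rewrite (mxnorm_eq0 absP); apply: contra_neq f0 => z; rewrite -(mulmxK uM f) z mul0mx.
have [i [j fMj]] := mxnorm_attained fM0.
exists X`_j; first by rewrite mem_nth// sX.
have -> : mxnorm abs (f *m X`_j) = mxnorm abs (f *m M).
  by rewrite fMj (mxnorm11 absP) mul_columnsE !ord1.
rewrite /e ler_pdivrMl ?ltr_wpDl// (le_trans (mxnorm_unit_row absP f uM))//.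
rewrite mulrDl mul1r [X in _ <= X + _](_ : _ = d%:R * mxnorm abs (f *m M) * mxnorm abs (invmx M)).
  by rewrite lerDl mxnorm_ge0.
by ring.
Qed.

Lemma general_position_count us : general_position us -> (0 < d)%N ->
  exists2 e : R, 0 < e & forall f : 'rV[K]_d,
    (count (fun u => (mxnorm abs (f *m u) < e * mxnorm abs f)%R) us < d)%N.
Proof.
move=> gus d0.
have /choice[E hE] : forall m : (size us).-tuple bool, exists e : R, 0 < e /\
    (size (mask m us) = d -> forall f : 'rV[K]_d,
    f != 0 -> exists2 x, x \in mask m us & e * mxnorm abs f <= mxnorm abs (f *m x)).
  move=> m; have [sm|sm] := eqVneq (size (mask m us)) d; last first.
    by exists 1; split => // h; rewrite h eqxx in sm.
  have [|e e0 he] := @basis_lower_bound (mask m us) _ sm; last by exists e.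
  by apply: gus; rewrite ?sm// mask_subseq.
exists (\big[Num.min/1]_m E m).
  by apply: lt_bigmin => // m _; case: (hE m).
(* The strict inequality in the count never holds for the zero form. *)
move=> f; have [->|f0] := eqVneq f 0.
  rewrite (eq_count (a2 := pred0)) ?count_pred0// => u /=.
  by rewrite mul0mx !(mxnorm0 absP) mulr0 ltxx.
rewrite ltnNge; apply/negP; rewrite -size_filter; set Y := [seq _ <- _ | _] => dY.
have : subseq (take d Y) us.
  exact: subseq_trans (take_subseq _ _) (filter_subseq _ _).
case/subseqP => m sm Xm.
have sm' : size m == size us by rewrite sm.
have [_] := hE (Tuple sm'); rewrite /= -Xm size_takel// => /(_ erefl f f0)[x xY].
have : x \in Y by exact: mem_take xY.
rewrite mem_filter => /andP[h _]; rewrite leNgt => /negP; apply.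
apply: lt_le_trans h _; rewrite ler_wpM2r ?mxnorm_ge0//.
exact: bigmin_le.
Qed.

End Quantitative.
End GeneralPosition.

Lemma exists_natSinv_lt (R : realType) (r : R) : 0 < r -> exists k, k.+1%:R^-1 < r.
Proof.
move=> r0; exists (Num.trunc r^-1).
by rewrite -[ltRHS]invrK ltf_pV2 ?posrE ?invr_gt0// truncnS_gt.
Qed.

(** * Borel sets of matrices *)

Section Separability.
Variables (R : realType) (K : fieldType) (abs : K -> R).
Hypothesis locK : is_local_field abs.
Let absP : is_absolute_value abs. Proof. by case: locK. Qed.

Lemma abs_gt1_exists : exists a, 1 < abs a.
Proof.
case: locK => _ [[x [x0 x1]] _].
have ax : 0 < abs x by rewrite lt_def x0 abs_ge0.
case: (ltgtP (abs x) 1) x1 => // h _; last by exists x.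
by exists x^-1; rewrite (absV absP) -invr1 ltf_pV2 ?posrE.
Qed.

(** Otherwise a greedy choice yields an [r]-separated sequence in the ball, without convergent
    subsequence; [s n] lists the first [n] choices, from which [ext] keeps its distance. *)
Lemma unit_ball_totally_bounded r : 0 < r ->
  exists F : seq K, forall x, abs x <= 1 -> exists2 y, y \in F & abs (y - x) < r.
Proof.
move=> r0; apply: contrapT => h.
have /choice[ext hext] : forall F : seq K, exists x, abs x <= 1 /\
    forall y, y \in F -> r <= abs (y - x).
  move=> F; apply: contrapT => hF; apply: h; exists F => x x1.
  apply: contrapT => hx; apply: hF; exists x; split => // y yF.
  by rewrite leNgt; apply/negP => yx; apply: hx; exists y.
pose s := fix s n := if n is n'.+1 then ext (s n') :: s n' else [::].
pose u n := ext (s n).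
have us m n : (m < n)%N -> u m \in s n.
  elim: n => // n IH; rewrite ltnS leq_eqVlt => /orP[/eqP ->|/IH h'].
    by rewrite /= mem_head.
  by rewrite /= inE h' orbT.
case: locK => _ [_ [_ [cpt _]]].
have [n|phi [phim [l hl]]] := cpt u; first by case: (hext (s n)).
have [N hN] := hl (r / 2) (divr_gt0 r0 (ltr0Sn _ 1)).
have h1 := hN N (leqnn N); have h2 := hN N.+1 (leqnSn N).
have := (hext (s (phi N.+1))).2 _ (us _ _ (phim N)).
apply/negP; rewrite -ltNge -/(u _).
rewrite (_ : _ - _ = (u (phi N) - l) - (u (phi N.+1) - l)); last by ring.
rewrite (le_lt_trans (absD absP _ _))// (absN absP) (splitr r).
by rewrite ltrD.
Qed.

(** Finite nets of the unit ball, dilated by the powers of an element of modulus greater than 1.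
    Separability is what places all open sets in the sigma-algebra generated by boxes. *)
Lemma dense_seq_exists :
  exists D : nat -> K, forall x r, 0 < r -> exists n, abs (D n - x) < r.
Proof.
have [a a1] := abs_gt1_exists; have a0 : 0 < abs a by rewrite (lt_trans _ a1).
have /choice[F hF] : forall k, exists F : seq K, forall x, abs x <= 1 ->
    exists2 y, y \in F & abs (y - x) < k.+1%:R^-1.
  by move=> k; apply: unit_ball_totally_bounded; rewrite invr_gt0.
pose D n := if unpickle n is Some (N, k, i) then a ^+ N * (F k)`_i else 0.
exists D => x r r0.
have : (fun k => (abs a)^-1 ^+ k) @ \oo --> (0 : R).
  by apply: cvg_expr; rewrite ger0_norm ?invr_ge0 ?ltW// invf_lt1.
have x1 : 0 < abs x + 1 by rewrite ltr_wpDl// abs_ge0.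
move=> /cvgrPdist_lt /(_ (abs x + 1)^-1); rewrite invr_gt0 => /(_ x1)[N _ /(_ N)/=].
rewrite leqnn sub0r normrN ger0_norm ?exprn_ge0 ?invr_ge0 ?(ltW a0)// => /(_ isT).
rewrite exprVn ltf_pV2 ?posrE// ?exprn_gt0// => xN.
have aN : 0 < abs a ^+ N by rewrite exprn_gt0.
have aN0 : a ^+ N != 0 by rewrite -(abs_gt0 absP) (absX absP).
have [k hk] := exists_natSinv_lt (divr_gt0 r0 aN).
have [|y yF hy] := hF k (x / a ^+ N).
  rewrite (absM absP) (absV absP) (absX absP) ler_pdivrMr// mul1r.
  by rewrite (le_trans _ (ltW xN))// lerDl.
move/(nthP 0): yF => [i iF iy].
exists (pickle (N, k, i)); rewrite /D pickleK iy.
rewrite (_ : _ - _ = a ^+ N * (y - x / a ^+ N)); last by field.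
by rewrite (absM absP) (absX absP) mulrC -ltr_pdivlMr// (lt_trans hy).
Qed.

End Separability.

Section OpenSets.
Variables (R : realType) (K : fieldType) (abs : K -> R) (n : nat).
Notation d := n.+1.
Hypothesis locK : is_local_field abs.
Let absP : is_absolute_value abs. Proof. by case: locK. Qed.
Implicit Types g h : 'M[K]_d.

Definition mxball g (r : R) : set (mxM abs d) := [set h | mxnorm abs (h - g) < r].

Definition mxopen (U : set 'M[K]_d) :=
  forall g, U g -> exists2 r, 0 < r & forall h, mxnorm abs (h - g) < r -> U h.

Lemma mxball_measurable g r : measurable (mxball g r).
Proof.
have [r0|r0] := ltP 0 r; last first.
  rewrite (_ : mxball g r = set0); first exact: measurable0.
  by rewrite -subset0 => h /(le_lt_trans (mxnorm_ge0 _ _)); rewrite ltNge r0.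
apply: sub_sigma_algebra; exists g, r; apply/seteqP; split => h hh.
  move=> i j; have := abs_le_mxnorm abs (h - g) i j.
  by rewrite !mxE => /le_lt_trans; exact.
by apply: mxnorm_ltP => // i j; rewrite !mxE; exact: hh.
Qed.

Lemma mxdense_exists : exists D : nat -> 'M[K]_d,
  forall g r, 0 < r -> exists m, mxnorm abs (D m - g) < r.
Proof.
have [D hD] := dense_seq_exists locK.
exists (fun m => if unpickle m is Some A then map_mx D (A : 'M[nat]_d) else 0).
move=> g r r0.
have /choice[A hA] : forall ij : 'I_d * 'I_d, exists m, abs (D m - g ij.1 ij.2) < r.
  by move=> ij; exact: hD.
exists (pickle (\matrix_(i, j) A (i, j))); rewrite pickleK.
by apply: mxnorm_ltP => // i j; rewrite !mxE; exact: (hA (i, j)).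
Qed.

Lemma mxball_countable_basis : exists D : nat -> 'M[K]_d, forall g r, 0 < r ->
  exists m k, mxball (D m) k.+1%:R^-1 g /\ forall h, mxball (D m) k.+1%:R^-1 h ->
    mxnorm abs (h - g) < r.
Proof.
have [D hD] := mxdense_exists; exists D => g r r0.
have [k hk] := exists_natSinv_lt (divr_gt0 r0 (ltr0Sn _ 1)).
have [m hm] := hD g k.+1%:R^-1 ltac:(by rewrite invr_gt0).
exists m, k; split; first by rewrite /mxball/= mxnorm_distC.
move=> h hh; rewrite (_ : h - g = (h - D m) + (D m - g)); last by rewrite addrA subrK.
by rewrite (le_lt_trans (mxnormD absP _ _))// (splitr r) ltrD// (lt_trans _ hk).
Qed.

Lemma mulmx_continuous (x y : 'M[K]_d) r : 0 < r -> exists2 s, 0 < s & forall x' y',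
  mxnorm abs (x' - x) < s -> mxnorm abs (y' - y) < s -> mxnorm abs (x' *m y' - x *m y) < r.
Proof.
move=> r0; pose c := d%:R * (mxnorm abs x + mxnorm abs y + 1).
have c0 : 0 < c by rewrite mulr_gt0// ltr_wpDl// addr_ge0 ?mxnorm_ge0.
exists (Num.min 1 (r / c)); first by rewrite lt_min ltr01 divr_gt0.
move=> x' y'; rewrite !lt_min => /andP[x1 xr] /andP[y1 yr].
rewrite (_ : _ - _ = (x' - x) *m y' + x *m (y' - y)); last first.
  by rewrite mulmxBl mulmxBr addrA subrK.
rewrite (le_lt_trans (mxnormD absP _ _))//.
have h1 := mxnormM absP (x' - x) y'; have h2 := mxnormM absP x (y' - y).
have y'b : mxnorm abs y' <= mxnorm abs y + 1.
  by have := mxnormB_ge absP y' y; lra.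
have d0 : 0 < d%:R :> R by [].
have xy0 := mxnorm_ge0 abs x; have yy0 := mxnorm_ge0 abs y.
have x'0 := mxnorm_ge0 abs (x' - x); have y'0 := mxnorm_ge0 abs (y' - y).
rewrite ltr_pdivlMr// in xr; rewrite ltr_pdivlMr// in yr.
pose s := Num.max (mxnorm abs (x' - x)) (mxnorm abs (y' - y)).
have sr : s * c < r by rewrite /s; case: (leP (mxnorm abs (x' - x)) (mxnorm abs (y' - y))).
have s0 : 0 <= s by rewrite /s le_max x'0.
have h3 : d%:R * mxnorm abs (x' - x) * mxnorm abs y' <= d%:R * s * (mxnorm abs y + 1).
  by rewrite ler_pM ?mulr_ge0// ?mxnorm_ge0// ler_wpM2l// /s le_max lexx.
have h4 : d%:R * mxnorm abs x * mxnorm abs (y' - y) <= d%:R * mxnorm abs x * s.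
  by rewrite ler_wpM2l ?mulr_ge0// /s le_max lexx orbT.
rewrite /c in sr.
move: h1 h2 h3 h4 sr; lra.
Qed.

Section Preimages.
Context (dO : measure_display) (Omega : measurableType dO).
Implicit Types X Y : Omega -> mxM abs d.

Lemma measurable_fun_mxball X g r : measurable_fun setT X ->
  measurable [set w | mxball g r (X w)].
Proof.
by move=> mX; rewrite -[X in measurable X]setTI; apply: mX => //; exact: mxball_measurable.
Qed.

(** An open set of pairs is a countable union of products of basic balls, so its preimage is a
    countable union of measurable rectangles. This makes products of random matrices measurable. *)
Lemma open_relation_measurable X Y (U : 'M[K]_d -> 'M[K]_d -> Prop) :
  measurable_fun setT X -> measurable_fun setT Y ->
  (forall x y, U x y -> exists2 r, 0 < r & forall x' y',
     mxnorm abs (x' - x) < r -> mxnorm abs (y' - y) < r -> U x' y') ->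
  measurable [set w | U (X w) (Y w)].
Proof.
move=> mX mY oU; have [D hD] := mxball_countable_basis.
pose B m k := mxball (D m) k.+1%:R^-1.
rewrite (_ : [set w | _] = \bigcup_m \bigcup_k \bigcup_m' \bigcup_(k' in
   [set k' | forall x y, B m k x -> B m' k' y -> U x y])
   ([set w | B m k (X w)] `&` [set w | B m' k' (Y w)])); last first.
  apply/seteqP; split => w /=.
    move=> /oU[r r0 hr]; have [m [k [h1 h2]]] := hD (X w) r r0.
    have [m' [k' [h1' h2']]] := hD (Y w) r r0.
    exists m => //; exists k => //; exists m' => //; exists k' => //.
    by move=> x y /h2 hx /h2' hy; exact: hr.
  by move=> [m _ [k _ [m' _ [k' /= h [h1 h2]]]]]; exact: h.
apply: bigcup_measurable => m _; apply: bigcup_measurable => k _.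
apply: bigcup_measurable => m' _; apply: bigcup_measurable => k' _.
by apply: measurableI; exact: measurable_fun_mxball.
Qed.

Lemma mxopen_measurable_preimage X U : measurable_fun setT X -> mxopen U ->
  measurable [set w | U (X w)].
Proof.
move=> mX oU; apply: (open_relation_measurable (U := fun x _ => U x) mX mX) => x y Ux.
by have [r r0 hr] := oU x Ux; exists r => // x' y' /hr.
Qed.

Lemma mx_measurability X :
  (forall U, mxopen U -> measurable [set w | U (X w)]) -> measurable_fun setT X.
Proof.
move=> h; apply: (@measurability _ _ _ (mxM abs d) _ _ (@mx_boxes R K abs d) erefl) =>
  _ [_ [g [r ->]] <-].
rewrite setTI; apply: (h) => x hx.
have [r0|r0] := ltP 0 r; last first.
  by have := hx 0 0; rewrite ltNge (le_trans r0) ?abs_ge0.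
have xg : mxnorm abs (x - g) < r.
  by apply: mxnorm_ltP => // i j; rewrite !mxE; exact: hx.
exists (r - mxnorm abs (x - g)); first by rewrite subr_gt0.
move=> y yx i j; rewrite (_ : _ - _ = (y i j - x i j) + (x i j - g i j)); last by ring.
rewrite (le_lt_trans (absD absP _ _))//.
have h1 := abs_le_mxnorm abs (y - x) i j; have h2 := abs_le_mxnorm abs (x - g) i j.
by rewrite !mxE in h1 h2; lra.
Qed.

Lemma measurable_mulmx X Y : measurable_fun setT X -> measurable_fun setT Y ->
  measurable_fun setT (fun w => X w *m Y w : mxM abs d).
Proof.
move=> mX mY; apply: mx_measurability => U oU.
apply: (open_relation_measurable (U := fun x y => U (x *m y)) mX mY) => x y /oU[r r0 hr].
have [s s0 hs] := mulmx_continuous x y r0.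
by exists s => // x' y' hx hy; apply: hr; exact: hs.
Qed.

Lemma measurable_rprod (X : nat -> Omega -> mxM abs d) m :
  (forall i, (i < m)%N -> measurable_fun setT (X i)) ->
  measurable_fun setT (fun w => rprod (fun i => X i w) m : mxM abs d).
Proof.
elim: m => [|m IH] h /=; first exact: measurable_cst.
by apply: measurable_mulmx; [apply: IH => i im; apply: h; exact: ltnW|exact: h].
Qed.

End Preimages.

Lemma mxopen_measurable (U : set (mxM abs d)) : mxopen U -> measurable U.
Proof. exact: (mxopen_measurable_preimage (@measurable_id _ _ _)). Qed.

Lemma lower_semicontinuous_mx_measurable (phi : mxM abs d -> R) :
  (forall r, mxopen [set g | r < phi g]) -> measurable_fun setT phi.
Proof.
move=> h; apply: (measurability _ (RGenOInfty.measurableE R)).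
move=> _ [_ [r ->] <-]; rewrite setTI.
rewrite (_ : _ @^-1` _ = [set g | r < phi g]); first exact: mxopen_measurable.
by apply/seteqP; split => g /=; rewrite in_itv/= andbT.
Qed.

(** If [v h = 0] then [v = v (g - h) g^-1], of norm at most [|v| / 2], so [h] is invertible. The
    identity [h^-1 - g^-1 = h^-1 (g - h) g^-1] first gives [|h^-1| <= 2 |g^-1|], then the
    closeness. *)
Lemma inverse_perturbation g r : g \in unitmx -> 0 < r -> exists2 s, 0 < s &
  forall h, mxnorm abs (h - g) < s -> h \in unitmx /\ mxnorm abs (invmx h - invmx g) < r.
Proof.
move=> ug r0; set A := mxnorm abs (invmx g).
have A0 : 0 <= A := mxnorm_ge0 _ _.
have d0 : 0 < d%:R :> R by [].
pose c := d%:R * d%:R * (A + 1) * (A + 1) : R.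
have c0 : 0 < c by rewrite !mulr_gt0// ltr_wpDl.
pose s := Num.min (2^-1 / c) (r / 2 / c).
exists s; first by rewrite lt_min !divr_gt0.
move=> h; rewrite lt_min => /andP[]; rewrite !ltr_pdivlMr// => h1 h2.
set e := mxnorm abs (h - g) in h1 h2.
have e0 : 0 <= e := mxnorm_ge0 _ _.
have t0 : 0 <= d%:R * d%:R * e by rewrite !mulr_ge0// ltW.
have t1 : 0 <= d%:R * d%:R * e * A by rewrite mulr_ge0.
have t2 : 0 <= d%:R * d%:R * e * A * A by rewrite mulr_ge0.
have dde : d%:R * d%:R * e * A <= 2^-1.
  by apply: le_trans (ltW h1); rewrite /c; move: t0 t1 t2; lra.
have uh : h \in unitmx.
  rewrite -row_free_unit -kermx_eq0; apply/negPn/negP => /rowV0Pn[v /sub_kermxP vh].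
  apply/negP; rewrite negbK -(mxnorm_eq0 absP) eq_le mxnorm_ge0 andbT.
  have ve : v = v *m (g - h) *m invmx g by rewrite mulmxBr vh subr0 mulmxK.
  have n1 : mxnorm abs v <= d%:R * mxnorm abs (v *m (g - h)) * A.
    by rewrite {1}ve; exact: mxnormM.
  have n2 : mxnorm abs (v *m (g - h)) <= d%:R * mxnorm abs v * e.
    by rewrite /e mxnorm_distC//; exact: mxnormM.
  have v0 := mxnorm_ge0 abs v.
  have n3 : d%:R * mxnorm abs (v *m (g - h)) * A <= d%:R * (d%:R * mxnorm abs v * e) * A.
    by rewrite ler_wpM2r// ler_wpM2l// ltW.
  have n4 := ler_wpM2l v0 dde.
  by lra.
split => //.
have ihE : invmx h - invmx g = invmx h *m (g - h) *m invmx g.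
  by rewrite mulmxBr mulmxBl mulmxK// mulVmx// mul1mx.
set B := mxnorm abs (invmx h - invmx g).
set C := mxnorm abs (invmx h).
have C0 : 0 <= C := mxnorm_ge0 _ _.
have B1 : B <= C * (d%:R * d%:R * e * A).
  rewrite /B ihE (le_trans (mxnormM absP _ _))// -/A.
  have : mxnorm abs (invmx h *m (g - h)) <= d%:R * C * e.
    by rewrite /e mxnorm_distC//; exact: mxnormM.
  move=> n1; have n2 : d%:R * mxnorm abs (invmx h *m (g - h)) * A <= d%:R * (d%:R * C * e) * A.
    by rewrite ler_wpM2r// ler_wpM2l// ltW.
  by lra.
have C1 : C <= A + B.
  by have := mxnormB_ge absP (invmx h) (invmx g); rewrite -/A -/B -/C; lra.
have C2 : C <= 2 * A by have := ler_wpM2l C0 dde; lra.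
have : B <= 2 * A * (d%:R * d%:R * e * A).
  by apply: le_trans B1 _; rewrite ler_wpM2r// !mulr_ge0// ltW.
have : e * (d%:R * d%:R * A * A) <= e * c.
  by rewrite /c; move: t0 t1 t2; lra.
by move: h2; lra.
Qed.

Lemma unitmx_open : mxopen [set g | g \in unitmx].
Proof.
by move=> g ug; have [s s0 hs] := inverse_perturbation ug ltr01; exists s => // h /hs[].
Qed.

Lemma measurable_invmx : measurable_fun setT (fun g : mxM abs d => invmx g : mxM abs d).
Proof.
apply: mx_measurability => U oU.
(* [invmx] is the identity on singular matrices, where the preimage of [U] is [U] itself. *)
have -> : [set g : mxM abs d | U (invmx g)] =
    [set g | g \in unitmx /\ U (invmx g)] `|` (~` [set g | g \in unitmx] `&` U).
  apply/seteqP; split => g /=.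
    have [ug|nug] := boolP (g \in unitmx); [by left|right; split => //].
    by move: H; rewrite invmx_out.
  by move=> [[]//|[/negP ng Ug]]; rewrite invmx_out.
apply: measurableU; last first.
  apply: measurableI; [apply: measurableC|]; apply: mxopen_measurable => //.
  exact: unitmx_open.
apply: mxopen_measurable => g [ug /oU[r r0 hr]].
have [s s0 hs] := inverse_perturbation ug r0; exists s => // h /hs[uh /hr].
by [].
Qed.

End OpenSets.

(** * Comparison of norms *)

Section NormComparison.
Variables (R : realType) (K : fieldType) (abs : K -> R) (n : nat).
Notation d := n.+1.
Hypothesis absP : is_absolute_value abs.
Implicit Types (g h : 'M[K]_d) (v : 'cV[K]_d) (f : 'rV[K]_d).
Local Notation mxnorm := (mxnorm abs).

Let d1 : 1 <= d%:R :> R. Proof. by rewrite ler1n. Qed.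
Let d0 : 0 < d%:R :> R. Proof. by []. Qed.

Lemma mxnorm_le_vnorm v : mxnorm v <= vnorm abs v.
Proof.
rewrite /vnorm; case: asboolP => _.
  apply: mxnorm_leP => [|i j]; first exact: bigmax_ge_id.
  by rewrite ord1; exact: (le_bigmax _ (fun i => abs (v i 0))).
apply: mxnorm_leP => [|i j]; first exact: sqrtr_ge0.
rewrite ord1 -(ger0_norm (abs_ge0 absP (v i 0))) -sqrtr_sqr ler_sqrt; last first.
  by apply: sumr_ge0 => k _; exact: sqr_ge0.
rewrite (bigD1 i)//= lerDl sumr_ge0// => k _; exact: sqr_ge0.
Qed.

Lemma vnorm_le_mxnorm v : vnorm abs v <= d%:R * mxnorm v.
Proof.
have v0 := mxnorm_ge0 abs v.
rewrite /vnorm; case: asboolP => _.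
  apply: bigmax_le => [|i _]; first by rewrite mulr_ge0.
  by rewrite (le_trans (abs_le_mxnorm _ _ _ _))// ler_peMl.
have dv0 : 0 <= d%:R * mxnorm v by rewrite mulr_ge0.
rewrite -(ger0_norm dv0) -sqrtr_sqr ler_sqrt ?sqr_ge0//.
rewrite (@le_trans _ _ (\sum_(i < d) mxnorm v ^+ 2))//.
  by apply: ler_sum => i _; rewrite lerXn2r ?nnegrE ?abs_ge0 ?abs_le_mxnorm.
rewrite sumr_const card_ord -[leLHS]mulr_natl exprMn ler_wpM2r ?sqr_ge0//.
by rewrite expr2 ler_peMl.
Qed.

Lemma vnorm_gt0 v : v != 0 -> 0 < vnorm abs v.
Proof.
by rewrite -(mxnorm_gt0 absP) => v0; apply: lt_le_trans v0 (mxnorm_le_vnorm v).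
Qed.

Lemma vnorm_ge0 v : 0 <= vnorm abs v.
Proof. exact: le_trans (mxnorm_ge0 _ _) (mxnorm_le_vnorm v). Qed.

Lemma opnorm_ratio_le g v : v != 0 ->
  vnorm abs (g *m v) / vnorm abs v <= d%:R * d%:R * mxnorm g.
Proof.
move=> v0; rewrite ler_pdivrMr ?vnorm_gt0// (le_trans (vnorm_le_mxnorm _))//.
rewrite -!mulrA ler_wpM2l//; rewrite (le_trans (mxnormM absP _ _))// -mulrA.
by rewrite ler_wpM2l// ler_wpM2l ?mxnorm_ge0// mxnorm_le_vnorm.
Qed.

Lemma delta_neq0 (i : 'I_d) : delta_mx i 0 != 0 :> 'cV[K]_d.
Proof. by apply/eqP => /matrixP /(_ i 0) /eqP; rewrite !mxE !eqxx oner_eq0. Qed.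

Lemma opnorm_set_nonempty g :
  [set vnorm abs (g *m v) / vnorm abs v | v in [set v : 'cV[K]_d | v != 0]] !=set0.
Proof.
by eexists; exists (delta_mx 0 0); [exact: (delta_neq0 0)|reflexivity].
Qed.

Lemma opnorm_ubound g v : v != 0 -> vnorm abs (g *m v) / vnorm abs v <= opnorm abs g.
Proof.
move=> v0; apply: ub_le_sup; last by exists v.
by exists (d%:R * d%:R * mxnorm g) => _ [x x0 <-]; exact: opnorm_ratio_le.
Qed.

Lemma opnorm_le_mxnorm g : opnorm abs g <= d%:R * d%:R * mxnorm g.
Proof.
apply: ge_sup; first exact: opnorm_set_nonempty.
by move=> _ [x x0 <-]; exact: opnorm_ratio_le.
Qed.

Lemma mxnorm_delta (i : 'I_d) : mxnorm (delta_mx i 0 : 'cV[K]_d) <= 1.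
Proof.
apply: mxnorm_leP => // j k; rewrite mxE; case: (_ && _) => /=.
  by rewrite (abs1 absP).
by rewrite (abs0 absP).
Qed.

Lemma opnorm_ge0 g : 0 <= opnorm abs g.
Proof.
by rewrite (le_trans _ (opnorm_ubound g (delta_neq0 0)))// divr_ge0 ?vnorm_ge0.
Qed.

Lemma mxnorm_le_opnorm g : mxnorm g <= d%:R * opnorm abs g.
Proof.
apply: mxnorm_leP => [|i j]; first by rewrite mulr_ge0 ?opnorm_ge0.
have := opnorm_ubound g (delta_neq0 j).
rewrite ler_pdivrMr ?vnorm_gt0 ?delta_neq0// => h.
have h1 : abs (g i j) <= vnorm abs (g *m delta_mx j 0).
  rewrite (le_trans _ (mxnorm_le_vnorm _))// -colE.
  by have := abs_le_mxnorm abs (col j g) i 0; rewrite mxE.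
have h2 : vnorm abs (delta_mx j 0) <= d%:R.
  by rewrite (le_trans (vnorm_le_mxnorm _))// -[leRHS]mulr1 ler_wpM2l// mxnorm_delta.
rewrite (le_trans h1)// (le_trans h)// mulrC ler_wpM2r// opnorm_ge0//.
Qed.

Lemma dualnorm_ratio_le f v : v != 0 ->
  abs ((f *m v) 0 0) / vnorm abs v <= d%:R * mxnorm f.
Proof.
move=> v0; rewrite ler_pdivrMr ?vnorm_gt0// -(mxnorm11 absP).
rewrite (le_trans (mxnormM absP _ _))// ler_wpM2l ?mulr_ge0 ?mxnorm_ge0//.
exact: mxnorm_le_vnorm.
Qed.

Lemma dualnorm_le_mxnorm f : dualnorm abs f <= d%:R * mxnorm f.
Proof.
apply: ge_sup; last by move=> _ [x x0 <-]; exact: dualnorm_ratio_le.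
by eexists; exists (delta_mx 0 0); [exact: (delta_neq0 0)|reflexivity].
Qed.

Lemma dualnorm_gt0 f : f != 0 -> 0 < dualnorm abs f.
Proof.
move=> f0; have [j fj] : exists j, f 0 j != 0.
  apply: contrapT => h; move/eqP: f0; apply; apply/rowP => j; rewrite mxE.
  by apply/eqP; apply: contrapT => /negP e; apply: h; exists j.
apply: (@lt_le_trans _ _ (abs ((f *m (delta_mx j 0 : 'cV_d)) 0 0) / vnorm abs (delta_mx j 0))).
  apply: divr_gt0; last exact: vnorm_gt0 (delta_neq0 j).
  by rewrite -colE mxE (abs_gt0 absP).
apply: ub_le_sup; last by exists (delta_mx j 0) => //; exact: delta_neq0.
by exists (d%:R * mxnorm f) => _ [x x0 <-]; exact: dualnorm_ratio_le.
Qed.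

Lemma unit_cond_ge1 g : g \in unitmx -> 1 <= d%:R * (mxnorm g * mxnorm (invmx g)).
Proof.
move=> ug; have := mxnormM absP g (invmx g); rewrite mulmxV// -mulrA.
apply: le_trans; have := abs_le_mxnorm abs (1%:M : 'M[K]_d) 0 0.
by rewrite mxE eqxx (abs1 absP).
Qed.

(** The counterpart of [Ncond] for the entrywise norm. It may be slightly negative, down to
    [- ln d], and is subadditive up to [ln (d * d)]; adding that constant repairs both. *)
Definition lncond g : R := ln (mxnorm g * mxnorm (invmx g)).

Lemma lncond_le_Ncond g : g \in unitmx -> lncond g <= Ncond abs g + ln (d%:R * d%:R).
Proof.
move=> ug; rewrite /lncond /Ncond.
have c0 : 0 < mxnorm g * mxnorm (invmx g).
  by rewrite -(pmulr_rgt0 _ d0) (lt_le_trans ltr01)// unit_cond_ge1.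
have hle : mxnorm g * mxnorm (invmx g) <= (opnorm abs g * opnorm abs (invmx g)) * (d%:R * d%:R).
  rewrite [leRHS](_ : _ = (d%:R * opnorm abs g) * (d%:R * opnorm abs (invmx g))); last by ring.
  by rewrite ler_pM ?mxnorm_ge0 ?mxnorm_le_opnorm.
have o0 : 0 < opnorm abs g * opnorm abs (invmx g).
  by rewrite -(pmulr_lgt0 _ (mulr_gt0 d0 d0)) (lt_le_trans c0).
have dd0 : 0 < d%:R * d%:R :> R by rewrite mulr_gt0.
rewrite -lnM ?posrE// ler_ln ?posrE//; exact: mulr_gt0.
Qed.

Lemma lncond_lower g : g \in unitmx -> - ln d%:R <= lncond g.
Proof.
move=> ug; have h := unit_cond_ge1 ug.
have c0 : 0 < mxnorm g * mxnorm (invmx g) by rewrite -(pmulr_rgt0 _ d0) (lt_le_trans ltr01).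
by rewrite lerNl -subr_ge0 opprK /lncond -lnM ?posrE// ln_ge0.
Qed.

End NormComparison.

Section NormMeasurability.
Variables (R : realType) (K : fieldType) (abs : K -> R) (n : nat).
Notation d := n.+1.
Hypothesis locK : is_local_field abs.
Let absP : is_absolute_value abs. Proof. by case: locK. Qed.
Local Notation mxnorm := (mxnorm abs).

Lemma vnorm_lower_semicontinuous (x : 'cV[K]_d) r : r < vnorm abs x ->
  exists2 s, 0 < s & forall y : 'cV[K]_d, mxnorm (y - x) < s -> r < vnorm abs y.
Proof.
rewrite /vnorm; case: asboolP => _ rx.
  have maxE (y : 'cV[K]_d) : \big[Num.max/0]_(i < d) abs (y i 0) = mxnorm y.
    apply/eqP; rewrite eq_le; apply/andP; split.
      by apply: bigmax_le => [|i _]; rewrite ?mxnorm_ge0 ?abs_le_mxnorm.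
    apply: mxnorm_leP => [|i j]; first exact: bigmax_ge_id.
    by rewrite ord1; exact: (le_bigmax _ (fun i => abs (y i 0))).
  rewrite maxE in rx; exists (mxnorm x - r); first by rewrite subr_gt0.
  move=> y yx; rewrite maxE; have := mxnormB_ge absP x y.
  by rewrite mxnorm_distC//; lra.
have [r0|r0] := ltP r 0.
  by exists 1 => // y _; rewrite (lt_le_trans r0)// sqrtr_ge0.
have S0 (y : 'cV[K]_d) : 0 <= \sum_(i < d) abs (y i 0) ^+ 2.
  by apply: sumr_ge0 => i _; exact: sqr_ge0.
have sqE (y : 'cV[K]_d) : (r < Num.sqrt (\sum_(i < d) abs (y i 0) ^+ 2)) =
    (r ^+ 2 < \sum_(i < d) abs (y i 0) ^+ 2).
  rewrite -{1}(ger0_norm r0) -sqrtr_sqr; have [|/eqP h] := ltP 0 (\sum_(i < d) abs (y i 0) ^+ 2).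
    by move=> h; rewrite ltr_sqrt.
  have -> : \sum_(i < d) abs (y i 0) ^+ 2 = 0 by apply/eqP; rewrite eq_le S0 andbT; move/eqP: h.
  by rewrite sqrtr0 !ltNge sqrtr_ge0 sqr_ge0.
rewrite sqE in rx; set Sx := \sum_(i < d) _ in rx.
pose c := d%:R * (2 * mxnorm x + 1).
have c0 : 0 < c by rewrite mulr_gt0// ltr_wpDl// mulr_ge0 ?mxnorm_ge0.
exists ((Sx - r ^+ 2) / c); first by rewrite divr_gt0// subr_gt0.
move=> y; rewrite ltr_pdivlMr// => yx; rewrite sqE.
have : Sx - \sum_(i < d) abs (y i 0) ^+ 2 <= d%:R * (mxnorm (y - x) * (2 * mxnorm x)).
  rewrite -sumrB (@le_trans _ _ (\sum_(i < d) mxnorm (y - x) * (2 * mxnorm x)))//; last first.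
    by rewrite sumr_const card_ord [leRHS]mulr_natl.
  apply: ler_sum => i _.
  have h1 := absB_ge absP (x i 0) (y i 0).
  have h2 := abs_le_mxnorm abs (y - x) i 0; rewrite !mxE (abs_distC absP) in h2.
  have h3 := abs_le_mxnorm abs x i 0.
  have h4 := abs_ge0 absP (y i 0); have h5 := abs_ge0 absP (x i 0).
  have h6 := mxnorm_ge0 abs (y - x).
  rewrite subr_sqr.
  have [le|lt] := leP (abs (x i 0)) (abs (y i 0)).
    apply: (@le_trans _ _ 0); last by rewrite !mulr_ge0// (le_trans h5).
    by rewrite mulr_le0_ge0 ?subr_le0 ?addr_ge0.
  apply: ler_pM; [by rewrite subr_ge0 ltW|exact: addr_ge0|exact: le_trans h1 h2|].
  by rewrite mulr_natl mulr2n lerD// (le_trans (ltW lt)).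
have := mulr_ge0 (ler0n R d) (mxnorm_ge0 abs (y - x)).
by move: yx; rewrite /c; set a := mxnorm _; set S := \sum_(_ < _) _; set e := mxnorm _; lra.
Qed.

(** A supremum of lower semicontinuous functions is lower semicontinuous, and that is enough for
    measurability. *)
Lemma opnorm_open r : mxopen abs [set g : 'M[K]_d | r < opnorm abs g].
Proof.
move=> g /= /sup_gt[|_ [v v0 <-]]; first exact: opnorm_set_nonempty.
rewrite ltr_pdivlMr ?vnorm_gt0// => /vnorm_lower_semicontinuous[s s0 hs].
have c0 : 0 < d%:R * (mxnorm v + 1) by rewrite mulr_gt0// ltr_wpDl// mxnorm_ge0.
exists (s / (d%:R * (mxnorm v + 1))); first by rewrite divr_gt0.
move=> h; rewrite ltr_pdivlMr// => hg.
apply: lt_le_trans (opnorm_ubound absP h v0); rewrite ltr_pdivlMr ?vnorm_gt0//.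
apply: hs; rewrite -mulmxBl (le_lt_trans (mxnormM absP _ _))//.
by apply: le_lt_trans hg; have := mxnorm_ge0 abs (h - g); have := mxnorm_ge0 abs v; nra.
Qed.

Lemma measurable_opnorm : measurable_fun setT (fun g : mxM abs d => opnorm abs g).
Proof. by apply: lower_semicontinuous_mx_measurable => // r; exact: opnorm_open. Qed.

Lemma measurable_Ncond_gt s : measurable [set g : mxM abs d | s < Ncond abs g].
Proof.
have mN : measurable_fun setT (fun g : mxM abs d => Ncond abs g).
  apply: (@measurableT_comp _ _ _ _ _ _ (@ln R)); first exact: measurable_ln.
  apply: measurable_funM; first exact: measurable_opnorm.
  apply: (@measurableT_comp _ _ _ _ _ _ (fun g : mxM abs d => opnorm abs g)).
    exact: measurable_opnorm.
  exact: measurable_invmx.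
rewrite [X in measurable X](_ : _ = setT `&` (fun g : mxM abs d => Ncond abs g) @^-1` `]s, +oo[%classic).
  by apply: mN => //; exact: measurable_itv.
by apply/seteqP; split => g /=; rewrite in_itv/= andbT; [split|case].
Qed.

Lemma mxnorm_mul_open (m p : nat) (A : 'M[K]_(m, d)) (B : 'M[K]_(d, p)) (a b : R) r :
  0 <= a -> 0 <= b ->
  mxopen abs [set g : 'M[K]_d | r + b * mxnorm (A *m g) < a * mxnorm (A *m g *m B)].
Proof.
move=> a0 b0 g /= hg; set D := a * mxnorm (A *m g *m B) - (r + b * mxnorm (A *m g)).
have D0 : 0 < D by rewrite subr_gt0.
pose c := a * (d%:R * (d%:R * mxnorm A) * mxnorm B) + b * (d%:R * mxnorm A) + 1.
have A0 := mxnorm_ge0 abs A; have B0 := mxnorm_ge0 abs B.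
have c0 : 0 < c by rewrite ltr_wpDl// addr_ge0// !mulr_ge0.
exists (D / c); first by rewrite divr_gt0.
move=> h; rewrite ltr_pdivlMr// => hD.
have e0 := mxnorm_ge0 abs (h - g).
have h1 : mxnorm (A *m h) - mxnorm (A *m g) <= d%:R * mxnorm A * mxnorm (h - g).
  by rewrite (le_trans (mxnormB_ge absP _ _))// -mulmxBr mxnormM.
have h2 : mxnorm (A *m g *m B) - mxnorm (A *m h *m B) <=
    d%:R * (d%:R * mxnorm A * mxnorm (h - g)) * mxnorm B.
  rewrite (le_trans (mxnormB_ge absP _ _))// -mulmxBl -mulmxBr.
  rewrite (le_trans (mxnormM absP _ _))// ler_wpM2r// ler_wpM2l//.
  by rewrite (mxnorm_distC absP h); exact: mxnormM.
have h3 := ler_wpM2l b0 h1; have h4 := ler_wpM2l a0 h2.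
by rewrite /c /D in hD; lra.
Qed.

(** Apart from a vanishing numerator or denominator, where the ratio is 0, the event compares two
    measurable functions: [num <= e^(-t) den]. *)
Lemma measurable_corr_event (f : 'rV[K]_d) (v : 'cV[K]_d) t : f != 0 -> v != 0 ->
  measurable [set g : mxM abs d | corr_ratio abs f g v = 0 \/
     t <= - ln (corr_ratio abs f g v)].
Proof.
move=> f0 v0; pose den (g : mxM abs d) := dualnorm abs f * opnorm abs g * vnorm abs v.
pose num (g : mxM abs d) := abs ((f *m g *m v) 0 0).
have den0 g : 0 <= den g by rewrite !mulr_ge0 ?opnorm_ge0 ?vnorm_ge0 ?ltW ?dualnorm_gt0.
have num0 g : 0 <= num g by exact: abs_ge0.
have mden : measurable_fun setT den.
  apply: measurable_funM => //; apply: measurable_funM => //.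
  exact: measurable_opnorm.
have mnum : measurable_fun setT num.
  apply: lower_semicontinuous_mx_measurable => // r.
  have := @mxnorm_mul_open 1 1 f v 1 0 r ler01 (lexx 0).
  congr mxopen; apply/seteqP; split => g /=; by rewrite mul0r addr0 mul1r (mxnorm11 absP).
have mset (F G : mxM abs d -> R) : measurable_fun setT F -> measurable_fun setT G ->
    measurable [set g | F g <= G g].
  move=> mF mG; rewrite [X in measurable X](_ : _ =
      setT `&` (fun g => F g <= G g) @^-1` [set true]).
    by apply: measurable_fun_ler.
  by apply/seteqP; split => g //= [].
rewrite [X in measurable X](_ : _ = [set g | num g <= 0] `|` [set g | den g <= 0] `|`
    [set g | num g <= expR (- t) * den g]).
  apply: measurableU; first apply: measurableU; apply: mset => //.
  by apply: measurable_funM.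
apply/seteqP; split => g /=.
- have [dg|dg] := leP (den g) 0; first by left; right.
  have [ng|ng] := leP (num g) 0; first by left; left.
  rewrite /corr_ratio -/(num g) -/(den g) => -[/eqP|h].
    by rewrite mulf_eq0 invr_eq0 !gt_eqF.
  right; rewrite -ler_pdivrMr// -[leLHS]lnK ?posrE ?divr_gt0// ler_expR.
  by rewrite lerNr.
- rewrite /corr_ratio -/(num g) -/(den g) => -[[ng|dg]|h].
  + by left; rewrite (_ : num g = 0) ?mul0r//; apply/eqP; rewrite eq_le ng num0.
  + by left; rewrite (_ : den g = 0) ?invr0 ?mulr0//; apply/eqP; rewrite eq_le dg den0.
  + have [dg|dg] := leP (den g) 0.
      by left; rewrite (_ : den g = 0) ?invr0 ?mulr0//; apply/eqP; rewrite eq_le dg den0.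
    have [ng|ng] := leP (num g) 0.
      by left; rewrite (_ : num g = 0) ?mul0r//; apply/eqP; rewrite eq_le ng num0.
    right; rewrite lerNr -[leRHS]expRK ler_ln ?posrE ?divr_gt0 ?expR_gt0//.
    by rewrite ler_pdivrMr.
Qed.

End NormMeasurability.

(** * Independence of disjoint segments *)

Section Restriction.
Local Open Scope ereal_scope.
Context (R : realType) (dO : measure_display) (Omega : measurableType dO).

Lemma ge0_integral_mrestr (P : {measure set Omega -> \bar R}) (B : set Omega)
    (mB : measurable B) (f : Omega -> \bar R) :
  measurable_fun setT f -> (forall w, 0 <= f w) ->
  \int[mrestr P mB]_w f w = \int[P]_(w in B) f w.
Proof.
move=> mf f0; rewrite -(setUv B) ge0_integral_setU//; last 3 first.
- exact: measurableC.
- by rewrite setUv.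
- exact/disj_setPCl.
rewrite [X in _ + X](_ : _ = 0) ?adde0.
  by apply: eq_measure_integral => A mA AB; rewrite /= /mrestr setIidl.
rewrite (eq_measure_integral (@mzero _ Omega R)) ?integral_measure_zero//.
move=> A mA AB; rewrite /= /mrestr (_ : A `&` B = set0) ?measure0//.
by rewrite -subset0 => w [/AB].
Qed.

(** For fixed [B], the finite measures [A |-> P (A]&[B)] and [A |-> P B * P A] agree on a generating
    family closed under intersection, hence on its sigma-algebra. The argument is run once for each
    factor. *)
Lemma indep_generated (P : probability Omega R) (G1 G2 : set (set Omega)) :
  setI_closed G1 -> setI_closed G2 -> G1 setT -> G2 setT ->
  G1 `<=` measurable -> G2 `<=` measurable ->
  (forall A B, G1 A -> G2 B -> P (A `&` B) = P A * P B) ->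
  forall A B, <<s G1 >> A -> <<s G2 >> B -> P (A `&` B) = P A * P B.
Proof.
move=> I1 I2 T1 T2 m1 m2 h.
have gen (G : set (set Omega)) : setI_closed G -> G setT -> G `<=` measurable ->
    forall B, measurable B -> (forall A, G A -> P (A `&` B) = P A * P B) ->
    forall A, <<s G >> A -> P (A `&` B) = P A * P B.
  move=> IG TG mG B mB hB.
  pose r : {nonneg R} := NngNum (fine_ge0 (measure_ge0 P B)).
  have rE : r%:num%:E = P B by rewrite /= fineK// fin_num_measure.
  have := @g_sigma_algebra_measure_unique _ R _ G mG (fun=> setT) (fun=> TG)
    _ (mrestr P mB) (mscale r P) IG.
  rewrite bigcup_const//.
  move=> /(_ erefl) H A /H; rewrite /= /mrestr /mscale => -> //.
  - by rewrite rE muleC.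
  - by move=> A' GA'; rewrite rE hB// muleC.
  - by move=> _; rewrite setTI (le_lt_trans (probability_le1 P mB))// ltry.
have sub (G : set (set Omega)) : G `<=` measurable -> <<s G >> `<=` measurable.
  by move=> mG; apply: smallest_sub => //; exact: sigma_algebra_measurable.
move=> A B gA gB; apply: (gen G1) => //; first exact: (sub G2).
move=> A' GA'; rewrite setIC muleC; apply: (gen G2) => //; first exact: m1.
by move=> B' GB'; rewrite setIC muleC; exact: h.
Qed.

End Restriction.

Section Sequence.
Local Open Scope ereal_scope.
Context (R : realType) (dO : measure_display) (Omega : measurableType dO)
  (P : probability Omega R) (dT : measure_display) (T : measurableType dT)
  (nu : probability T R) (gam : nat -> Omega -> T).
Hypothesis mgam : forall n, measurable_fun setT (gam n).
Hypothesis lawgam : forall n (A : set T), measurable A -> P (gam n @^-1` A) = nu A.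
Hypothesis indgam : forall n (A : nat -> set T), (forall i, measurable (A i)) ->
  P (\bigcap_(i in [set k | (k < n)%N]) (gam i @^-1` A i)) =
     (\prod_(i < n) P (gam i @^-1` A i))%E.

Definition cylinder n (A : nat -> set T) : set Omega :=
  \bigcap_(i in [set k | (k < n)%N]) (gam i @^-1` A i).

Lemma cylinder_prob n A : (forall i, measurable (A i)) ->
  P (cylinder n A) = \prod_(i < n) nu (A i).
Proof. by move=> mA; rewrite indgam//; apply: eq_bigr => i _; exact: lawgam. Qed.

Lemma measurable_preimage i (A : set T) : measurable A -> measurable (gam i @^-1` A).
Proof. by move=> mA; rewrite -[X in measurable X]setTI; exact: mgam. Qed.

(** Events constraining finitely many letters, all with index in [J]: an intersection-stable
    generator of the sigma-algebra of these letters. *)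
Definition cylinders (J : set nat) : set (set Omega) :=
  [set E | exists n A, [/\ forall i, measurable (A i), forall i, ~ J i -> A i = setT,
     forall i, (n <= i)%N -> A i = setT & E = cylinder n A]].

Lemma cylinder_extend n m A : (n <= m)%N -> (forall i, (n <= i)%N -> A i = setT) ->
  cylinder n A = cylinder m A.
Proof.
move=> nm hA; apply/seteqP; split => w h i /= im; last by apply: h; exact: leq_trans im nm.
by case: (ltnP i n) => [/h//|/hA] e; rewrite /= e.
Qed.

Lemma cylindersT J : cylinders J setT.
Proof. by exists 0%N, (fun=> setT); split => //; apply/esym; rewrite -subTset => w _ i. Qed.

Lemma cylinder_setI n A B : cylinder n A `&` cylinder n B = cylinder n (fun i => A i `&` B i).
Proof.
apply/seteqP; split => w; first by move=> [hA hB] i ni; split; [exact: hA|exact: hB].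
by move=> h; split => i /h [].
Qed.

Lemma cylinders_setI J : setI_closed (cylinders J).
Proof.
move=> _ _ [n [A [mA JA nA ->]]] [m [B [mB JB nB ->]]].
exists (maxn n m), (fun i => A i `&` B i); split.
- by move=> i; exact: measurableI.
- by move=> i Ji; rewrite JA// JB// setTI.
- by move=> i; rewrite geq_max => /andP[h1 h2]; rewrite nA// nB// setTI.
- rewrite (cylinder_extend (leq_maxl n m) nA) (cylinder_extend (leq_maxr n m) nB).
  exact: cylinder_setI.
Qed.

Lemma cylinders_measurable J : cylinders J `<=` measurable.
Proof.
move=> _ [n [A [mA _ _ ->]]]; case: n => [|n].
  rewrite (_ : cylinder 0 A = setT) //; by rewrite -subTset => w _ i.
by apply: bigcap_measurable => [|i _]; [exists 0%N|exact: measurable_preimage].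
Qed.

(** The sample space with the sigma-algebra of the letters indexed by [J]. Measurability from this
    type expresses that a variable depends on these letters only. *)
Definition pastType J := g_sigma_algebraType (cylinders J).

Lemma sigma_cylinders_measurable J E : <<s cylinders J >> E -> measurable E.
Proof.
apply: smallest_sub; first exact: sigma_algebra_measurable.
exact: cylinders_measurable.
Qed.

Lemma cylinders_indep (J1 J2 : set nat) A B : J1 `&` J2 = set0 ->
  <<s cylinders J1 >> A -> <<s cylinders J2 >> B -> P (A `&` B) = P A * P B.
Proof.
move=> J12; apply: indep_generated; try exact: cylinders_setI; try exact: cylindersT;
  try exact: cylinders_measurable.
move=> {A B} _ _ [n [A [mA JA nA ->]]] [m [B [mB JB nB ->]]].
rewrite (cylinder_extend (leq_maxl n m) nA) (cylinder_extend (leq_maxr n m) nB).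
rewrite cylinder_setI !cylinder_prob//; last by move=> i; exact: measurableI.
rewrite -big_split /=; apply: eq_bigr => i _.
have [Ji|Ji] := pselect (J1 i); last by rewrite JA// setTI probability_setT mul1e.
rewrite JB ?setIT ?probability_setT ?mule1// => J2i.
by have : (J1 `&` J2) i by []; rewrite J12.
Qed.

Lemma measurable_gam_past (J : set nat) i : J i ->
  measurable_fun setT (gam i : pastType J -> T).
Proof.
move=> Ji _ A mA; rewrite setTI; apply: sub_sigma_algebra.
exists i.+1, (fun k => if k == i then A else setT); split.
- by move=> k; case: ifP.
- by move=> k; case: eqP => // ->.
- by move=> k; case: eqP => // ->; rewrite ltnn.
- apply/seteqP; split => w h; last by have := h i (ltnSn i); rewrite /= eqxx.
  by move=> k _ /=; case: eqP => // ->.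
Qed.

Lemma measurable_past_total (J : set nat) d' (T' : measurableType d') (X : Omega -> T') :
  measurable_fun setT (X : pastType J -> T') -> measurable_fun setT X.
Proof.
by move=> mX _ A mA; exact: (sigma_cylinders_measurable (mX measurableT A mA)).
Qed.

Lemma past_preimage (J : set nat) d' (T' : measurableType d') (X : Omega -> T') A :
  measurable_fun setT (X : pastType J -> T') -> measurable A ->
  <<s cylinders J >> (X @^-1` A).
Proof. by move=> mX mA; have := mX measurableT A mA; rewrite setTI. Qed.

(** On the coarser sigma-algebra of [J1], the restriction of [P] to [B] coincides with [P B] times
    [P]. Pushing both forward along the identity therefore yields the equality of integrals for
    every nonnegative [z] at once. *)
Lemma indep_integral (J1 J2 : set nat) (z : Omega -> \bar R) B : J1 `&` J2 = set0 ->
  measurable_fun setT (z : pastType J1 -> \bar R) -> (forall w, 0 <= z w) ->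
  <<s cylinders J2 >> B -> \int[P]_(w in B) z w = P B * \int[P]_w z w.
Proof.
move=> J12 mz z0 sB; have mB := sigma_cylinders_measurable sB.
have mz' := measurable_past_total mz.
pose r : {nonneg R} := NngNum (fine_ge0 (measure_ge0 P B)).
have rE : r%:num%:E = P B by rewrite /= fineK// fin_num_measure.
have mid : measurable_fun setT (id : Omega -> pastType J1).
  by move=> _ A mA; rewrite setTI; exact: (sigma_cylinders_measurable mA).
rewrite -ge0_integral_mrestr// -rE -ge0_integral_mscale//.
transitivity (\int[pushforward (mrestr P mB) (id : Omega -> pastType J1)]_w z w).
  by rewrite ge0_integral_pushforward//.
transitivity (\int[pushforward (mscale r P) (id : Omega -> pastType J1)]_w z w); last first.
  by rewrite ge0_integral_pushforward//.
apply: eq_measure_integral => A mA _.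
change (P (A `&` B) = r%:num%:E * P A).
by rewrite rE (cylinders_indep J12)// muleC.
Qed.

End Sequence.

(** * Laws of products of consecutive letters *)

Section BlockLaw.
Local Open Scope ereal_scope.

Lemma rectangle_unique (R : realType) d1 d2 (T1 : measurableType d1) (T2 : measurableType d2)
    (m1 m2 : {measure set (T1 * T2) -> \bar R}) :
  (m1 setT < +oo) ->
  (forall A B, measurable A -> measurable B -> m1 (A `*` B) = m2 (A `*` B)) ->
  forall C, measurable C -> m1 C = m2 C.
Proof.
move=> fin h C mC.
apply: (measure_unique [set A `*` B | A in measurable & B in measurable] (fun=> setT)) => //.
- exact: measurable_prod_measurableType.
- move=> _ _ [A1 mA1 [A2 mA2 <-]] [B1 mB1 [B2 mB2 <-]].
  exists (A1 `&` B1); first exact: measurableI.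
  by exists (A2 `&` B2); [exact: measurableI|rewrite setXI].
- by move=> _; exists setT => //; exists setT => //; rewrite setXTT.
- by rewrite bigcup_const.
- by move=> _ [A mA [B mB <-]]; exact: h.
Qed.

Context (R : realType) (K : fieldType) (abs : K -> R) (n : nat).
Notation d := n.+1.
Hypothesis locK : is_local_field abs.
Variable nu : probability (mxM abs d) R.

Definition segment (Omega : Type) (gam : nat -> Omega -> mxM abs d) s m (w : Omega) : mxM abs d :=
  rprod (fun i => gam (s + i)%N w) m.

Lemma segmentD (Omega : Type) (gam : nat -> Omega -> mxM abs d) s m m' w :
  segment gam s (m + m') w = segment gam s m w *m segment gam (s + m) m' w.
Proof.
elim: m' => [|m' IH]; first by rewrite addn0 /segment /= mulmx1.
by rewrite addnS /segment /= -/(segment gam s (m + m') w) IH addnA mulmxA.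
Qed.

Definition interval_set s m : set nat := [set i | (s <= i < s + m)%N].

Section OneSpace.
Context (dO : measure_display) (Omega : measurableType dO) (P : probability Omega R)
  (gam : nat -> Omega -> mxM abs d).
Hypothesis iid : iid_with_law P gam nu.

Lemma measurable_segment_past (J : set nat) s m : (forall i, (s <= i < s + m)%N -> J i) ->
  measurable_fun setT (segment gam s m : pastType gam J -> mxM abs d).
Proof.
move=> h; apply: measurable_rprod => // i im; apply: measurable_gam_past.
by apply: h; rewrite leq_addr ltn_add2l.
Qed.

Lemma measurable_segment s m : measurable_fun setT (segment gam s m).
Proof.
have [mg _] := iid.
by apply: measurable_rprod.
Qed.

End OneSpace.

(** A shorter segment and the next letter are independent, so by induction their joint law is
    determined on rectangles. The law is thus free of the starting index and of the probability
    space, which carries constants from one space to all others. *)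
Lemma segment_law (dO dO' : measure_display) (Omega : measurableType dO)
    (Omega' : measurableType dO') (P : probability Omega R) (P' : probability Omega' R)
    (gam : nat -> Omega -> mxM abs d) (gam' : nat -> Omega' -> mxM abs d) s s' m B :
  iid_with_law P gam nu -> iid_with_law P' gam' nu -> measurable B ->
  P (segment gam s m @^-1` B) = P' (segment gam' s' m @^-1` B).
Proof.
move=> iid iid'; elim: m B => [|m IH] B mB.
  change (P (cst 1%:M @^-1` B) = P' (cst 1%:M @^-1` B)).
  by rewrite !preimage_cst; case: ifP; rewrite ?probability_setT ?measure0.
have rect (dQ : measure_display) (O : measurableType dQ) (Q : probability O R)
    (g : nat -> O -> mxM abs d) k (A1 A2 : set (mxM abs d)) : iid_with_law Q g nu ->
    measurable A1 -> measurable A2 ->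
    Q (segment g k m @^-1` A1 `&` g (k + m)%N @^-1` A2) = Q (segment g k m @^-1` A1) * nu A2.
  move=> [mg [lg ig]] mA1 mA2; rewrite -(lg (k + m)%N)//.
  apply: (cylinders_indep mg lg ig (J1 := interval_set k m) (J2 := [set (k + m)%N])).
  - by rewrite -subset0 => i [/andP[_ h1] /= e]; rewrite e ltnn in h1.
  - by apply: past_preimage => //; exact: measurable_segment_past.
  - by apply: past_preimage => //; exact: measurable_gam_past.
pose Y w : mxM abs d * mxM abs d := (segment gam s m w, gam (s + m)%N w).
pose Y' w : mxM abs d * mxM abs d := (segment gam' s' m w, gam' (s' + m)%N w).
have mY : measurable_fun setT Y.
  by apply/measurable_fun_pairP; split; [exact: (measurable_segment iid)|case: iid => mg _; exact: mg].
have mY' : measurable_fun setT Y'.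
  by apply/measurable_fun_pairP; split; [exact: (measurable_segment iid')|case: iid' => mg _; exact: mg].
pose C := [set x : mxM abs d * mxM abs d | B (x.1 *m x.2)].
have mC : measurable C.
  have := @measurable_mulmx R K abs n locK _ _ _ _ measurable_fst measurable_snd.
  by move=> /(_ measurableT B mB); rewrite setTI.
change (pushforward P Y C = pushforward P' Y' C).
apply: rectangle_unique => //.
  rewrite /= /pushforward preimage_setT probability_setT; exact: ltry.
move=> A1 A2 mA1 mA2; rewrite /= /pushforward.
have -> : Y @^-1` (A1 `*` A2) = segment gam s m @^-1` A1 `&` gam (s + m)%N @^-1` A2 by [].
have -> : Y' @^-1` (A1 `*` A2) = segment gam' s' m @^-1` A1 `&` gam' (s' + m)%N @^-1` A2 by [].
by rewrite !rect// IH.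
Qed.

End BlockLaw.

(** * Supports and the Schottky family *)

(* The axioms of a measure do not constrain its values on non-measurable sets,
   so a probability may be replaced by one vanishing there; hence a property
   asserted of every probability space can only be positivity of a measurable set. *)
Section ZeroOutside.
Local Open Scope ereal_scope.
Context (R : realType) (dO : measure_display) (Omega : measurableType dO).
Variable P : probability Omega R.

Definition zero_outside (A : set Omega) : \bar R :=
  if `[< measurable A >] then P A else 0.

Let zero_outside0 : zero_outside set0 = 0.
Proof. by rewrite /zero_outside; case: asboolP => // _; rewrite measure0. Qed.

Let zero_outside_ge0 A : 0 <= zero_outside A.
Proof. by rewrite /zero_outside; case: asboolP. Qed.

Lemma zero_outside_measurable A : measurable A -> zero_outside A = P A.
Proof. by move=> mA; rewrite /zero_outside; case: asboolP. Qed.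

Let zero_outside_sigma : semi_sigma_additive zero_outside.
Proof.
move=> F mF tF mUF; rewrite zero_outside_measurable//.
under eq_fun do under eq_bigr do rewrite zero_outside_measurable//.
exact: measure_semi_sigma_additive.
Qed.

HB.instance Definition _ := isMeasure.Build _ _ _ zero_outside
  zero_outside0 zero_outside_ge0 zero_outside_sigma.

Let zero_outsideT : zero_outside setT = 1.
Proof. by rewrite zero_outside_measurable ?probability_setT. Qed.

HB.instance Definition _ := @Measure_isProbability.Build _ _ _ zero_outside zero_outsideT.

End ZeroOutside.

Section Support.
Context (R : realType) (K : fieldType) (abs : K -> R) (n : nat).
Notation d := n.+1.
Hypothesis locK : is_local_field abs.
Let absP : is_absolute_value abs. Proof. by case: locK. Qed.
Variable nu : probability (mxM abs d) R.
Context (dO : measure_display) (Omega : measurableType dO) (P : probability Omega R)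
  (gam : nat -> Omega -> mxM abs d).
Hypothesis iid : iid_with_law P gam nu.
Local Notation mxnorm := (mxnorm abs).
Local Notation seg := (segment gam).
Local Notation ball := (@mxball R K abs n).

(** The topological support of the law of a product of [m] letters. *)
Definition in_support m (h : 'M[K]_d) :=
  forall r : R, 0 < r -> (0 < P (seg 0 m @^-1` ball h r))%E.

Lemma measurable_segment_preimage s m (B : set (mxM abs d)) : measurable B ->
  measurable (seg s m @^-1` B).
Proof.
by move=> mB; rewrite -[X in measurable X]setTI; exact: (measurable_segment locK iid).
Qed.

Lemma segment_indep s m s' m' (B B' : set (mxM abs d)) : (s + m <= s')%N ->
  measurable B -> measurable B' ->
  P (seg s m @^-1` B `&` seg s' m' @^-1` B') =
  (P (seg 0 m @^-1` B) * P (seg 0 m' @^-1` B'))%E.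
Proof.
move=> le mB mB'; have [mg [lg ig]] := iid.
rewrite -(segment_law locK s 0 _ iid iid mB) -(segment_law locK s' 0 _ iid iid mB').
apply: (cylinders_indep mg lg ig (J1 := interval_set s m) (J2 := interval_set s' m')).
- rewrite -subset0 => i [/= /andP[_ h1] /andP[h2 _]].
  by have := leq_trans le h2; rewrite leqNgt h1.
- by apply: past_preimage => //; apply: measurable_segment_past.
- by apply: past_preimage => //; apply: measurable_segment_past.
Qed.

Lemma in_supportM a b g h : in_support a g -> in_support b h -> in_support (a + b) (g *m h).
Proof.
move=> sg sh r r0; have [s s0 hs] := mulmx_continuous locK g h r0.
apply: (@lt_le_trans _ _ (P (seg 0 a @^-1` ball g s `&` seg a b @^-1` ball h s))).
  by rewrite segment_indep ?add0n//; [exact: mule_gt0 (sg _ s0) (sh _ s0)|exact: mxball_measurable..].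
apply: le_measure; rewrite ?inE.
- by apply: measurableI; apply: measurable_segment_preimage; exact: mxball_measurable.
- by apply: measurable_segment_preimage; exact: mxball_measurable.
- move=> w [h1 h2]; rewrite /preimage/= segmentD add0n; exact: hs.
Qed.

Lemma in_support0 : in_support 0 1%:M.
Proof.
move=> r r0; rewrite (_ : _ @^-1` _ = setT) ?probability_setT//.
by rewrite -subTset => w _; rewrite /preimage/= /mxball/= subrr (mxnorm0 absP).
Qed.

Lemma in_support_expr a g p : in_support a g -> in_support (a * p) (g ^+ p).
Proof.
move=> sg; elim: p => [|p IH]; first by rewrite muln0 expr0; exact: in_support0.
by rewrite mulnS addnC exprSr; exact: in_supportM.
Qed.

(** Applied to the measure [zero_outside P], the hypothesis forces the event to be measurable with
    positive [P]-probability. If [S] missed the support, it would be covered by countably many basic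
    balls of probability zero. *)
Lemma conv_pos_support m (S : set 'M[K]_d) : conv_pos nu m S ->
  exists2 h, S h & in_support m h.
Proof.
move=> cp; have [mg [lg ig]] := iid.
have iid' : iid_with_law (zero_outside P) gam nu.
  have mpre i A : measurable A -> measurable (gam i @^-1` A).
    by move=> mA; rewrite -[X in measurable X]setTI; exact: mg.
  split => //; split => [k A mA|k A mA].
    by rewrite /= zero_outside_measurable ?lg//; exact: mpre.
  rewrite /= zero_outside_measurable ?ig//.
    by apply: eq_bigr => i _; rewrite zero_outside_measurable//; exact: mpre.
  case: k => [|k]; last by apply: bigcap_measurable => [|i _]; [exists 0%N|exact: mpre].
  by rewrite (_ : \bigcap_(i in _) _ = setT)// -subTset => w _ i.
have := cp _ _ _ _ iid'; set E := [set w | _].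
rewrite /= /zero_outside; case: asboolP; last by rewrite ltxx.
move=> mE PE; apply: contrapT => h.
have hS g : S g -> exists2 r, 0 < r & P (seg 0 m @^-1` ball g r) = 0%E.
  move=> Sg; apply: contrapT => h'; apply: h; exists g => // r r0.
  rewrite lt_def measure_ge0 andbT; apply/eqP => z; apply: h'; by exists r.
have [D hD] := mxball_countable_basis n locK.
pose B a k := seg 0 m @^-1` ball (D a) k.+1%:R^-1.
have mB a k : measurable (B a k).
  by apply: measurable_segment_preimage; exact: mxball_measurable.
pose N := \bigcup_a \bigcup_k (if P (B a k) == 0%E then B a k else set0).
have nN : P.-negligible N.
  apply: negligible_bigcup => a; apply: negligible_bigcup => k.
  by case: eqP => [z|_]; [apply/negligibleP|exact: negligible_set0].
have : P.-negligible E.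
  apply: negligibleS nN => w /hS[r r0 Pr]; have [a [k [h1 h2]]] := hD (seg 0 m w) r r0.
  exists a => //; exists k => //.
  rewrite (_ : P (B a k) == 0%E)//; apply/eqP/le_anti; rewrite measure_ge0 andbT -Pr.
  apply: le_measure; rewrite ?inE.
  - exact: mB.
  - by apply: measurable_segment_preimage; exact: mxball_measurable.
  - by move=> w' /h2.
by move/negligibleP => /(_ mE) z; rewrite z ltxx in PE.
Qed.

(* Cone over the closure of the support of nu^{*(a + n0 p)} as p grows. *)
Definition limit_support n0 a (M : 'M[K]_d) := forall e : R, 0 < e ->
  exists N, forall p, (N <= p)%N -> exists c h,
    [/\ c != 0, in_support (a + n0 * p) h & mxnorm (c *: h - M) < e].

Lemma limit_supportM n0 a b M M' : limit_support n0 a M -> limit_support n0 b M' ->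
  limit_support n0 (a + b) (M *m M').
Proof.
move=> lM lM' e e0; have [s s0 hs] := mulmx_continuous locK M M' e0.
have [N hN] := lM s s0; have [N' hN'] := lM' s s0.
exists (N + N')%N => p hp.
(* The second factor keeps the fixed exponent [N'] and the first takes the rest, so the total is
   exactly [p]. *)
have [c [h [c0 sh hh]]] := hN (p - N')%N ltac:(lia).
have [c' [h' [c'0 sh' hh']]] := hN' N' (leqnn _).
exists (c * c'), (h *m h'); split; first by rewrite mulf_neq0.
- rewrite (_ : (_ + _)%N = ((a + n0 * (p - N')) + (b + n0 * N'))%N); first exact: in_supportM.
  by rewrite addnACA -mulnDr subnK//; lia.
- by rewrite -scalerA scalemxAr scalemxAl; exact: hs.
Qed.

Lemma limit_support_left n0 a b h M : in_support b h -> limit_support n0 a M ->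
  limit_support n0 (b + a) (h *m M).
Proof.
move=> sh lM e e0; have [s s0 hs] := mulmx_continuous locK h M e0.
have [N hN] := lM s s0; exists N => p /hN[c [h' [c0 sh' hh']]].
exists c, (h *m h'); split => //; first by rewrite -addnA; exact: in_supportM.
by rewrite scalemxAr; apply: hs => //; rewrite subrr (mxnorm0 absP).
Qed.

Lemma limit_support_right n0 a b h M : in_support b h -> limit_support n0 a M ->
  limit_support n0 (a + b) (M *m h).
Proof.
move=> sh lM e e0; have [s s0 hs] := mulmx_continuous locK M h e0.
have [N hN] := lM s s0; exists N => p /hN[c [h' [c0 sh' hh']]].
exists c, (h' *m h); split => //; first by rewrite addnAC; exact: in_supportM.
by rewrite scalemxAl; apply: hs => //; rewrite subrr (mxnorm0 absP).
Qed.

Lemma limit_supportZ n0 a M s : s != 0 -> limit_support n0 a M -> limit_support n0 a (s *: M).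
Proof.
move=> s0 lM e e0; have as0 : 0 < abs s by rewrite (abs_gt0 absP).
have [N hN] := lM (e / abs s) (divr_gt0 e0 as0).
exists N => p /hN[c [h [c0 sh hh]]]; exists (s * c), h; split => //.
  by rewrite mulf_neq0.
by rewrite -scalerA -scalerBr (mxnormZ absP) mulrC -ltr_pdivlMr.
Qed.

(* Powers of a rank one limit are multiples of it, which brings its phase back to 0. *)
Lemma limit_support_rank1 n0 a (u : 'cV_d) (phi : 'rV_d) : (0 < n0)%N ->
  (phi *m u) 0 0 != 0 -> limit_support n0 a (u *m phi) -> limit_support n0 0 (u *m phi).
Proof.
move=> n00 pu lM; set s := (phi *m u) 0 0 in pu.
have sq : u *m phi *m (u *m phi) = s *: (u *m phi).
  rewrite mulmxA -(mulmxA u) [phi *m u]mx11_scalar -/s mul_mx_scalar.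
  by rewrite -scalemxAl.
have lk k : limit_support n0 (k.+1 * a) (u *m phi).
  elim: k => [|k IH]; first by rewrite mul1n.
  rewrite mulSn -[u *m phi]scale1r -(mulVf pu) -scalerA -sq.
  apply: limit_supportZ; first by rewrite invr_neq0.
  exact: limit_supportM.
(* After [n0] factors the phase is [n0 * a], a multiple of [n0] that the exponent [p] absorbs. *)
move=> e e0; have [N hN] := lk n0.-1 e e0.
exists (N + a)%N => p hp; have [c [h [c0 sh hh]]] := hN (p - a)%N ltac:(lia).
exists c, h; split => //; rewrite add0n.
by rewrite prednK// -mulnDr subnKC// in sh; lia.
Qed.

End Support.

(** * Construction of the Schottky family *)

Section Schottky.
Context (R : realType) (K : fieldType) (abs : K -> R) (n : nat).
Notation d := n.+2.
Hypothesis locK : is_local_field abs.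
Let absP : is_absolute_value abs. Proof. by case: locK. Qed.
Variable nu : probability (mxM abs d) R.
Context (dO : measure_display) (Omega : measurableType dO) (P : probability Omega R)
  (gam : nat -> Omega -> mxM abs d).
Hypothesis iid : iid_with_law P gam nu.
Hypothesis irr : strongly_irreducible nu.
Hypothesis prox : proximal nu.
Local Notation mxnorm := (mxnorm abs).
Local Notation seg := (segment gam).
Local Notation ball := (@mxball R K abs n.+1).
Local Notation supp := (in_support P gam).
Local Notation limsupp := (limit_support P gam).

(** Excludes the exponent 0 from proximality, the empty product being the identity; the block length
    is thereby positive. *)
Lemma rho1_gt_rho2_neq1 : ~ rho1_gt_rho2 abs (1%:M : 'M[K]_d).
Proof.
move=> [L [iota [absL [s [absLP [_ [chiE [i [si hi]]]]]]]]].
have sizes : size s = d.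
  have := size_char_poly (1%:M : 'M[K]_d).
  by rewrite -(size_map_poly iota) chiE size_prod_XsubC => -[].
have root1 j : (j < size s)%N -> s`_j = 1.
  move=> js; have : root (char_poly (1%:M : 'M[L]_d)) s`_j.
    by rewrite -(map_mx1 iota) -map_char_poly chiE root_prod_XsubC mem_nth.
  rewrite -eigenvalue_root_char => /eigenvalueP[v]; rewrite mulmx1 => e v0.
  have : (s`_j - 1) *: v == 0 by rewrite scalerBl -e scale1r subrr.
  by rewrite scaler_eq0 (negbTE v0) orbF subr_eq0 => /eqP.
have [j jn ji] : exists2 j, (j < size s)%N & j != i.
  by rewrite sizes; case: (i) => [|k]; [exists 1%N|exists 0%N].
by have := hi j jn ji; rewrite !root1// ltxx.
Qed.

Lemma rank1_limit : exists n0 (u : 'cV[K]_d) (phi : 'rV[K]_d),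
  [/\ (0 < n0)%N, u != 0, phi != 0 & limsupp n0 0 (u *m phi)].
Proof.
have [n0 cp] := prox.
have [g rg sg] := conv_pos_support locK iid cp.
have n00 : (0 < n0)%N.
  rewrite lt0n; apply/eqP => n00; rewrite n00 in sg.
  apply: rho1_gt_rho2_neq1; suff <- : g = 1%:M by [].
  apply/eqP; rewrite -subr_eq0 -(mxnorm_eq0 absP); apply: contraT => g1.
  have g1' : 0 < mxnorm (g - 1%:M) by rewrite lt_def g1 mxnorm_ge0.
  have := sg _ g1'; rewrite (_ : _ @^-1` _ = set0) ?measure0 ?ltxx//.
  by rewrite -subset0 => w; rewrite /preimage/= /mxball/= (mxnorm_distC absP) ltxx.
case: (locK) => _ [_ [cpl _]].
have [u [phi [u0 phi0 h]]] := proximal_rank1 cpl rg.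
exists n0, u, phi; split => // e e0; have [N hN] := h e e0.
exists N => p /hN[c c0 hc]; exists c, (g ^+ p); split => //.
by rewrite add0n; exact: (in_support_expr locK iid).
Qed.

(** New pairs have the form [(h u, phi h')] with [h], [h'] in supports. Part (a) of strong
    irreducibility moves [h u] off the finitely many bad hyperplanes, part (b) does it for [phi h'].
    The matrix [h u phi h'] carries the phase of [h] and [h'], which is removed provided that it is
    not nilpotent. *)
Lemma general_position_pairs n0 (u : 'cV[K]_d) (phi : 'rV[K]_d) q :
  (0 < n0)%N -> u != 0 -> phi != 0 -> limsupp n0 0 (u *m phi) ->
  exists ps : seq ('cV[K]_d * 'rV[K]_d), [/\ size ps = q,
    general_position (map fst ps), general_position (map (fun p => p.2^T) ps) &
    forall p, p \in ps -> limsupp n0 0 (p.1 *m p.2)].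
Proof.
move=> n00 u0 phi0 lu; elim: q => [|q [ps [sps g1 g2 hps]]].
  by exists [::]; split => // X; rewrite subseq0 => /eqP -> _; rewrite nil_free.
have [N [fs [N0 fs0 hfs]]] := general_position_extend g1 isT.
have [k cp] := irr.1 N fs u N0 fs0 u0.
have [h /= /prodf_neq0 hh sh] := conv_pos_support locK iid cp.
pose u' := h *m u.
have fu' i : fs i *m u' != 0.
  by apply: contra_neq (hh i isT) => z; rewrite -mulmxA z mxE.
have u'0 : u' != 0.
  by apply: contra_neq (fu' (Ordinal N0)) => ->; rewrite mulmx0.
have [N' [fs' [N'0 fs'0 hfs']]] := general_position_extend g2 isT.
(* The extra index [ord0] demands [phi' u' != 0], that is, a rank one matrix that is not
   nilpotent. *)
pose vs (j : 'I_N'.+1) : 'cV[K]_d := if unlift ord0 j is Some j' then (fs' j')^T else u'.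
have vs0 j : vs j != 0.
  by rewrite /vs; case: unliftP => [j' _|_] //; rewrite trmx_eq0.
have [k' cp'] := irr.2 N'.+1 phi vs isT phi0 vs0.
have [h' /= /prodf_neq0 hh' sh'] := conv_pos_support locK iid cp'.
pose phi' := phi *m h'.
exists ((u', phi') :: ps); split => /=.
- by rewrite sps.
- exact: hfs.
- apply: hfs' => i; rewrite -trmx_eq0 trmx_mul trmxK.
  apply: contra_neq (hh' (lift ord0 i) isT) => z.
  by rewrite /vs liftK z mxE.
- move=> p; rewrite inE => /predU1P[->/=|]; last exact: hps.
  apply: (@limit_support_rank1 _ _ _ _ locK _ _ _ _ _ iid n0 (k + 0 + k')) => //.
    by have := hh' ord0 isT; rewrite /vs unlift_none.
  rewrite /u' /phi' mulmxA -(mulmxA h).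
  by apply: (limit_support_right locK iid) => //; apply: (limit_support_left locK iid).
Qed.

Lemma count_ord_nth (T : Type) (x0 : T) (s : seq T) (p : pred T) q : size s = q ->
  (\sum_(i < q) p (nth x0 s i) = count p s)%N.
Proof.
by move=> <-; rewrite -sumn_count sumnE big_map (big_nth x0) big_mkord.
Qed.

Lemma schottky_exists : exists m (u : 'I_(2 * d) -> 'cV[K]_d) (phi : 'I_(2 * d) -> 'rV[K]_d)
    (S : 'I_(2 * d) -> set (mxM abs d)) (e c : R),
  [/\ (0 < m)%N, 0 < c,
    forall i, mxopen abs (S i) /\ (0 < P (seg 0 m @^-1` S i))%E,
    (forall f : 'rV[K]_d, \sum_i (mxnorm (f *m u i) < e * mxnorm f)%R < d)%N /\
    (forall x : 'cV[K]_d, \sum_i (mxnorm (phi i *m x) < e * mxnorm x)%R < d)%N &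
    forall i g (f : 'rV[K]_d) (x : 'cV[K]_d), S i g -> e * mxnorm f <= mxnorm (f *m u i) ->
      e * mxnorm x <= mxnorm (phi i *m x) ->
      c * (mxnorm f * mxnorm g * mxnorm x) <= mxnorm (f *m g *m x)].
Proof.
have [n0 [u0 [phi0 [n00 nu0 nphi0 lu]]]] := rank1_limit.
have [ps [sps g1 g2 hps]] := general_position_pairs (2 * d) n00 nu0 nphi0 lu.
have [e1 e10 he1] := general_position_count absP g1 isT.
have [e2 e20 he2] := general_position_count absP g2 isT.
pose e := Num.min e1 e2; have e0 : 0 < e by rewrite lt_min e10 e20.
pose u (i : 'I_(2 * d)) := (nth (u0, phi0) ps i).1.
pose phi (i : 'I_(2 * d)) := (nth (u0, phi0) ps i).2.
have d0 : 0 < d%:R :> R by [].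
(* The largest error that [near_rank1_mul] tolerates. *)
pose del := e * e / 2 / (d%:R * d%:R).
have del0 : 0 < del by rewrite !divr_gt0 ?mulr_gt0.
pose B := \big[Num.max/1]_i (mxnorm (u i) * mxnorm (phi i) + del).
have B0 : 0 < B by rewrite (lt_le_trans ltr01)// bigmax_ge_id.
have lup i : limsupp n0 0 (u i *m phi i) by apply: hps; rewrite mem_nth// sps.
have /choice[N hN] : forall i, exists N, forall p, (N <= p)%N -> exists c h,
    [/\ c != 0, supp (0 + n0 * p) h & mxnorm (c *: h - u i *m phi i) < del].
  by move=> i; exact: lup.
(* One exponent for all indices, so that all the open sets concern the same block length [n0 * p];
   the successor keeps it positive. *)
pose p := (\max_i N i).+1.
have /choice[c hc] : forall i, exists c, exists h,
    [/\ c != 0, supp (n0 * p) h & mxnorm (c *: h - u i *m phi i) < del].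
  move=> i; have [|c [h hh]] := hN i p; last by exists c, h.
  by rewrite /p leqW// leq_bigmax.
pose S i : set (mxM abs d) := [set g | mxnorm (c i *: g - u i *m phi i) < del].
exists (n0 * p)%N, u, phi, S, e, (e * e / (2 * B)); split.
- by rewrite muln_gt0 n00.
- by rewrite divr_gt0 ?mulr_gt0.
- move=> i; have [h [c0 sh hh]] := hc i.
  have ac0 : 0 < abs (c i) by rewrite (abs_gt0 absP).
  have oS : mxopen abs (S i).
    move=> g gS; exists ((del - mxnorm (c i *: g - u i *m phi i)) / abs (c i)).
      by rewrite divr_gt0// subr_gt0.
    move=> g'; rewrite ltr_pdivlMr// mulrC -(mxnormZ absP) => hg'.
    rewrite /S/= (_ : _ - _ = c i *: (g' - g) + (c i *: g - u i *m phi i)); last first.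
      by rewrite scalerBr addrA subrK.
    by rewrite (le_lt_trans (mxnormD absP _ _))// -ltrBrDr.
  split => //; have [r r0 hr] := oS h hh.
  apply: (lt_le_trans (sh r r0)); apply: le_measure; rewrite ?inE.
  + by apply: (measurable_segment_preimage locK iid); exact: mxball_measurable.
  + by apply: (measurable_segment_preimage locK iid); exact: mxopen_measurable.
  + by move=> w /hr.
- split => [f|x].
    apply: leq_ltn_trans (he1 f).
    rewrite count_map -(count_ord_nth (u0, phi0) _ sps).
    apply: leq_sum => i _; rewrite /u /=; case: ltP => //= h.
    by rewrite (lt_le_trans h)// ler_wpM2r ?mxnorm_ge0// ge_min lexx.
  apply: leq_ltn_trans (he2 x^T).
  rewrite count_map -(count_ord_nth (u0, phi0) _ sps).
  apply: leq_sum => i _; rewrite /phi /= -trmx_mul !mxnorm_tr; case: ltP => //= h.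
  by rewrite (lt_le_trans h)// ler_wpM2r ?mxnorm_ge0// ge_min lexx orbT.
- move=> i g f x Sg hf hx; have [h [c0 _ _]] := hc i.
  apply: (near_rank1_mul absP c0 e0 del0) Sg hf hx.
    by rewrite /del mulrC divfK// gt_eqF// mulr_gt0.
  exact: (le_bigmax _ (fun i => mxnorm (u i) * mxnorm (phi i) + del)).
Qed.

End Schottky.

(** * Weights along chains of blocks *)

Section PastMonotone.
Context (R : realType) (dO : measure_display) (Omega : measurableType dO)
  (P : probability Omega R) (dT : measure_display) (T : measurableType dT)
  (nu : probability T R) (gam : nat -> Omega -> T).
Hypothesis mgam : forall n, measurable_fun setT (gam n).
Hypothesis lawgam : forall n (A : set T), measurable A -> P (gam n @^-1` A) = nu A.
Hypothesis indgam : forall n (A : nat -> set T), (forall i, measurable (A i)) ->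
  P (\bigcap_(i in [set k | (k < n)%N]) (gam i @^-1` A i)) =
     (\prod_(i < n) P (gam i @^-1` A i))%E.

Lemma cylinders_subset (J J' : set nat) : J `<=` J' ->
  <<s cylinders gam J >> `<=` <<s cylinders gam J' >>.
Proof.
move=> JJ'; apply: smallest_sub; first exact: smallest_sigma_algebra.
move=> _ [n [A [mA JA nA ->]]]; apply: sub_sigma_algebra.
by exists n, A; split => // i Ji; apply: JA => /JJ'.
Qed.

Lemma measurable_past_subset (J J' : set nat) d' (T' : measurableType d') (X : Omega -> T') :
  J `<=` J' -> measurable_fun setT (X : pastType gam J -> T') ->
  measurable_fun setT (X : pastType gam J' -> T').
Proof.
by move=> JJ' mX _ A mA; apply: (cylinders_subset JJ'); exact: (mX measurableT A mA).
Qed.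

Lemma measurable_past_indic (J : set nat) (B : set Omega) :
  <<s cylinders gam J >> B -> measurable_fun setT (\1_B : pastType gam J -> R).
Proof. by move=> sB; apply: measurable_indic. Qed.

Lemma indep_expectation (J1 J2 : set nat) (z : Omega -> R) B p : J1 `&` J2 = set0 ->
  measurable_fun setT (z : pastType gam J1 -> R) -> (forall w, 0 <= z w) ->
  <<s cylinders gam J2 >> B -> P B = p%:E ->
  (\int[P]_w (z w * \1_B w)%:E = p%:E * \int[P]_w (z w)%:E)%E.
Proof.
move=> J12 mz z0 sB pB.
have := indep_integral mgam lawgam indgam J12 (z := EFin \o z) _ _ sB.
rewrite pB => <- //; last by apply/measurable_EFinP.
rewrite [RHS]integral_mkcond epatch_indic; apply: eq_integral => w _ /=.
by rewrite EFinM.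
Qed.

(** Stands in for conditional expectation given the letters of [J1]: in a finite sum of products,
    each indicator depending on [J2] is replaced by its probability. *)
Lemma indep_mixture (I : finType) (J1 J2 : set nat) (h : I -> Omega -> R)
    (C : I -> set Omega) (p : I -> R) : J1 `&` J2 = set0 ->
  (forall i, measurable_fun setT (h i : pastType gam J1 -> R)) ->
  (forall i w, 0 <= h i w) ->
  (forall i, <<s cylinders gam J2 >> (C i)) -> (forall i, P (C i) = (p i)%:E) ->
  (\int[P]_w (\sum_i h i w * \1_(C i) w)%:E = \int[P]_w (\sum_i h i w * p i)%:E)%E.
Proof.
move=> J12 mh h0 sC pC.
have mh' i : measurable_fun setT (h i) by exact: measurable_past_total (mh i).
have mC i : measurable (C i) by exact: sigma_cylinders_measurable (sC i).
have p0 i : 0 <= p i by rewrite -lee_fin -pC.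
under eq_integral do rewrite -sumEFin.
under [RHS]eq_integral do rewrite -sumEFin.
rewrite ge0_integral_sum//; last 2 first.
- by move=> i; apply/measurable_EFinP; apply: measurable_funM => //; exact: measurable_indic.
- by move=> i w _; rewrite lee_fin mulr_ge0.
rewrite ge0_integral_sum//; last 2 first.
- by move=> i; apply/measurable_EFinP; apply: measurable_funM.
- by move=> i w _; rewrite lee_fin mulr_ge0.
apply: eq_bigr => i _; rewrite (indep_expectation J12 (mh i) _ (sC i) (pC i))//.
under [RHS]eq_integral do rewrite mulrC EFinM.
rewrite ge0_integralZl_EFin//; last by apply/measurable_EFinP.
by move=> w _; rewrite lee_fin.
Qed.

End PastMonotone.

Section Weights.
Variables (R : realType) (q : nat) (p : 'I_q -> R).
Hypothesis p01 : forall i, 0 < p i <= 1.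
Hypothesis q2 : (2 <= q)%N.

Let Q := \sum_i (p i)^-1.

(** Scores [x] satisfy [|x| <= b Q], and [2 b Q ^ 2 = 1] gives [|x| <= 1/2] and [2 x ^ 2 <= b].
    Hence [(1 + x)(1 + b - x) = 1 + b (1 + x) - x ^ 2 >= 1]. *)
Definition weight_gap : R := (2 * Q ^+ 2)^-1.
Local Notation b := weight_gap.

Let p0 i : 0 < p i. Proof. by case/andP: (p01 i). Qed.

Let pV1 i : 1 <= (p i)^-1.
Proof. by case/andP: (p01 i) => h1 h2; rewrite invf_ge1. Qed.

Let Q1 : 1 <= Q.
Proof.
have i0 : (0 < q)%N by exact: ltn_trans q2.
rewrite /Q (bigD1 (Ordinal i0))//= (le_trans (pV1 (Ordinal i0)))// lerDl.
by apply: sumr_ge0 => i _; rewrite invr_ge0 ltW.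
Qed.

Let Q0 : 0 < Q. Proof. exact: lt_le_trans ltr01 Q1. Qed.

Lemma weight_gap_gt0 : 0 < b.
Proof. by rewrite invr_gt0 mulr_gt0// exprn_gt0. Qed.

Let bQQ : 2 * b * Q * Q = 1.
Proof. by rewrite /b expr2; field; rewrite gt_eqF. Qed.

Let bQ : b * Q <= 2^-1.
Proof. by have := weight_gap_gt0; have := bQQ; have := Q1; nra. Qed.

Lemma weight_gap_le : b <= 2^-1.
Proof. by have := weight_gap_gt0; have := bQ; have := Q1; nra. Qed.

(** Spreads over the indices what the terms [b / p i] leave of the constant [1 + b]. *)
Let kap := (1 + b - b * Q) / q%:R.

Let qR : 0 < q%:R :> R. Proof. by rewrite ltr0n; exact: ltn_trans q2. Qed.

Let kap0 : 0 <= kap.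
Proof.
by rewrite divr_ge0 ?ler0n//; have := weight_gap_gt0; have := bQ; lra.
Qed.

(* [e i] records that the block fails the i-th alignment test and [s i] that it
   lies in the i-th Schottky set. The weight equals 1 + b - x where
   x = sum_i (b / p_i) (1 - 2 e_i) s_i; it is written as a combination of
   nonnegative terms for the sake of integration, and dominates 1 / (1 + x). *)
Definition weight_coef (e : 'I_q -> bool) (ib : 'I_q * bool) : R :=
  if ib.2 then kap + 2 * (b / p ib.1) * (e ib.1)%:R else kap + b / p ib.1.

Definition weight (e s : 'I_q -> bool) : R :=
  \sum_(ib : 'I_q * bool) weight_coef e ib * (s ib.1 == ib.2)%:R.

Let score (e s : 'I_q -> bool) : R := \sum_i b / p i * (1 - 2 * (e i)%:R) * (s i)%:R.

Lemma weightE e s : weight e s = 1 + b - score e s.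
Proof.
rewrite /weight.
transitivity (\sum_i \sum_(c : bool) (if c then kap + 2 * (b / p i) * (e i)%:R
     else kap + b / p i) * (s i == c)%:R).
  by rewrite [RHS]pair_big; apply: eq_bigr => -[i c] _.
have -> : 1 + b = \sum_(i < q) kap + \sum_i b / p i.
  by rewrite sumr_const card_ord -mulr_sumr -/Q /kap -[_ *+ q]mulr_natr divfK ?gt_eqF//; ring.
rewrite -big_split -sumrB; apply: eq_bigr => i _.
rewrite big_bool /=; case: (s i) => /=; ring.
Qed.

Let score_bound e s : `|score e s| <= b * Q.
Proof.
rewrite (le_trans (ler_norm_sum _ _ _))// /Q mulr_sumr; apply: ler_sum => i _.
have bp : 0 <= b / p i by rewrite divr_ge0 ?ltW ?weight_gap_gt0.
rewrite -mulrA normrM (ger0_norm bp) ler_piMr// ler_norml.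
by case: (e i) (s i) => [] [] /=; lra.
Qed.

Lemma weight_coef_ge0 e ib : 0 <= weight_coef e ib.
Proof.
case: ib => i c; rewrite /weight_coef /=.
have := divr_ge0 (ltW weight_gap_gt0) (ltW (p0 i)); have := kap0.
by case: c; case: (e i) => /=; lra.
Qed.

Lemma weight_ge0 e s : 0 <= weight e s.
Proof. by apply: sumr_ge0 => ib _; rewrite mulr_ge0 ?weight_coef_ge0. Qed.

Lemma weight_le2 e s : weight e s <= 2.
Proof.
rewrite weightE; have := score_bound e s; have := bQ; have := weight_gap_le.
by rewrite ler_norml => h1 h2 /andP[h3 h4]; lra.
Qed.

(** For a bad block, every [i] with [s i] has a failure on some side, so its contributions to the
    two scores [x] and [y] sum to at most 0. Then [x + y <= 0], whence [(1 + x)(1 + y) <= 1], while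
    the weights dominate [1 / (1 + x)] and [1 / (1 + y)]. *)
Lemma weightM_ge1 (e e' s : 'I_q -> bool) : (forall i, s i -> e i || e' i) ->
  1 <= weight e s * weight e' s.
Proof.
move=> h; rewrite !weightE.
have : score e s + score e' s <= 0.
  rewrite -big_split /=; apply: sumr_le0 => i _.
  have := divr_ge0 (ltW weight_gap_gt0) (ltW (p0 i)).
  have := h i; case: (s i); rewrite /= ?mulr0 ?addr0// => /(_ isT).
  by case: (e i); case: (e' i) => //= _; lra.
have := score_bound e s; have := score_bound e' s.
set x := score e s; set y := score e' s.
rewrite !ler_norml => /andP[y1 y2] /andP[x1 x2] xy.
have lb z : - (b * Q) <= z -> z <= b * Q -> 1 <= (1 + z) * (1 + b - z).
  move=> z1 z2; have zz : 2 * (z * z) <= b.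
    have : z * z <= (b * Q) * (b * Q) by have := weight_gap_gt0; nra.
    by have := bQQ; have := weight_gap_gt0; nra.
  have := bQ; nra.
have hx := lb x x1 x2; have hy := lb y y1 y2.
have b2 := bQ.
have x0 : 0 < 1 + x by lra.
have y0 : 0 < 1 + y by lra.
have xy1 : (1 + x) * (1 + y) <= 1 by nra.
have wx : 0 < 1 + b - x by have := weight_gap_gt0; lra.
have wy : 0 < 1 + b - y by have := weight_gap_gt0; lra.
have : 1 <= ((1 + x) * (1 + y)) * ((1 + b - x) * (1 + b - y)).
  rewrite (_ : _ * _ * _ = ((1 + x) * (1 + b - x)) * ((1 + y) * (1 + b - y))); last by ring.
  by rewrite -[leLHS]mulr1 ler_pM.
by move=> h1; rewrite (le_trans h1)// ler_piMl// mulr_ge0// ltW.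
Qed.

(** The factor [1 / p i] makes the mean score [b (q - 2 r)], with [r] the number of failures. This
    is at least [2 b], so the mean weight is at most [1 + b - 2 b]. *)
Lemma weight_mean (e : 'I_q -> bool) : (2 * \sum_i (e i) + 2 <= q)%N ->
  \sum_(ib : 'I_q * bool) weight_coef e ib * (if ib.2 then p ib.1 else 1 - p ib.1)
    <= 1 - b.
Proof.
move=> he.
have -> : \sum_(ib : 'I_q * bool) weight_coef e ib *
     (if ib.2 then p ib.1 else 1 - p ib.1) =
   \sum_i \sum_(c : bool) (if c then kap + 2 * (b / p i) * (e i)%:R
     else kap + b / p i) * (if c then p i else 1 - p i).
  by rewrite [RHS]pair_big; apply: eq_bigr => -[i c] _.
have -> : \sum_i \sum_(c : bool) (if c then kap + 2 * (b / p i) * (e i)%:R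
     else kap + b / p i) * (if c then p i else 1 - p i) =
  \sum_i (kap + b / p i - b + 2 * b * (e i)%:R).
  by apply: eq_bigr => i _; rewrite big_bool /=; field; rewrite gt_eqF.
rewrite !big_split /= -!mulr_sumr -/Q !sumr_const card_ord -natr_sum.
rewrite -[q%:R^-1 *+ q]mulr_natr mulVf ?gt_eqF// mulr1 -[- b *+ q]mulr_natr.
have : (2 * (\sum_i e i)%:R + 2 <= q%:R :> R) by rewrite -natrM -natrD ler_nat.
by have := weight_gap_gt0; nra.
Qed.

End Weights.

(** * Expectation of products of weights along independent blocks *)

Section Chain.
Context (R : realType) (dO : measure_display) (Omega : measurableType dO)
  (P : probability Omega R) (dT : measure_display) (T : measurableType dT)
  (nu : probability T R) (gam : nat -> Omega -> T).
Hypothesis mgam : forall n, measurable_fun setT (gam n).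
Hypothesis lawgam : forall n (A : set T), measurable A -> P (gam n @^-1` A) = nu A.
Hypothesis indgam : forall n (A : nat -> set T), (forall i, measurable (A i)) ->
  P (\bigcap_(i in [set k | (k < n)%N]) (gam i @^-1` A i)) =
     (\prod_(i < n) P (gam i @^-1` A i))%E.
Variables (q : nat) (p : 'I_q -> R).
Hypothesis p01 : forall i, 0 < p i <= 1.
Hypothesis q2 : (2 <= q)%N.

Local Notation past J := (<<s cylinders gam J >>).

Definition block_weight (E B : 'I_q -> set Omega) (w : Omega) : R :=
  weight p (fun i => w \in E i) (fun i => w \in B i).

Lemma measurable_weight_coef J (E : 'I_q -> set Omega) ib : (forall i, past J (E i)) ->
  measurable_fun setT ((fun w => weight_coef p (fun i => w \in E i) ib) : pastType gam J -> R).
Proof.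
move=> sE; rewrite /weight_coef; case: ib => i [] /=; last exact: measurable_cst.
apply: measurable_funD => //; apply: measurable_funM => //.
exact: measurable_past_indic (sE i).
Qed.

Lemma measurable_block_weight J (E B : 'I_q -> set Omega) :
  (forall i, past J (E i)) -> (forall i, past J (B i)) ->
  measurable_fun setT (block_weight E B : pastType gam J -> R).
Proof.
move=> sE sB; rewrite /block_weight /weight.
apply: measurable_sum => ib; apply: measurable_funM; first exact: measurable_weight_coef.
case: ib => i c /=.
apply: (@eq_measurable_fun _ _ (pastType gam J) R setT (\1_(if c then B i else ~` B i))).
  move=> w _; rewrite indicE; case: c; first by rewrite eqb_id.
  by rewrite in_setC; case: (w \in B i).
apply: measurable_past_indic; case: c => //.
by rewrite -setTD; apply: sigma_algebraCD.
Qed.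

(** The tests [E] depend on [J1] and the memberships [B] on [J2]; since the weight is linear in the
    indicators of the [B i] and of their complements, averaging over the block alone leaves
    [weight_mean]. *)
Lemma block_weight_step (J1 J2 : set nat) (z : Omega -> R) (E B : 'I_q -> set Omega) :
  J1 `&` J2 = set0 ->
  measurable_fun setT (z : pastType gam J1 -> R) -> (forall w, 0 <= z w) ->
  (forall i, past J1 (E i)) -> (forall i, past J2 (B i)) ->
  (forall i, P (B i) = (p i)%:E) ->
  (forall w, (2 * \sum_i (w \in E i) + 2 <= q)%N) ->
  (\int[P]_w (z w * block_weight E B w)%:E
     <= (1 - weight_gap p)%:E * \int[P]_w (z w)%:E)%E.
Proof.
move=> J12 mz z0 sE sB pB hE.
pose h (ib : 'I_q * bool) w := z w * weight_coef p (fun i => w \in E i) ib.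
pose C (ib : 'I_q * bool) := if ib.2 then B ib.1 else ~` B ib.1.
pose pr (ib : 'I_q * bool) := if ib.2 then p ib.1 else 1 - p ib.1.
have mz' : measurable_fun setT z by exact: measurable_past_total mz.
have mh ib : measurable_fun setT (h ib : pastType gam J1 -> R).
  by apply: measurable_funM => //; exact: measurable_weight_coef.
have mh' ib : measurable_fun setT (h ib) by exact: measurable_past_total (mh ib).
have gap0 : 0 <= 1 - weight_gap p by have := weight_gap_le p01 q2; lra.
rewrite (_ : (\int[P]_w (z w * block_weight E B w)%:E =
    \int[P]_w (\sum_ib h ib w * \1_(C ib) w)%:E)%E); last first.
  apply: eq_integral => w _; congr EFin; rewrite /block_weight /weight mulr_sumr.
  apply: eq_bigr => -[i c] _; rewrite /h /C mulrA indicE /=; congr (_ * _%:R).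
  by case: c; rewrite ?eqb_id ?in_setC//; case: (w \in B i).
rewrite (indep_mixture mgam lawgam indgam (p := pr) J12)//; last 3 first.
- by move=> ib w; rewrite mulr_ge0 ?weight_coef_ge0.
- move=> [i c]; rewrite /C /=; case: c => //.
  by rewrite -setTD; apply: sigma_algebraCD.
- move=> [i c]; rewrite /C /pr /=; case: c => //.
  by rewrite probability_setC ?pB//; exact: sigma_cylinders_measurable (sB i).
rewrite -ge0_integralZl_EFin//; last 2 first.
- by move=> w _; rewrite lee_fin.
- exact/measurable_EFinP.
have pr0 ib : 0 <= pr ib.
  by rewrite /pr; case: ib => i [] /=; case/andP: (p01 i) => h1 h2; lra.
apply: ge0_le_integral => //.
- by move=> w _; rewrite lee_fin sumr_ge0// => ib _; rewrite !mulr_ge0 ?weight_coef_ge0.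
- apply/measurable_EFinP; apply: measurable_sum => ib.
  by apply: measurable_funM.
- by apply/measurable_EFinP; apply: measurable_funM.
- move=> w _; rewrite -EFinM lee_fin mulrC.
  rewrite [leLHS](_ : _ = z w * \sum_ib weight_coef p (fun i => w \in E i) ib * pr ib).
    by rewrite ler_wpM2l// weight_mean.
  by rewrite mulr_sumr; apply: eq_bigr => ib _; rewrite mulrA.
Qed.

Section Blocks.
Variables (k0 : nat) (J blk : nat -> set nat) (E B : nat -> 'I_q -> set Omega).
Hypothesis Jblk : forall j, (j < k0)%N -> J j `&` blk j = set0.
Hypothesis JS : forall j, (j < k0)%N -> J j `|` blk j `<=` J j.+1.
Hypothesis sE : forall j i, (j < k0)%N -> past (J j) (E j i).
Hypothesis sB : forall j i, (j < k0)%N -> past (blk j) (B j i).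
Hypothesis pB : forall j i, (j < k0)%N -> P (B j i) = (p i)%:E.
Hypothesis cE : forall j w, (j < k0)%N -> (2 * \sum_i (w \in E j i) + 2 <= q)%N.

Let JS1 j : (j < k0)%N -> J j `<=` J j.+1.
Proof. by move=> jk x Jx; apply: JS => //; left. Qed.

Let JS2 j : (j < k0)%N -> blk j `<=` J j.+1.
Proof. by move=> jk x Jx; apply: JS => //; right. Qed.

(** [J j] holds the letters revealed before step [j] and [blk j] those of the block read at that
    step. The blocks may be read in either direction, which serves both sides. *)
Definition chain_weight k w : R := \prod_(j < k) block_weight (E j) (B j) w.

Lemma chain_weight_ge0 k w : 0 <= chain_weight k w.
Proof. by apply: prodr_ge0 => j _; exact: weight_ge0. Qed.

Lemma measurable_chain_weight k : (k <= k0)%N ->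
  measurable_fun setT (chain_weight k : pastType gam (J k) -> R).
Proof.
rewrite /chain_weight; elim: k => [_|k IH kk].
  by under eq_fun do rewrite big_ord0; exact: measurable_cst.
have {}IH := IH (ltnW kk).
under eq_fun do rewrite big_ord_recr /=.
apply: measurable_funM.
  exact: measurable_past_subset (@JS1 k kk) IH.
apply: measurable_block_weight => i.
  by apply: (cylinders_subset (@JS1 k kk)); exact: sE.
by apply: (cylinders_subset (@JS2 k kk)); exact: sB.
Qed.

Local Notation theta := (1 - weight_gap p).

Lemma theta_bounds : 2^-1 <= theta < 1.
Proof. by have := weight_gap_le p01 q2; have := weight_gap_gt0 p01 q2; lra. Qed.

Let theta0 : 0 <= theta.
Proof. by case/andP: theta_bounds => h _; rewrite (le_trans _ h). Qed.

Lemma chain_expectation k : (k <= k0)%N ->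
  (\int[P]_w (chain_weight k w)%:E <= (theta ^+ k)%:E)%E.
Proof.
elim: k => [_|k IH kk].
  under eq_integral do rewrite /chain_weight big_ord0.
  by rewrite integral_cst//= mul1e probability_setT expr0.
under eq_integral do rewrite /chain_weight big_ord_recr /= -/(chain_weight k _).
have := block_weight_step (Jblk kk) (measurable_chain_weight (ltnW kk)) (chain_weight_ge0 k)
  (fun i => sE i kk) (fun i => sB i kk) (fun i => pB i kk) (fun w => cE w kk).
move=> /le_trans; apply; rewrite exprS EFinM lee_wpmul2l//; exact: IH (ltnW kk).
Qed.

(** Only the block containing the letter [i0] loses its factor [theta]: its weight is bounded by 2,
    after which the letter is independent of the blocks read before. *)
Lemma chain_expectation_indic k i0 (A : set T) : (k <= k0)%N -> measurable A ->
  (exists2 j, (j < k)%N & blk j i0) ->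
  (\int[P]_w (chain_weight k w * \1_(gam i0 @^-1` A) w)%:E
     <= (2 * theta ^+ k.-1)%:E * nu A)%E.
Proof.
move=> kk mA [j0]; elim: k kk => [//|k IH] kk j0k ij0 /=.
have mC : measurable (gam i0 @^-1` A) by exact: measurable_preimage.
have mZ l : (l <= k0)%N -> measurable_fun setT (chain_weight l).
  by move=> lk; exact: measurable_past_total (measurable_chain_weight lk).
have mZk := mZ k (ltnW kk).
under eq_integral do rewrite /chain_weight big_ord_recr /= -/(chain_weight k _).
have [ik|ik] := pselect (blk k i0).
  apply: (@le_trans _ _ (\int[P]_w (2%:E * (chain_weight k w * \1_(gam i0 @^-1` A) w)%:E))%E).
    apply: ge0_le_integral => //.
    - by move=> w _; rewrite lee_fin !mulr_ge0 ?chain_weight_ge0 ?weight_ge0.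
    - apply/measurable_EFinP; apply: measurable_funM; last exact: measurable_indic.
      have := mZ k.+1 kk; rewrite /chain_weight; under eq_fun do rewrite big_ord_recr /=.
      by [].
    - apply/measurable_EFinP; apply: measurable_funM => //.
      by apply: measurable_funM => //; exact: measurable_indic.
    - move=> w _; rewrite -EFinM lee_fin mulrA ler_wpM2r// mulrC ler_wpM2r ?chain_weight_ge0//.
      exact: weight_le2.
  rewrite ge0_integralZl_EFin//; last 2 first.
  - by move=> w _; rewrite lee_fin mulr_ge0 ?chain_weight_ge0.
  - by apply/measurable_EFinP; apply: measurable_funM => //; exact: measurable_indic.
  rewrite (indep_expectation mgam lawgam indgam (p := fine (nu A)) (Jblk kk)
    (measurable_chain_weight (ltnW kk)) (chain_weight_ge0 k)); last 2 first.
  - apply: past_preimage => //; exact: measurable_gam_past.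
  - by rewrite lawgam// fineK// fin_num_measure.
  rewrite fineK ?fin_num_measure// muleCA EFinM -muleA [leRHS]muleA muleC.
  rewrite lee_wpmul2r//; rewrite lee_wpmul2l//; exact: chain_expectation (ltnW kk).
have j0k' : (j0 < k)%N.
  by rewrite ltn_neqAle -ltnS j0k andbT; apply/eqP => e; apply: ik; rewrite -e.
(* The letter is already revealed, so its indicator joins the past factor of [block_weight_step]. *)
have iJ : J k i0.
  have mono l : (l <= k0)%N -> (j0 < l)%N -> J l i0.
    elim: l => // l IHl lk; rewrite ltnS leq_eqVlt => /orP[/eqP e|h].
      by apply: JS => //; right; rewrite -e.
    by apply: JS => //; left; exact: IHl (ltnW lk) h.
  exact: mono (ltnW kk) j0k'.
have {}IH := IH (ltnW kk) j0k' ij0.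
have mzI : measurable_fun setT ((fun w => chain_weight k w * \1_(gam i0 @^-1` A) w) :
    pastType gam (J k) -> R).
  apply: measurable_funM; first exact: measurable_chain_weight (ltnW kk).
  apply: measurable_past_indic; apply: past_preimage => //; exact: measurable_gam_past.
have := block_weight_step (Jblk kk) mzI
  (fun w => mulr_ge0 (chain_weight_ge0 k w) (ler0n _ _)) (fun i => sE i kk)
  (fun i => sB i kk) (fun i => pB i kk) (fun w => cE w kk).
under eq_integral do rewrite mulrAC.
move=> /le_trans; apply.
rewrite (_ : (2 * theta ^+ k)%:E = (theta%:E * (2 * theta ^+ k.-1)%:E))%E; last first.
  by rewrite -EFinM mulrCA -exprS prednK//; exact: leq_ltn_trans j0k'.
by rewrite -muleA lee_wpmul2l.
Qed.

End Blocks.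

End Chain.

(** * Runs of bad blocks *)

Section NormEvents.
Variables (R : realType) (K : fieldType) (abs : K -> R) (n : nat).
Notation d := n.+1.
Hypothesis locK : is_local_field abs.

Lemma measurable_mxnorm_mul m p (A : 'M[K]_(m, d)) (B : 'M[K]_(d, p)) :
  measurable_fun setT (fun g : mxM abs d => mxnorm abs (A *m g *m B)).
Proof.
apply: lower_semicontinuous_mx_measurable => // r.
have := @mxnorm_mul_open _ _ _ _ locK _ _ A B 1 0 r ler01 (lexx 0).
by congr mxopen; apply/seteqP; split => g /=; rewrite mul0r addr0 mul1r.
Qed.

Lemma measurable_mxnorm_lt m p m' p' (A : 'M[K]_(m, d)) (B : 'M[K]_(d, p))
    (A' : 'M[K]_(m', d)) (B' : 'M[K]_(d, p')) e :
  measurable [set g : mxM abs d | mxnorm abs (A *m g *m B) < e * mxnorm abs (A' *m g *m B')].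
Proof.
rewrite [X in measurable X](_ : _ = setT `&`
    (fun g => mxnorm abs (A *m g *m B) < e * mxnorm abs (A' *m g *m B')) @^-1` [set true]).
  apply: measurable_fun_ltr => //; first exact: measurable_mxnorm_mul.
  by apply: measurable_funM => //; exact: measurable_mxnorm_mul.
by apply/seteqP; split => g //= [].
Qed.

End NormEvents.

Section BadBlocks.
Variables (R : realType) (K : fieldType) (abs : K -> R) (n : nat).
Notation d := n.+2.
Hypothesis locK : is_local_field abs.
Let absP : is_absolute_value abs. Proof. by case: locK. Qed.
Variable nu : probability (mxM abs d) R.
Context (dO : measure_display) (Omega : measurableType dO) (P : probability Omega R)
  (gam : nat -> Omega -> mxM abs d).
Hypothesis iid : iid_with_law P gam nu.
Local Notation mxnorm := (mxnorm abs).
Local Notation seg := (segment gam).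
Local Notation q := (2 * d)%N.
Variables (m : nat) (u : 'I_q -> 'cV[K]_d) (phi : 'I_q -> 'rV[K]_d)
  (S : 'I_q -> set (mxM abs d)) (e : R) (p : 'I_q -> R).
Hypothesis oS : forall i, mxopen abs (S i).
Hypothesis pS : forall s i, P (seg s m @^-1` S i) = (p i)%:E.
Hypothesis p01 : forall i, 0 < p i <= 1.
Hypothesis cu : forall f : 'rV[K]_d, (\sum_i (mxnorm (f *m u i) < e * mxnorm f)%R < d)%N.
Hypothesis cphi : forall x : 'cV[K]_d, (\sum_i (mxnorm (phi i *m x) < e * mxnorm x)%R < d)%N.
Variables (N : nat) (f : 'rV[K]_d) (v : 'cV[K]_d).

Definition left_fail s i : set Omega :=
  [set w | mxnorm (f *m seg 0 s w *m u i) < e * mxnorm (f *m seg 0 s w)].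

(** The subtraction is truncated: from [N] on nothing follows, and [v] itself is tested. *)
Definition right_fail s i : set Omega :=
  [set w | mxnorm (phi i *m (seg s (N - s) w *m v)) < e * mxnorm (seg s (N - s) w *m v)].

Local Notation theta := (1 - weight_gap p).

Lemma left_fail_past s i : <<s cylinders gam [set j | (j < s)%N] >> (left_fail s i).
Proof.
have := measurable_mxnorm_lt locK f (u i) f (1%:M : 'M[K]_d) e.
rewrite (_ : left_fail s i = seg 0 s @^-1` [set g | mxnorm (f *m g *m u i) <
    e * mxnorm (f *m g *m (1%:M : 'M[K]_d))]); last first.
  by apply/seteqP; split => w; rewrite /left_fail /preimage/= mulmx1.
move=> mE; apply: past_preimage mE; exact: measurable_segment_past.
Qed.

Lemma right_fail_past s i : <<s cylinders gam [set j | (s <= j)%N] >> (right_fail s i).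
Proof.
have := measurable_mxnorm_lt locK (phi i) v (1%:M : 'M[K]_d) v e.
rewrite (_ : right_fail s i = seg s (N - s) @^-1` [set g | mxnorm (phi i *m g *m v) <
    e * mxnorm ((1%:M : 'M[K]_d) *m g *m v)]); last first.
  by apply/seteqP; split => w; rewrite /right_fail /preimage/= mul1mx mulmxA.
move=> mE; apply: past_preimage mE; apply: measurable_segment_past => // j.
by case/andP.
Qed.

Lemma block_past s i : <<s cylinders gam (interval_set s m) >> (seg s m @^-1` S i).
Proof.
apply: past_preimage; first exact: measurable_segment_past.
exact: mxopen_measurable.
Qed.

Lemma left_fail_count s w : (2 * \sum_i (w \in left_fail s i) + 2 <= q)%N.
Proof.
have := cu (f *m seg 0 s w).
rewrite (_ : (\sum_i _)%N = \sum_i (w \in left_fail s i))%N; first by lia.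
by apply: eq_bigr => i _; congr nat_of_bool; apply/idP/idP; rewrite inE.
Qed.

Lemma right_fail_count s w : (2 * \sum_i (w \in right_fail s i) + 2 <= q)%N.
Proof.
have := cphi (seg s (N - s) w *m v).
rewrite (_ : (\sum_i _)%N = \sum_i (w \in right_fail s i))%N; first by lia.
by apply: eq_bigr => i _; congr nat_of_bool; apply/idP/idP; rewrite inE.
Qed.

(* The first alignment is tested from left to right, the second from right to left:
   each is then a chain, and a run of bad blocks makes one of the two products of
   weights at least 1. *)
Lemma bad_cover b0 k : exists G : set Omega, [/\ measurable G,
  forall w, ~ G w -> exists j i, [/\ (j < k)%N, S i (seg (b0 + j * m) m w),
     ~ left_fail (b0 + j * m) i w & ~ right_fail (b0 + j * m + m) i w],
  (P G <= (2 * theta ^+ k)%:E)%E &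
  forall i0 A, measurable A -> (b0 <= i0 < b0 + k * m)%N ->
    (P (G `&` gam i0 @^-1` A) <= (4 * theta ^+ k.-1)%:E * nu A)%E].
Proof.
have [mg [lg ig]] := iid.
have q2 : (2 <= q)%N by lia.
pose J j := [set i | (i < b0 + j * m)%N].
pose blk j := interval_set (b0 + j * m) m.
pose E j := left_fail (b0 + j * m).
pose B j i := seg (b0 + j * m) m @^-1` S i.
(* Reading from the right, step [j] meets block [k - j - 1], and every letter beyond it is
   revealed. *)
pose J' j := [set i | (b0 + (k - j) * m <= i)%N].
pose blk' j := interval_set (b0 + (k - j.+1) * m) m.
pose E' j := right_fail (b0 + (k - j) * m).
pose B' j i := seg (b0 + (k - j.+1) * m) m @^-1` S i.
have Jblk j : (j < k)%N -> J j `&` blk j = set0.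
  move=> _; rewrite -subset0 => i [].
  by rewrite /J /blk /interval_set /= => h1 /andP[h2 _]; move: h1; rewrite ltnNge h2.
have JS j : (j < k)%N -> J j `|` blk j `<=` J j.+1.
  by move=> _ i; rewrite /J /blk /interval_set /setU /= mulSn => -[h|/andP[h1 h2]]; lia.
have kj j : (j < k)%N -> ((k - j) * m = (k - j.+1) * m + m)%N.
  by move=> jk; rewrite (_ : (k - j = (k - j.+1).+1)%N) ?mulSn; lia.
have Jblk' j : (j < k)%N -> J' j `&` blk' j = set0.
  move=> jk; rewrite -subset0 => i []; rewrite /J' /blk' /interval_set /= kj// => h1 /andP[_].
  by rewrite -addnA ltnNge h1.
have JS' j : (j < k)%N -> J' j `|` blk' j `<=` J' j.+1.
  by move=> jk i; rewrite /J' /blk' /interval_set /setU /= kj// => -[h|/andP[h1 _]]; lia.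
have sE j i : (j < k)%N -> <<s cylinders gam (J j) >> (E j i) by move=> _; exact: left_fail_past.
have sB j i : (j < k)%N -> <<s cylinders gam (blk j) >> (B j i) by move=> _; exact: block_past.
have sE' j i : (j < k)%N -> <<s cylinders gam (J' j) >> (E' j i) by move=> _; exact: right_fail_past.
have sB' j i : (j < k)%N -> <<s cylinders gam (blk' j) >> (B' j i) by move=> _; exact: block_past.
have pB j i : (j < k)%N -> P (B j i) = (p i)%:E by move=> _; exact: pS.
have pB' j i : (j < k)%N -> P (B' j i) = (p i)%:E by move=> _; exact: pS.
have cE j w : (j < k)%N -> (2 * \sum_i (w \in E j i) + 2 <= q)%N by move=> _; exact: left_fail_count.
have cE' j w : (j < k)%N -> (2 * \sum_i (w \in E' j i) + 2 <= q)%N.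
  by move=> _; exact: right_fail_count.
pose Z := chain_weight p E B k; pose Z' := chain_weight p E' B' k.
have Z0 w : 0 <= Z w by exact: chain_weight_ge0.
have Z'0 w : 0 <= Z' w by exact: chain_weight_ge0.
have mZ : measurable_fun setT Z.
  exact: (measurable_past_total mg (measurable_chain_weight p JS sE sB (leqnn k))).
have mZ' : measurable_fun setT Z'.
  exact: (measurable_past_total mg (measurable_chain_weight p JS' sE' sB' (leqnn k))).
have mge (F : Omega -> R) : measurable_fun setT F -> measurable [set w | 1 <= F w].
  move=> mF; rewrite [X in measurable X](_ : _ = setT `&` (fun w => 1 <= F w) @^-1` [set true]).
    exact: measurable_fun_ler.
  by apply/seteqP; split => w //= [].
pose G := [set w | 1 <= Z w] `|` [set w | 1 <= Z' w].
have mG : measurable G by apply: measurableU; exact: mge.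
(* Markov's inequality before integration; multiplied by the indicator of [H], it serves both
   estimates. *)
have indG w : \1_G w <= Z w + Z' w.
  rewrite indicE; case: (boolP (w \in G)) => [|_]; last by rewrite addr_ge0.
  by rewrite inE => -[/= h|/= h]; rewrite (le_trans h)// ?lerDl ?lerDr.
have PG (H : set Omega) : measurable H ->
    (P (G `&` H) <= \int[P]_w (Z w * \1_H w)%:E + \int[P]_w (Z' w * \1_H w)%:E)%E.
  move=> mH; rewrite -ge0_integralD//; last 4 first.
  - by move=> w _; rewrite lee_fin mulr_ge0.
  - by apply/measurable_EFinP; apply: measurable_funM => //; exact: measurable_indic.
  - by move=> w _; rewrite lee_fin mulr_ge0.
  - by apply/measurable_EFinP; apply: measurable_funM => //; exact: measurable_indic.
  rewrite -[X in (P X <= _)%E](setIT (G `&` H)) -integral_indic//; last exact: measurableI.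
  apply: ge0_le_integral => //.
  - by apply/measurable_EFinP; apply: measurable_indic; exact: measurableI.
  - apply: emeasurable_funD; apply/measurable_EFinP; apply: measurable_funM => //;
      exact: measurable_indic.
  - move=> w _; rewrite -EFinD lee_fin -mulrDl indicI /=.
    by rewrite ler_wpM2r.
exists G; split => //.
- move=> w Gw; apply: contrapT => h.
  have hb j i : (j < k)%N -> w \in B j i -> (w \in E j i) || (w \in right_fail (b0 + j * m + m) i).
    move=> jk; rewrite inE => Bw; apply/orP; apply: contrapT => /not_orP[h1 h2].
    by apply: h; exists j, i; split => //; move=> hh; [apply: h1|apply: h2]; rewrite inE.
  (* Reindexed by block position, the two products can be multiplied block by block. *)
  have Z'E : Z' w = \prod_(j < k) block_weight p (right_fail (b0 + j * m + m)) (B j) w.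
    rewrite /Z' /chain_weight [RHS](reindex_inj rev_ord_inj); apply: eq_bigr => j _ /=.
    have jk := ltn_ord j; rewrite /E' /B' /B kj//.
    by rewrite addnA.
  have : 1 <= Z w * Z' w.
    rewrite Z'E /Z /chain_weight -big_split /=.
    apply: (big_ind (fun x : R => 1 <= x)) => [//|x y x1 y1|j _].
      by rewrite -[leLHS]mulr1 ler_pM.
    by apply: weightM_ge1 => // i; apply: hb.
  have [/negP] : ~ (1 <= Z w) /\ ~ (1 <= Z' w) by split => h'; apply: Gw; [left|right].
  rewrite -ltNge => h1 /negP; rewrite -ltNge => h2.
  by apply/negP; rewrite -ltNge; have := Z0 w; have := Z'0 w; nra.
- rewrite -[X in P X]setIT (le_trans (PG _ measurableT))//.
  under eq_integral do rewrite indicT mulr1.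
  under [X in (_ + X <= _)%E]eq_integral do rewrite indicT mulr1.
  rewrite mulr2n mulrDl mul1r EFinD; apply: leeD.
    exact: (chain_expectation mg lg ig p01 q2 Jblk JS sE sB pB cE (leqnn k)).
  exact: (chain_expectation mg lg ig p01 q2 Jblk' JS' sE' sB' pB' cE' (leqnn k)).
- move=> i0 A mA /andP[i1 i2].
  have mH : measurable (gam i0 @^-1` A) by exact: measurable_preimage.
  have m0 : (0 < m)%N by case: (posnP m) => // m0; rewrite m0 muln0 in i2; lia.
  pose j0 := ((i0 - b0) %/ m)%N.
  have j0P : (j0 * m <= i0 - b0 < j0 * m + m)%N.
    by rewrite leq_trunc_div addnC -mulSn ltn_ceil.
  have j0k : (j0 < k)%N by rewrite ltn_divLR//; lia.
  rewrite (le_trans (PG _ mH))//.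
  rewrite (_ : 4 * theta ^+ k.-1 = 2 * theta ^+ k.-1 + 2 * theta ^+ k.-1); last by ring.
  have th0 : 0 <= 2 * theta ^+ k.-1.
    by rewrite mulr_ge0// exprn_ge0//; have := weight_gap_le p01 q2; lra.
  rewrite EFinD ge0_muleDl ?lee_fin//; apply: leeD.
    apply: (chain_expectation_indic mg lg ig p01 q2 Jblk JS sE sB pB cE (leqnn k) mA).
    by exists j0 => //; rewrite /blk /interval_set /=; lia.
  apply: (chain_expectation_indic mg lg ig p01 q2 Jblk' JS' sE' sB' pB' cE' (leqnn k) mA).
  exists (k - j0.+1)%N; first by lia.
  rewrite /blk' /interval_set /= (_ : (k - (k - j0.+1).+1 = j0)%N); last by lia.
  by lia.
Qed.

End BadBlocks.

(** Otherwise the sum is at most [t - l (D + 1)], which is smaller than [t - D]; the 1 makes this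
    strict. *)
Lemma exists_above_average (R : realType) (x : nat -> R) l t a D : (0 < l)%N -> 0 <= D ->
  t <= D + \sum_(i < l) (x i + a) -> exists2 i, (i < l)%N & t / l%:R - (a + D + 1) < x i.
Proof.
move=> l0 D0 tD; apply: contrapT => h.
have lR : 1 <= l%:R :> R by rewrite ler1n.
have lR0 : 0 < l%:R :> R by rewrite ltr0n.
have : \sum_(i < l) (x i + a) <= \sum_(i < l) (t / l%:R - (D + 1)).
  apply: ler_sum => i _; have : x i <= t / l%:R - (a + D + 1).
    by rewrite leNgt; apply/negP => xi; apply: h; exists i.
  lra.
rewrite sumr_const card_ord -[X in _ <= X -> _]mulr_natr mulrBl divfK ?gt_eqF//.
by nra.
Qed.

Lemma sume_const (R : realType) n (x : \bar R) : (\sum_(i < n) x = n%:R%:E * x)%E.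
Proof.
elim: n => [|n IH]; first by rewrite big_ord0 mul0e.
by rewrite big_ord_recr /= IH -natr1 EFinD ge0_muleDl ?lee_fin// mul1e.
Qed.

Section WindowBound.
Local Open Scope ereal_scope.
Context (R : realType) (dO : measure_display) (Omega : measurableType dO)
  (P : probability Omega R) (dT : measure_display) (T : measurableType dT)
  (nu : probability T R) (gam : nat -> Omega -> T).
Hypothesis mgam : forall n, measurable_fun setT (gam n).

(* Decompose according to the least k with w \notin G k. *)
Lemma window_bound (K m : nat) (theta : R) (b0 : nat -> nat) (G : nat -> set Omega)
    (A : nat -> set T) (EV U : set Omega) :
  measurable EV -> measurable U -> P (~` U) = 0 ->
  (forall k, measurable (G k)) -> (forall k, measurable (A k)) ->
  (forall w, G 0%N w) ->
  P (G K) <= (2 * theta ^+ K)%:E ->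
  (forall k i, (k < K)%N -> (i < k * m)%N ->
     P (G k `&` gam (b0 k + i)%N @^-1` A k) <= (4 * theta ^+ k.-1)%:E * nu (A k)) ->
  (forall w k, EV w -> U w -> (k < K)%N -> ~ G k.+1 w ->
     exists2 i, (i < k * m)%N & A k (gam (b0 k + i)%N w)) ->
  P EV <= (2 * theta ^+ K)%:E +
    \sum_(k < K) ((k * m)%:R * (4 * theta ^+ k.-1))%:E * nu (A k).
Proof.
move=> mEV mU U0 mG mA G0 GK GA hEV.
have mI k i : measurable (G k `&` gam (b0 k + i)%N @^-1` A k).
  by apply: measurableI => //; exact: measurable_preimage.
pose V k := \big[setU/set0]_(i < (k * m)%N) (G k `&` gam (b0 k + i)%N @^-1` A k).
have mV k : measurable (V k) by apply: bigsetU_measurable.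
have mVV : measurable (\big[setU/set0]_(k < K) V k) by apply: bigsetU_measurable.
have sub : EV `<=` ~` U `|` (G K `|` \big[setU/set0]_(k < K) V k).
  move=> w EVw; have [Uw|] := pselect (U w); last by left.
  right; have [GKw|nGK] := pselect (G K w); [by left|right].
  have [k kK [Gk nGk]] : exists2 k, (k < K)%N & G k w /\ ~ G k.+1 w.
    apply: contrapT => h; apply: nGK.
    have : forall k, (k <= K)%N -> G k w.
      elim=> [//|k IH] kK; apply: contrapT => nG; apply: h.
      by exists k => //; split => //; exact: IH (ltnW kK).
    by apply.
  have [i ik Ai] := hEV w k EVw Uw kK nGk.
  have Vw : V k w.
    by rewrite /V -(bigcup_mkord (k * m)%N (fun i => G k `&` gam (b0 k + i)%N @^-1` A k)); exists i.
  by rewrite -bigcup_mkord; exists k.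
apply: (@le_trans _ _ (P (~` U `|` (G K `|` \big[setU/set0]_(k < K) V k)))).
  apply: le_measure; rewrite ?inE//; apply: measurableU; first exact: measurableC.
  exact: measurableU.
apply: (le_trans (measureU2 _ _ _)).
- exact: measurableC.
- exact: measurableU.
rewrite [X in X + _]U0 add0e; apply: (le_trans (measureU2 _ _ _)) => //.
apply: leeD => //.
apply: (le_trans (Boole_inequality _ (fun k _ => mV k))).
apply: lee_sum => k _.
apply: (le_trans (Boole_inequality _ (fun i _ => mI k i))).
apply: (@le_trans _ _ (\sum_(i < (k * m)%N) (4 * theta ^+ k.-1)%:E * nu (A k))).
  by apply: lee_sum => i _; exact: GA.
by rewrite sume_const EFinM muleA.
Qed.

End WindowBound.

(** * One-sided estimates *)

Section Windows.
Variables (R : realType) (K : fieldType) (abs : K -> R) (n : nat).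
Notation d := n.+2.
Hypothesis absP : is_absolute_value abs.
Local Notation mxnorm := (mxnorm abs).

Let d0 : 0 < d%:R :> R. Proof. by []. Qed.

Lemma lncond_mul (g h : 'M[K]_d) : g \in unitmx -> h \in unitmx ->
  lncond abs (g *m h) <= lncond abs g + lncond abs h + ln (d%:R * d%:R).
Proof.
move=> ug uh.
have pos (x : 'M[K]_d) : x \in unitmx -> 0 < mxnorm x * mxnorm (invmx x).
  by move=> ux; rewrite -(pmulr_rgt0 _ d0) (lt_le_trans ltr01)// unit_cond_ge1.
have ugh : g *m h \in unitmx by rewrite unitmx_mul ug.
have p1 := pos g ug; have p2 := pos h uh; have p3 := pos _ ugh.
have dd : 0 < d%:R * d%:R :> R by rewrite mulr_gt0.
have p12 := mulr_gt0 p1 p2; have p12d := mulr_gt0 p12 dd.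
rewrite /lncond -lnM ?posrE// -lnM ?posrE// ler_ln ?posrE//.
have -> : invmx (g *m h) = invmx h *m invmx g := invrM ug uh.
have h1 := mxnormM absP g h; have h2 := mxnormM absP (invmx h) (invmx g).
have := ler_pM (mxnorm_ge0 _ _) (mxnorm_ge0 _ _) h1 h2.
by move=> /le_trans; apply; rewrite le_eqVlt; apply/orP; left; apply/eqP; ring.
Qed.

Lemma segment_unit (Omega : Type) (gam : nat -> Omega -> mxM abs d) s l w :
  (forall i, (i < l)%N -> gam (s + i)%N w \in unitmx) -> segment gam s l w \in unitmx.
Proof.
elim: l => [|l IH] h; first exact: unitmx1.
rewrite /segment /= unitmx_mul IH ?h//= => i il; apply: h; exact: ltnW.
Qed.

Lemma lncond_segment (Omega : Type) (gam : nat -> Omega -> mxM abs d) s l w :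
  (forall i, (i < l)%N -> gam (s + i)%N w \in unitmx) ->
  lncond abs (segment gam s l w) <=
    \sum_(i < l) (lncond abs (gam (s + i)%N w) + ln (d%:R * d%:R)).
Proof.
elim: l => [|l IH] h.
  rewrite big_ord0 /lncond /segment /= invmx1 ln_le0//.
  have m1 : mxnorm (1%:M : 'M[K]_d) <= 1.
    apply: mxnorm_leP => // i j; rewrite mxE; case: (_ == _).
      by rewrite (abs1 absP).
    by rewrite (abs0 absP).
  by rewrite mulr_ile1 ?mxnorm_ge0.
rewrite big_ord_recr /=.
have ul i : (i < l)%N -> gam (s + i)%N w \in unitmx by move=> il; apply: h; exact: ltnW.
apply: (le_trans (lncond_mul (segment_unit ul) (h l (ltnSn l)))).
by rewrite addrA; do 2 apply: lerD => //; exact: IH.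
Qed.

Variables (Omega : Type) (gam : nat -> Omega -> mxM abs d).
Local Notation seg := (segment gam).

Lemma segment3 s m N w : (s + m <= N)%N ->
  seg 0 N w = seg 0 s w *m seg s m w *m seg (s + m) (N - (s + m)) w.
Proof.
move=> h; have := segmentD gam 0 (s + m) (N - (s + m)) w; rewrite subnKC// add0n => ->.
by have := segmentD gam 0 s m w; rewrite add0n => ->.
Qed.

Lemma expR_cond_bound (X Y t a b : R) : 0 < X -> 0 < b -> 0 < a -> X <= a * b * Y ->
  Y <= expR (- t) * X -> t <= ln a + ln b.
Proof.
move=> X0 b0 a0 XY YX; rewrite -lnM ?posrE// -[leLHS]expRK ler_ln ?posrE ?expR_gt0 ?mulr_gt0//.
have ab : 0 < a * b by rewrite mulr_gt0.
have : X <= a * b * (expR (- t) * X) by rewrite (le_trans XY)// ler_wpM2l// ltW.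
rewrite mulrA ler_pMl// expRN ler_pdivlMr ?expR_gt0// mul1r.
by [].
Qed.

(** With [L] the product of the letters before the good block [g] and [x] the vector after it,
    [|f| <= d |f L||L^-1|] and [|L g x| <= d ^ 2 |L||g||x|]. Hence [|f||gamma v|] is at most
    [d ^ 3 / c] times the condition number of [L] times [|f gamma v|]. *)
Lemma left_window (f : 'rV[K]_d) (v : 'cV[K]_d) s m N c t w : 0 < c ->
  (s + m <= N)%N -> (forall i, (i < N)%N -> gam i w \in unitmx) -> f != 0 -> v != 0 ->
  c * (mxnorm (f *m seg 0 s w) * mxnorm (seg s m w) *
     mxnorm (seg (s + m) (N - (s + m)) w *m v)) <=
     mxnorm (f *m seg 0 s w *m seg s m w *m (seg (s + m) (N - (s + m)) w *m v)) ->
  mxnorm (f *m seg 0 N w *m v) <= expR (- t) * (mxnorm f * mxnorm (seg 0 N w *m v)) ->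
  t <= ln (d%:R ^+ 3 / c) + \sum_(i < s) (lncond abs (gam i w) + ln (d%:R * d%:R)).
Proof.
move=> c0 sm un f0 v0 good small.
have uL : seg 0 s w \in unitmx by apply: segment_unit => i il; apply: un; lia.
have uN : seg 0 N w \in unitmx by apply: segment_unit => i il; apply: un; lia.
have hL : lncond abs (seg 0 s w) <= \sum_(i < s) (lncond abs (gam i w) + ln (d%:R * d%:R)).
  by apply: lncond_segment => i il; apply: un; lia.
rewrite (le_trans _ (lerD (lexx _) hL))//.
have fullE := segment3 w sm.
set L := seg 0 s w in uL hL good fullE *; set g := seg s m w in good fullE.
set x := seg (s + m) _ w *m v in good.
have fv : f *m seg 0 N w *m v = f *m L *m g *m x by rewrite fullE /x !mulmxA.
have Nv : seg 0 N w *m v = L *m (g *m x) by rewrite fullE /x !mulmxA.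
apply: (expR_cond_bound (X := mxnorm f * mxnorm (seg 0 N w *m v))
   (Y := mxnorm (f *m seg 0 N w *m v))) small.
- rewrite mulr_gt0 ?(mxnorm_gt0 absP)//.
  by apply: contra_neq v0 => z; rewrite -(mulKmx uN v) z mulmx0.
- by rewrite -(pmulr_rgt0 _ d0) (lt_le_trans ltr01)// unit_cond_ge1.
- by rewrite divr_gt0// exprn_gt0.
- rewrite fv Nv.
  have h1 := mxnorm_unit_row absP f uL.
  have h2 : mxnorm (L *m (g *m x)) <= d%:R * mxnorm L * (d%:R * mxnorm g * mxnorm x).
    rewrite (le_trans (mxnormM absP _ _))// ler_wpM2l ?mulr_ge0 ?mxnorm_ge0//.
    exact: mxnormM.
  rewrite (le_trans (ler_pM (mxnorm_ge0 _ _) (mxnorm_ge0 _ _) h1 h2))//.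
  rewrite [leLHS](_ : _ = d%:R ^+ 3 / c * (mxnorm L * mxnorm (invmx L)) *
     (c * (mxnorm (f *m L) * mxnorm g * mxnorm x))); last by field; rewrite gt_eqF.
  by rewrite ler_wpM2l// !mulr_ge0 ?mxnorm_ge0 ?invr_ge0 ?exprn_ge0// ltW.
Qed.

(** The mirror of [left_window]: now the letters after the good block are paid for, through
    [|v| <= d |X^-1||X v|]. *)
Lemma right_window (f : 'rV[K]_d) (v : 'cV[K]_d) s m N c t w : 0 < c ->
  (s + m <= N)%N -> (forall i, (i < N)%N -> gam i w \in unitmx) -> f != 0 -> v != 0 ->
  c * (mxnorm (f *m seg 0 s w) * mxnorm (seg s m w) *
     mxnorm (seg (s + m) (N - (s + m)) w *m v)) <=
     mxnorm (f *m seg 0 s w *m seg s m w *m (seg (s + m) (N - (s + m)) w *m v)) ->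
  mxnorm (f *m seg 0 N w *m v) <= expR (- t) * (mxnorm (f *m seg 0 N w) * mxnorm v) ->
  t <= ln (d%:R ^+ 3 / c) + \sum_(i < N - (s + m))
     (lncond abs (gam (s + m + i)%N w) + ln (d%:R * d%:R)).
Proof.
move=> c0 sm un f0 v0 good small.
have uX : seg (s + m) (N - (s + m)) w \in unitmx by apply: segment_unit => i il; apply: un; lia.
have uN : seg 0 N w \in unitmx by apply: segment_unit => i il; apply: un; lia.
have hX : lncond abs (seg (s + m) (N - (s + m)) w) <=
    \sum_(i < N - (s + m)) (lncond abs (gam (s + m + i)%N w) + ln (d%:R * d%:R)).
  by apply: lncond_segment => i il; apply: un; lia.
rewrite (le_trans _ (lerD (lexx _) hX))//.
have fullE := segment3 w sm.
set X := seg (s + m) _ w in uX hX good fullE *; set g := seg s m w in good fullE.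
set y := f *m seg 0 s w in good.
have fv : f *m seg 0 N w *m v = y *m g *m (X *m v) by rewrite fullE /y !mulmxA.
have fN : f *m seg 0 N w = y *m g *m X by rewrite fullE /y !mulmxA.
apply: (expR_cond_bound (X := mxnorm (f *m seg 0 N w) * mxnorm v)
   (Y := mxnorm (f *m seg 0 N w *m v))) small.
- rewrite mulr_gt0 ?(mxnorm_gt0 absP)//.
  by apply: contra_neq f0 => z; rewrite -(mulmxK uN f) z mul0mx.
- by rewrite -(pmulr_rgt0 _ d0) (lt_le_trans ltr01)// unit_cond_ge1.
- by rewrite divr_gt0// exprn_gt0.
- rewrite fv fN.
  have h1 := mxnorm_unit_col absP v uX.
  have h2 : mxnorm (y *m g *m X) <= d%:R * (d%:R * mxnorm y * mxnorm g) * mxnorm X.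
    rewrite (le_trans (mxnormM absP _ _))// ler_wpM2r ?mxnorm_ge0// ler_wpM2l//.
    exact: mxnormM.
  rewrite (le_trans (ler_pM (mxnorm_ge0 _ _) (mxnorm_ge0 _ _) h2 h1))//.
  rewrite [leLHS](_ : _ = d%:R ^+ 3 / c * (mxnorm X * mxnorm (invmx X)) *
     (c * (mxnorm y * mxnorm g * mxnorm (X *m v)))); last by field; rewrite gt_eqF.
  by rewrite ler_wpM2l// !mulr_ge0 ?mxnorm_ge0 ?invr_ge0 ?exprn_ge0// ltW.
Qed.

End Windows.

Section OneSided.
Variables (R : realType) (K : fieldType) (abs : K -> R) (n : nat).
Notation d := n.+2.
Hypothesis locK : is_local_field abs.
Let absP : is_absolute_value abs. Proof. by case: locK. Qed.
Variable nu : probability (mxM abs d) R.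
Hypothesis nu_unit : nu [set g : mxM abs d | g \in unitmx] = 1%E.
Context (dO : measure_display) (Omega : measurableType dO) (P : probability Omega R)
  (gam : nat -> Omega -> mxM abs d).
Hypothesis iid : iid_with_law P gam nu.
Local Notation mxnorm := (mxnorm abs).
Local Notation seg := (segment gam).
Local Notation q := (2 * d)%N.
Variables (m : nat) (u : 'I_q -> 'cV[K]_d) (phi : 'I_q -> 'rV[K]_d)
  (S : 'I_q -> set (mxM abs d)) (e c : R) (p : 'I_q -> R).
Hypothesis m0 : (0 < m)%N.
Hypothesis c0 : 0 < c.
Hypothesis oS : forall i, mxopen abs (S i).
Hypothesis pS : forall s i, P (seg s m @^-1` S i) = (p i)%:E.
Hypothesis p01 : forall i, 0 < p i <= 1.
Hypothesis cu : forall f : 'rV[K]_d, (\sum_i (mxnorm (f *m u i) < e * mxnorm f)%R < d)%N.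
Hypothesis cphi : forall x : 'cV[K]_d, (\sum_i (mxnorm (phi i *m x) < e * mxnorm x)%R < d)%N.
Hypothesis good : forall i g (f : 'rV[K]_d) (x : 'cV[K]_d), S i g ->
  e * mxnorm f <= mxnorm (f *m u i) -> e * mxnorm x <= mxnorm (phi i *m x) ->
  c * (mxnorm f * mxnorm g * mxnorm x) <= mxnorm (f *m g *m x).
Variable N : nat.

Local Notation theta := (1 - weight_gap p).

Definition lnd2 : R := ln (d%:R * d%:R).
Definition cost : R := Num.max 0 (ln (d%:R ^+ 3 / c)).
(** [lnd2 + cost + 1] is the loss in [exists_above_average]; the last [lnd2] converts [lncond] into
    [Ncond]. *)
Definition offset : R := lnd2 + cost + 1 + lnd2.

Definition heavy t k : set (mxM abs d) := [set g | t / (k * m)%:R - offset < Ncond abs g].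

Let cost0 : 0 <= cost. Proof. by rewrite /cost le_max lexx. Qed.

Lemma lncond_term_ge0 (g : 'M[K]_d) : g \in unitmx -> 0 <= lncond abs g + lnd2.
Proof.
move=> ug; have := lncond_lower absP ug; have : 0 <= ln d%:R :> R by rewrite ln_ge0// ler1n.
by rewrite /lnd2 lnM ?posrE//; lra.
Qed.

Let units : set Omega := \bigcap_(i in [set k | (k < N)%N]) (gam i @^-1` [set g | g \in unitmx]).

Let units_measurable : measurable units.
Proof.
have [mg _] := iid; rewrite /units; case: N => [|N'].
  by rewrite (_ : \bigcap_(i in _) _ = setT)// -subTset => w _ i.
apply: bigcap_measurable => [|i _]; first by exists 0%N.
apply: measurable_preimage => //; apply: mxopen_measurable => //; exact: unitmx_open.
Qed.

Let units_null : P (~` units) = 0%E.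
Proof.
have [mg [lg ig]] := iid.
have mu : measurable [set g : mxM abs d | g \in unitmx].
  by apply: mxopen_measurable => //; exact: unitmx_open.
rewrite probability_setC// ig//.
rewrite big1 ?subee// => i _; by rewrite lg.
Qed.

Let units_all w : units w -> forall i, (i < N)%N -> gam i w \in unitmx.
Proof. by move=> h i iN; exact: (h i iN). Qed.

Let KN k : (k < N %/ m)%N -> (k.+1 * m <= N)%N.
Proof. by move=> kK; rewrite (leq_trans _ (leq_trunc_div N m))// leq_mul2r kK orbT. Qed.

(** The [l] letters lie inside a window of [k] blocks; adding [lnd2] makes every term nonnegative,
    so the sum extends to the whole window, where some letter is above average. As [t] exceeds
    [cost], the sum is not empty. *)
Let heavy_window t k (w : Omega) (s l j : nat) : cost < t -> units w -> (s + k * m <= N)%N ->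
  (j + l <= k * m)%N ->
  t <= ln (d%:R ^+ 3 / c) + \sum_(i < l) (lncond abs (gam (s + j + i)%N w) + lnd2) ->
  exists2 i, (i < k * m)%N & heavy t k (gam (s + i)%N w).
Proof.
move=> tc Uw sN jl ht.
pose x i := lncond abs (gam (s + i)%N w).
have x0 i : (i < k * m)%N -> 0 <= x i + lnd2.
  by move=> ik; apply: lncond_term_ge0; apply: units_all => //; lia.
have lncost : ln (d%:R ^+ 3 / c) <= cost by rewrite /cost le_max lexx orbT.
have {}ht : t <= cost + \sum_(i < l) (x (j + i)%N + lnd2).
  by rewrite (le_trans ht)// lerD// le_eqVlt; apply/orP; left; apply/eqP;
     apply: eq_bigr => i _; rewrite /x addnA.
have l0 : (0 < l)%N.
  by rewrite lt0n; apply/eqP => l0; move: ht; rewrite l0 big_ord0 addr0 leNgt tc.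
have ht' : t <= cost + \sum_(i < k * m) (x i + lnd2).
  rewrite (le_trans ht)// lerD2l.
  have kE : (k * m = j + (l + (k * m - (j + l))))%N by lia.
  rewrite -(big_mkord xpredT (fun i => x i + lnd2)) (big_cat_nat (n := j))//=; last by lia.
  rewrite (big_cat_nat (m := j) (n := (j + l)%N))//=; last by lia.
  rewrite [X in _ <= _ + (X + _)](_ : _ = \sum_(i < l) (x (j + i)%N + lnd2)); last first.
    rewrite -[X in \sum_(X <= _ < _) _]add0n big_addn addKn big_mkord.
    by apply: eq_bigr => i _; rewrite addnC.
  have nn a b : (b <= k * m)%N -> 0 <= \sum_(a <= i < b) (x i + lnd2).
    by move=> bk; rewrite big_nat sumr_ge0// => i /andP[_ ib]; apply: x0; lia.
  by rewrite addrCA lerDl addr_ge0// nn//; lia.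
have km0 : (0 < k * m)%N by lia.
have [i ik hi] := exists_above_average km0 cost0 ht'.
exists i => //; rewrite /heavy /= /offset.
have ui : gam (s + i)%N w \in unitmx by apply: units_all => //; lia.
have := lncond_le_Ncond absP ui; rewrite -/(x i) -/lnd2; lra.
Qed.

Lemma measurable_left_event (f : 'rV[K]_d) (v : 'cV[K]_d) t : measurable [set w |
  (mxnorm (f *m seg 0 N w *m v) <= expR (- t) * (mxnorm f * mxnorm (seg 0 N w *m v)))%R].
Proof.
have mE : measurable [set g : mxM abs d | (mxnorm (f *m g *m v) <=
    (expR (- t) * mxnorm f) * mxnorm (1%:M *m g *m v))%R].
  rewrite [X in measurable X](_ : _ = setT `&` (fun g => mxnorm (f *m g *m v) <=
    (expR (- t) * mxnorm f) * mxnorm (1%:M *m g *m v))%R @^-1` [set true]).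
    apply: measurable_fun_ler => //; first exact: measurable_mxnorm_mul.
    by apply: measurable_funM => //; exact: measurable_mxnorm_mul.
  by apply/seteqP; split => g //= [].
have := measurable_segment_preimage locK iid 0 N mE; congr measurable.
by apply/seteqP; split => w; rewrite /preimage /= mul1mx mulrA.
Qed.

Lemma measurable_right_event (f : 'rV[K]_d) (v : 'cV[K]_d) t : measurable [set w |
  (mxnorm (f *m seg 0 N w *m v) <= expR (- t) * (mxnorm (f *m seg 0 N w) * mxnorm v))%R].
Proof.
have mE : measurable [set g : mxM abs d | (mxnorm (f *m g *m v) <=
    (expR (- t) * mxnorm v) * mxnorm (f *m g *m 1%:M))%R].
  rewrite [X in measurable X](_ : _ = setT `&` (fun g => mxnorm (f *m g *m v) <=
    (expR (- t) * mxnorm v) * mxnorm (f *m g *m 1%:M))%R @^-1` [set true]).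
    apply: measurable_fun_ler => //; first exact: measurable_mxnorm_mul.
    by apply: measurable_funM => //; exact: measurable_mxnorm_mul.
  by apply/seteqP; split => g //= [].
have := measurable_segment_preimage locK iid 0 N mE; congr measurable.
by apply/seteqP; split => w; rewrite /preimage /= mulmx1 [mxnorm (_ *m seg 0 N w) * _]mulrC mulrA.
Qed.

Let tail t := ((2 * theta ^+ (N %/ m))%:E +
  \sum_(k < N %/ m) ((k * m)%:R * (4 * theta ^+ k.-1))%:E * nu (heavy t k))%E.

Lemma left_bound (f : 'rV[K]_d) (v : 'cV[K]_d) t : f != 0 -> v != 0 -> cost < t ->
  (P [set w | (mxnorm (f *m seg 0 N w *m v) <= expR (- t) * (mxnorm f * mxnorm (seg 0 N w *m v)))%R]
     <= tail t)%E.
Proof.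
move=> f0 v0 tc; have [mg [lg ig]] := iid.
have /choice[G hG] := fun k => bad_cover locK iid oS pS p01 cu cphi N f v 0 k.
apply: (window_bound mg (b0 := fun=> 0%N) (G := G) (U := units)) => //.
- exact: measurable_left_event.
- by move=> k; case: (hG k).
- by move=> k; exact: measurable_Ncond_gt.
(* Among no blocks none is good, so the covering event for [k = 0] is everything. *)
- by move=> w; apply: contrapT => nG; case: (hG 0%N) => _ /(_ w nG)[j [i []]].
- by case: (hG (N %/ m)%N).
- move=> k i kK ik; case: (hG k) => _ _ _; apply; first exact: measurable_Ncond_gt.
  by rewrite !add0n.
(* Some block [j <= k] is good, and the [j * m] letters before it fit in a window of [k] blocks. *)
- move=> w k EVw Uw kK nG; case: (hG k.+1) => _ /(_ w nG)[j [i [jk Si nl nr]]] _ _.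
  have jN : (0 + j * m + m <= N)%N.
    by rewrite add0n addnC -mulSn (leq_trans _ (KN kK))// leq_mul2r jk orbT.
  have gd : c * (mxnorm (f *m seg 0 (0 + j * m) w) * mxnorm (seg (0 + j * m) m w) *
     mxnorm (seg (0 + j * m + m) (N - (0 + j * m + m)) w *m v)) <=
     mxnorm (f *m seg 0 (0 + j * m) w *m seg (0 + j * m) m w *m
       (seg (0 + j * m + m) (N - (0 + j * m + m)) w *m v)).
    by apply: (good Si); rewrite leNgt; apply/negP.
  have := left_window absP c0 jN (units_all Uw) f0 v0 gd EVw.
  rewrite add0n => h; apply: (@heavy_window t k w 0 (j * m) 0) => //.
  + by rewrite add0n (leq_trans _ (KN kK))// leq_mul2r leqnSn orbT.
  + by rewrite add0n leq_mul2r -ltnS jk orbT.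
Qed.

(** Runs of bad blocks are counted from the right end, so the window of [k] blocks starts at
    [N - k * m]. *)
Lemma right_bound (f : 'rV[K]_d) (v : 'cV[K]_d) t : f != 0 -> v != 0 -> cost < t ->
  (P [set w | (mxnorm (f *m seg 0 N w *m v) <= expR (- t) * (mxnorm (f *m seg 0 N w) * mxnorm v))%R]
     <= tail t)%E.
Proof.
move=> f0 v0 tc; have [mg [lg ig]] := iid.
have /choice[G hG] := fun k => bad_cover locK iid oS pS p01 cu cphi N f v (N - k * m) k.
apply: (window_bound mg (b0 := fun k => (N - k * m)%N) (G := G) (U := units)) => //.
- exact: measurable_right_event.
- by move=> k; case: (hG k).
- by move=> k; exact: measurable_Ncond_gt.
- by move=> w; apply: contrapT => nG; case: (hG 0%N) => _ /(_ w nG)[j [i []]].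
- by case: (hG (N %/ m)%N).
- move=> k i kK ik; case: (hG k) => _ _ _; apply; first exact: measurable_Ncond_gt.
  by rewrite leq_addr ltn_add2l.
- move=> w k EVw Uw kK nG; case: (hG k.+1) => _ /(_ w nG)[j [i [jk Si nl nr]]] _ _.
  have kN := KN kK; set s := (N - k.+1 * m + j * m)%N in Si nl nr.
  have jm : (j * m <= k * m)%N by rewrite leq_mul2r -ltnS jk orbT.
  have jN : (s + m <= N)%N by rewrite /s; move: kN; rewrite mulSn; lia.
  have gd : c * (mxnorm (f *m seg 0 s w) * mxnorm (seg s m w) *
     mxnorm (seg (s + m) (N - (s + m)) w *m v)) <=
     mxnorm (f *m seg 0 s w *m seg s m w *m (seg (s + m) (N - (s + m)) w *m v)).
    by apply: (good Si); rewrite leNgt; apply/negP.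
  have := right_window absP c0 jN (units_all Uw) f0 v0 gd EVw.
  have sE : (s + m = N - k * m + j * m)%N by rewrite /s; move: kN; rewrite mulSn; lia.
  rewrite sE => h; apply: (@heavy_window t k w (N - k * m) _ (j * m)) h => //.
  + by move: kN; rewrite mulSn; lia.
  + by move: kN; rewrite mulSn; lia.
Qed.

End OneSided.

(** * The final estimate *)

Section TailSeries.
Variable R : realType.

Lemma sum_le_nneseries_multiples (a F : nat -> \bar R) q K : (0 < q)%N ->
  (forall k, (0 <= F k)%E) -> (a 0%N <= 0)%E -> (forall k, (0 < k)%N -> (a k <= F (q * k)%N)%E) ->
  (\sum_(k < K) a k <= \sum_(1 <= k <oo) F k)%E.
Proof.
move=> q0 F0 a0 aF.
apply: (@le_trans _ _ (\sum_(1 <= k < (q * K)%N) F k)%E); last first.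
  by apply: nneseries_lim_ge => k _ _; exact: F0.
elim: K => [|K IH]; first by rewrite big_ord0 sume_ge0.
rewrite big_ord_recr /=; have [->|K0] := posnP K.
  by rewrite big_ord0 add0e (le_trans a0)// sume_ge0.
rewrite (big_cat_nat (n := (q * K)%N))//=; [|by rewrite muln_gt0 q0|by rewrite leq_mul2l leqnSn orbT].
apply: leeD => //.
rewrite big_ltn ?ltn_mul2l ?q0 ?ltnSn//.
by apply: (le_trans (aF K K0)); rewrite leeDl// sume_ge0.
Qed.

Variables (theta : R) (m : nat).
Hypothesis th : 2^-1 <= theta < 1.
Hypothesis m0 : (0 < m)%N.
(** Chosen so that the term of index [2 * m * k] has exponential factor [theta ^+ k]: [k] blocks
    have [k * m] letters, and the 2 reflects the halving of [t]. *)
Definition decay_rate : R := - ln theta / (2 * m)%:R.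

Let th0 : 0 < theta. Proof. by case/andP: th => h _; apply: lt_le_trans h; rewrite invr_gt0. Qed.
Let m20 : 0 < (2 * m)%:R :> R. Proof. by rewrite ltr0n muln_gt0. Qed.

Lemma decay_rate_gt0 : 0 < decay_rate.
Proof. by case/andP: th => _ h; rewrite divr_gt0// oppr_gt0 ln_lt0// th0. Qed.

Lemma expR_decay_rate k : expR (- (decay_rate * (2 * m * k)%:R)) = theta ^+ k.
Proof.
rewrite natrM mulrA /decay_rate mulfVK ?gt_eqF// mulNr opprK mulr_natr -lnXn//.
by rewrite lnK// posrE exprn_gt0.
Qed.

(** Only the terms whose index is a multiple of [2 * m] are used. As [theta >= 1/2], one missing
    power of [theta] costs a factor 2, which the 8 covers in both summands. *)
Lemma tail_le_series (A : R) (x y : nat -> \bar R) N : 0 <= A ->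
  (forall k, (0 <= x k)%E) -> (forall k, (0 <= y k)%E) ->
  (forall k, (0 < k)%N -> (x k <= y (2 * m * k)%N)%E) ->
  (A%:E * ((2 * theta ^+ (N %/ m))%:E +
     \sum_(k < N %/ m) ((k * m)%:R * (4 * theta ^+ k.-1))%:E * x k) <=
   (8 * A * expR (- (decay_rate * N%:R)))%:E +
   \sum_(1 <= k <oo) (8 * A * expR (- (decay_rate * k%:R)) * k%:R)%:E * y k)%E.
Proof.
move=> A0 x0 y0 xy; case/andP: (th) => th2 _.
have F0 k : (0 <= (8 * A * expR (- (decay_rate * k%:R)) * k%:R)%:E * y k)%E.
  by rewrite mule_ge0// lee_fin !mulr_ge0// expR_ge0.
rewrite muleDr// ?fin_num_adde_defr//; apply: leeD.
  rewrite -EFinM lee_fin.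
  have : theta ^+ (N %/ m).+1 <= expR (- (decay_rate * N%:R)).
    rewrite -expR_decay_rate ler_expR lerN2 ler_pM2l ?decay_rate_gt0// ler_nat.
    by have := ltn_ceil N m0; lia.
  have t0 := exprn_gt0 (N %/ m) th0.
  rewrite exprS => h; rewrite [8 * A]mulrC -mulrA; apply: ler_wpM2l => //; nra.
rewrite ge0_sume_distrr => [|k _]; last first.
  by rewrite mule_ge0// lee_fin !mulr_ge0// exprn_ge0// ltW.
apply: (sum_le_nneseries_multiples
  (a := fun k => (A%:E * (((k * m)%:R * (4 * theta ^+ k.-1))%:E * x k))%E)
  (q := (2 * m)%N)) => //.
- by rewrite muln_gt0.
- by rewrite mul0n mul0r mul0e mule0.
move=> [//|k] _; rewrite muleA -EFinM; apply: lee_pmul => //; last exact: xy.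
  by rewrite lee_fin !mulr_ge0// exprn_ge0// ltW.
rewrite lee_fin expR_decay_rate -mulnA (mulnC m) (natrM _ 2) exprS /=.
have := exprn_gt0 k th0; set z := theta ^+ k; set r := (_ * m)%:R => z0.
have p : 0 <= A * r * z by rewrite !mulr_ge0// ltW.
have : 0 <= 2 * theta - 1 by lra.
move=> /(mulr_ge0 p); lra.
Qed.

End TailSeries.

Section Deterministic.
Variables (R : realType) (K : fieldType) (abs : K -> R) (n : nat).
Notation d := n.+2.
Hypothesis absP : is_absolute_value abs.
Local Notation mxnorm := (mxnorm abs).

(* Contrapositive: if [|e_i g v|] is comparable to [|e_i g||v|] for every i, then
   [|g v|] is comparable to [|g||v|], so that it remains to compare [|f g v|] with
   [|f||g v|]. *)
Lemma corr_event_cover (f : 'rV[K]_d) (g : 'M[K]_d) (v : 'cV[K]_d) (t s : R) :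
  f != 0 -> v != 0 -> 2 * s + ln (d%:R ^+ 4) <= t ->
  corr_ratio abs f g v = 0 \/ t <= - ln (corr_ratio abs f g v) ->
  mxnorm (f *m g *m v) <= expR (- s) * (mxnorm f * mxnorm (g *m v)) \/
  exists i : 'I_d, mxnorm ((delta_mx 0 i : 'rV[K]_d) *m g *m v) <=
    expR (- s) * (mxnorm ((delta_mx 0 i : 'rV[K]_d) *m g) * mxnorm v).
Proof.
move=> f0 v0 st corr; apply: contrapT => /not_orP[/negP]; rewrite -ltNge => hf.
move=> /forallNP hi.
have {}hi i : expR (- s) * (mxnorm ((delta_mx 0 i : 'rV[K]_d) *m g) * mxnorm v) <
    mxnorm ((delta_mx 0 i : 'rV[K]_d) *m g *m v) by rewrite ltNge; apply/negP/hi.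
have s0 := expR_gt0 (- s).
have nf : 0 < mxnorm f by rewrite mxnorm_gt0.
have nv : 0 < mxnorm v by rewrite mxnorm_gt0.
have gv : expR (- s) * mxnorm v * mxnorm g <= mxnorm (g *m v).
  rewrite mulrC -ler_pdivlMr ?mulr_gt0//; apply: mxnorm_leP => [|i j].
    by rewrite divr_ge0 ?mxnorm_ge0// ltW// mulr_gt0.
  rewrite ler_pdivlMr ?mulr_gt0//.
  have a1 : abs (g i j) <= mxnorm ((delta_mx 0 i : 'rV[K]_d) *m g).
    by rewrite -rowE; have := abs_le_mxnorm abs (row i g) 0 j; rewrite mxE.
  have a2 : mxnorm ((delta_mx 0 i : 'rV[K]_d) *m g *m v) <= mxnorm (g *m v).
    rewrite -mulmxA -rowE; apply: mxnorm_leP; first exact: mxnorm_ge0.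
    by move=> k l; rewrite mxE; exact: abs_le_mxnorm.
  have := hi i; have := ler_wpM2l (ltW (mulr_gt0 s0 nv)) a1; lra.
have fgv0 : 0 < mxnorm (f *m g *m v).
  by apply: le_lt_trans hf; rewrite !mulr_ge0 ?mxnorm_ge0 ?expR_ge0.
have g0 : 0 < mxnorm g.
  rewrite mxnorm_gt0//; apply/eqP => g0; move: fgv0.
  by rewrite g0 mulmx0 mul0mx mxnorm0 ?ltxx.
have op0 : 0 < opnorm abs g by have := mxnorm_le_opnorm absP g; have : 0 < d%:R :> R by []; nra.
set D := dualnorm abs f * opnorm abs g * vnorm abs v.
have D0 : 0 < D by rewrite !mulr_gt0 ?dualnorm_gt0 ?vnorm_gt0.
(* One factor [d] from the dual norm, two from the operator norm, one from the vector norm. *)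
have DE : D <= d%:R ^+ 4 * (mxnorm f * mxnorm g * mxnorm v).
  have h1 := dualnorm_le_mxnorm absP f; have h2 := opnorm_le_mxnorm absP g.
  have h3 := vnorm_le_mxnorm absP v.
  have dn0 := ltW (dualnorm_gt0 absP f0); have vn0 := ltW (vnorm_gt0 absP v0).
  have := ler_pM (mulr_ge0 dn0 (ltW op0)) vn0 (ler_pM dn0 (ltW op0) h1 h2) h3.
  move=> /le_trans; apply.
  by rewrite le_eqVlt; apply/orP; left; apply/eqP; ring.
have big : expR (- t) * D < mxnorm (f *m g *m v).
  apply: le_lt_trans hf.
  have : expR (- t) <= expR (- s) * expR (- s) / d%:R ^+ 4.
    rewrite -expRD -[d%:R ^+ 4]lnK ?posrE ?exprn_gt0// -expRN -expRD ler_expR; lra.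
  rewrite ler_pdivlMr ?exprn_gt0// => ht.
  have := ler_wpM2l (expR_ge0 (- t)) DE => /le_trans; apply.
  have p : 0 <= mxnorm f * mxnorm g * mxnorm v by rewrite !mulr_ge0 ?mxnorm_ge0.
  have := ler_wpM2r p ht; have := ler_wpM2l (ltW (mulr_gt0 s0 nf)) gv; lra.
have : expR (- t) < corr_ratio abs f g v.
  by rewrite /corr_ratio -/D ltr_pdivlMr// -(mxnorm11 absP).
move=> h; have c0 := lt_trans (expR_gt0 _) h.
case: corr => [z|]; first by rewrite z ltxx in c0.
by rewrite leNgt => /negP; apply; rewrite ltrNl -(expRK (- t)) ltr_ln ?posrE ?expR_gt0.
Qed.

End Deterministic.

Section CorrBound.
Variables (R : realType) (K : fieldType) (abs : K -> R) (n : nat).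
Notation d := n.+2.
Hypothesis locK : is_local_field abs.
Let absP : is_absolute_value abs. Proof. by case: locK. Qed.
Variable nu : probability (mxM abs d) R.
Hypothesis nu_unit : nu [set g : mxM abs d | g \in unitmx] = 1%E.
Context (dO : measure_display) (Omega : measurableType dO) (P : probability Omega R)
  (gam : nat -> Omega -> mxM abs d).
Hypothesis iid : iid_with_law P gam nu.
Local Notation mxnorm := (mxnorm abs).
Local Notation seg := (segment gam).
Local Notation q := (2 * d)%N.
Variables (m : nat) (u : 'I_q -> 'cV[K]_d) (phi : 'I_q -> 'rV[K]_d)
  (S : 'I_q -> set (mxM abs d)) (e c : R) (p : 'I_q -> R).
Hypothesis m0 : (0 < m)%N.
Hypothesis c0 : 0 < c.
Hypothesis oS : forall i, mxopen abs (S i).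
Hypothesis pS : forall s i, P (seg s m @^-1` S i) = (p i)%:E.
Hypothesis p01 : forall i, 0 < p i <= 1.
Hypothesis cu : forall f : 'rV[K]_d, (\sum_i (mxnorm (f *m u i) < e * mxnorm f)%R < d)%N.
Hypothesis cphi : forall x : 'cV[K]_d, (\sum_i (mxnorm (phi i *m x) < e * mxnorm x)%R < d)%N.
Hypothesis good : forall i g (f : 'rV[K]_d) (x : 'cV[K]_d), S i g ->
  e * mxnorm f <= mxnorm (f *m u i) -> e * mxnorm x <= mxnorm (phi i *m x) ->
  c * (mxnorm f * mxnorm g * mxnorm x) <= mxnorm (f *m g *m x).

(** [offset + ln (d ^ 4)] serves large [t]. The other terms let the shifted threshold for [k = 1]
    fall below [- ln d - lnd2], a lower bound of [Ncond] on invertible matrices, when [t] is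
    small. *)
Definition corr_shift : R := offset n c + 2 * cost n c + ln (d%:R ^+ 4) + lnd2 R n + ln d%:R.

Local Notation theta := (1 - weight_gap p).
Local Notation beta := (decay_rate theta m).
Local Notation C := (8 * d.+1%:R).

Let th : 2^-1 <= theta < 1.
Proof.
have q2 : (1 < q)%N by [].
by have := weight_gap_le p01 q2; have := weight_gap_gt0 p01 q2; lra.
Qed.

Let cost0 : 0 <= cost n c. Proof. by rewrite /cost le_max lexx. Qed.
Let lnd0 : 0 <= ln d%:R :> R. Proof. by rewrite ln_ge0// ler1n. Qed.
Let lnd20 : 0 <= lnd2 R n. Proof. by rewrite /lnd2 lnM ?posrE// addr_ge0. Qed.
Let lnd40 : 0 <= ln (d%:R ^+ 4) :> R. Proof. by rewrite lnXn// mulrn_wge0. Qed.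

Lemma corr_shift_gt0 : 0 < corr_shift.
Proof.
rewrite /corr_shift /offset; have := cost0; have := lnd0; have := lnd20; have := lnd40.
by set a := ln _; set b := ln d%:R; lra.
Qed.

Let bound_series t := (\sum_(1 <= k <oo) (C * expR (- (beta * k%:R)) * k%:R)%:E *
  nu [set g : mxM abs d | (t / k%:R - corr_shift < Ncond abs g)%R])%E.

Let term0 t k : (0 <= (C * expR (- (beta * k%:R)) * k%:R)%:E *
  nu [set g : mxM abs d | (t / k%:R - corr_shift < Ncond abs g)%R])%E.
Proof. by rewrite mule_ge0// lee_fin !mulr_ge0// expR_ge0. Qed.

(** Covers the range of [t] where the halved parameter does not exceed [cost]: the term [k = 1] has
    full mass and a coefficient at least 1. *)
Let small_t t : t <= 2 * cost n c + ln (d%:R ^+ 4) -> (1 <= bound_series t)%E.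
Proof.
move=> ht.
have mu : measurable [set g : mxM abs d | g \in unitmx].
  by apply: mxopen_measurable => //; exact: unitmx_open.
have full : (1 <= nu [set g : mxM abs d | (t / 1%:R - corr_shift < Ncond abs g)%R])%E.
  rewrite -nu_unit; apply: le_measure; rewrite ?inE//; first exact: measurable_Ncond_gt.
  move=> g /= ug; have := lncond_lower absP ug; have := lncond_le_Ncond absP ug.
  move: ht cost0 lnd0 lnd20 lnd40; rewrite -/(lnd2 R n) /corr_shift /offset divr1.
  by move: (ln _) (ln _) (lnd2 _ _) (cost _ _) (lncond _ _) (Ncond _ _) => *; lra.
apply: (@le_trans _ _ (\sum_(1 <= k < 2) (C * expR (- (beta * k%:R)) * k%:R)%:E *
  nu [set g : mxM abs d | (t / k%:R - corr_shift < Ncond abs g)%R])%E); last first.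
  by apply: nneseries_lim_ge => k _ _.
rewrite big_nat1 -[leLHS]mule1; apply: lee_pmul => //.
rewrite lee_fin mulr1.
have : theta <= expR (- (beta * 1%:R)).
  rewrite -[leLHS]expr1 -(expR_decay_rate th m0) ler_expR lerN2 ler_pM2l ?decay_rate_gt0//.
  by rewrite ler_nat muln1; lia.
have : 1 <= d.+1%:R :> R by rewrite ler1n.
case/andP: th => h1 h2; nra.
Qed.

Lemma corr_event_bound (f : 'rV[K]_d) (v : 'cV[K]_d) N t : f != 0 -> v != 0 -> 0 <= t ->
  (P [set w | (corr_ratio abs f (seg 0 N w) v = 0 \/
        t <= - ln (corr_ratio abs f (seg 0 N w) v))%R]
     <= (C * expR (- (beta * N%:R)))%:E + bound_series t)%E.
Proof.
move=> f0 v0 t0.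
have mE := measurable_segment_preimage locK iid 0 N (measurable_corr_event locK t f0 v0).
have [ht|ht] := leP t (2 * cost n c + ln (d%:R ^+ 4)).
  apply: (le_trans (probability_le1 P mE)); apply: (le_trans (small_t ht)).
  by rewrite leeDr// lee_fin mulr_ge0// expR_ge0.
pose s := (t - ln (d%:R ^+ 4)) / 2.
have sc : cost n c < s by rewrite /s; lra.
have hs : 2 * s + ln (d%:R ^+ 4) <= t by rewrite /s; lra.
pose T := ((2 * theta ^+ (N %/ m))%:E +
  \sum_(k < N %/ m) ((k * m)%:R * (4 * theta ^+ k.-1))%:E * nu (@heavy R K abs n m c s k))%E.
pose L := [set w | mxnorm (f *m seg 0 N w *m v) <=
  expR (- s) * (mxnorm f * mxnorm (seg 0 N w *m v))].
pose Ri (i : nat) := [set w | mxnorm ((delta_mx 0 (inord i) : 'rV[K]_d) *m seg 0 N w *m v) <=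
  expR (- s) * (mxnorm ((delta_mx 0 (inord i) : 'rV[K]_d) *m seg 0 N w) * mxnorm v)].
have PL : (P L <= T)%E.
  exact: (left_bound locK nu_unit iid m0 c0 oS pS p01 cu cphi good N f0 v0 sc).
have PR i : (P (Ri i) <= T)%E.
  apply: (right_bound locK nu_unit iid m0 c0 oS pS p01 cu cphi good N _ v0 sc).
  by apply/eqP => /matrixP /(_ 0 (inord i)) /eqP; rewrite !mxE !eqxx oner_eq0.
have mL : measurable L by exact: (measurable_left_event locK iid).
have mR i : measurable (Ri i) by exact: (measurable_right_event locK iid).
have sub : [set w | (corr_ratio abs f (seg 0 N w) v = 0 \/
        t <= - ln (corr_ratio abs f (seg 0 N w) v))%R] `<=` L `|` \big[setU/set0]_(i < d) Ri i.
  move=> w /= /(corr_event_cover absP f0 v0 hs)[|[i hi]]; [by left|right].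
  by rewrite -(bigcup_mkord d Ri); exists i => //=; rewrite /Ri /= inord_val.
have mRR : measurable (\big[setU/set0]_(i < d) Ri i) by apply: bigsetU_measurable.
apply: (@le_trans _ _ (P (L `|` \big[setU/set0]_(i < d) Ri i))).
  by apply: le_measure; rewrite ?inE//; exact: measurableU.
(* One left event for [f] and one right event for each of the d coordinate forms. *)
apply: (@le_trans _ _ (d.+1%:R%:E * T)%E).
  apply: (le_trans (measureU2 _ mL mRR)).
  rewrite -nat1r EFinD ge0_muleDl ?lee_fin// mul1e; apply: leeD => //.
  apply: (le_trans (Boole_inequality _ (fun i _ => mR i))).
  apply: (@le_trans _ _ (\sum_(i < d) T)%E); first by apply: lee_sum => i _; exact: PR.
  by rewrite sume_const.
apply: (tail_le_series th m0 N (x := fun k => nu (@heavy R K abs n m c s k))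
  (y := fun k => nu [set g : mxM abs d | (t / k%:R - corr_shift < Ncond abs g)%R])) => //.
move=> k k0; apply: le_measure; rewrite ?inE; [exact: measurable_Ncond_gt..|].
move=> g; rewrite /heavy /=; apply: le_lt_trans.
have -> : (2 * m * k)%:R = 2 * (k * m)%:R :> R by rewrite -mulnA (mulnC m) natrM.
have : 1 <= (k * m)%:R :> R by rewrite ler1n muln_gt0 k0.
rewrite /s /corr_shift; move: cost0 lnd0 lnd20 lnd40.
move: (ln (d%:R ^+ 4)) (ln d%:R) (lnd2 _ _) (cost _ _) (offset _ _) (k * m)%:R.
move=> a b b2 c1 o r c10 b0 b20 a0 r1.
have r0 : 0 < r by lra.
have -> : t / (2 * r) = (t - a) / 2 / r + a / 2 / r by field; lra.
suff : a / 2 / r <= a by lra.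
by rewrite ler_pdivrMr//; nra.
Qed.

End CorrBound.

Theorem theorem5p9 (R : realType) (K : fieldType) (abs : K -> R) (d : nat)
    (nu : probability (mxM abs d) R) :
  is_local_field abs -> (2 <= d)%N ->
  nu [set g : mxM abs d | g \in unitmx] = 1%E ->
  strongly_irreducible nu -> proximal nu ->
  exists C D beta : R, 0 < C /\ 0 < D /\ 0 < beta /\
  forall (dO : measure_display) (Omega : measurableType dO)
    (P : probability Omega R) (gam : nat -> Omega -> mxM abs d),
    iid_with_law P gam nu ->
    forall (f : 'rV[K]_d) (v : 'cV[K]_d) (n : nat) (t : R),
      f != 0 -> v != 0 -> 0 <= t ->
      (P [set w | (corr_ratio abs f (rprod (fun i => gam i w) n) v = 0 \/
                   t <= - ln (corr_ratio abs f (rprod (fun i => gam i w) n) v))%R]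
       <= (C * expR (- (beta * n%:R)))%:E +
          \sum_(1 <= k <oo)
             ((C * expR (- (beta * k%:R)) * k%:R)%:E *
              nu [set g : mxM abs d | (t / k%:R - D < Ncond abs g)%R]))%E.
Proof.
case: d nu => [|[|n]] nu locK // _ nu_unit irr prox.
(* The constants are read off from one space carrying such letters; if there is none, the claim is
   vacuous. *)
have [hex|none] := pselect (exists (dO : measure_display)
    (Omega : measurableType dO) (P : probability Omega R) (gam : nat -> Omega -> mxM abs n.+2),
    iid_with_law P gam nu); last first.
  exists 1, 1, 1; do 3 split => //; move=> dO Omega P gam iid.
  by exfalso; apply: none; exists dO, Omega, P, gam.
case: hex => disp [Om [P [gam iid]]].
have [m [u [phi [S [e [c [m0 c0 oS [cu cphi] good]]]]]]] := schottky_exists locK iid irr prox.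
have mS i : measurable (S i) by apply: (mxopen_measurable locK); case: (oS i).
pose p i := fine (P (segment gam 0 m @^-1` S i)).
have mseg i : measurable (segment gam 0 m @^-1` S i).
  apply: (measurable_segment_preimage locK iid); exact: mS.
have pE i : (p i)%:E = P (segment gam 0 m @^-1` S i).
  by rewrite /p fineK// fin_num_measure.
have p01 i : 0 < p i <= 1.
  by rewrite -lte_fin -lee_fin pE probability_le1// andbT; case: (oS i).
have q2 : (1 < 2 * n.+2)%N by [].
have th : 2^-1 <= 1 - weight_gap p < 1.
  by have := weight_gap_le p01 q2; have := weight_gap_gt0 p01 q2; lra.
exists (8 * n.+3%:R), (corr_shift n c), (decay_rate (1 - weight_gap p) m).
split; first by rewrite mulr_gt0.
split; first exact: corr_shift_gt0.
split; first exact: decay_rate_gt0.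
move=> dO' Omega' P' gam' iid' f v N t f0 v0 t0.
apply: (corr_event_bound locK nu_unit iid' m0 c0 _ _ p01 cu cphi good) => // [i|s i].
  by case: (oS i).
by rewrite (segment_law locK s 0 m iid' iid (mS i)) pE.
Qed.
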